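(* Let $A=\mathbb{F}_q[t]$, $F=\mathbb{F}_q(t)$, $n\ge1$ and $r\ge1$. Then: (a) The elements $f_1,\ldots,f_r\in R_n$ are algebraically independent over $F$. (b) Each $\Delta_k$ and $E_k$ ($1\le k\le r$) is a subset of $R_n$ of cardinality $q^{r(n-1)+k-1}$. (c) The product induces bijective maps $\Delta_1\times\cdots\times\Delta_r\to\Delta_1\cdots\Delta_r\subset R_n$ and $E_1\times\cdots\times E_r\to E_1\cdots E_r\subset R_n$. (d) The ring $R_n$ is a free module over $F[f_1,\ldots,f_r]$ with basis $\Delta_1\cdots\Delta_r$. (e) We have $R_n^U=F[f_1,\ldots,f_r]$. (f) As an $F$-vector space $R_n$ decomposes as $$R_n\ =\bigoplus_{I\subset\{1,\ldots,r\}}\ \bigoplus_{e\in E_I}F[f_k|_{k\in I}]\cdot e.$$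
   Context: $\mathbb{F}_q$ is a finite field with $q$ elements, $A=\mathbb{F}_q[t]$, $F=\mathbb{F}_q(t)$. For $0\le\nu\le n$ put $V_\nu=(t^{-\nu}A/A)^{\oplus r}$, so $V_0=0$ and $V_\nu\subset V_n$ is the $t^\nu$-torsion submodule. For a finite dimensional $\mathbb{F}_q$-vector space $V$ let $K_V$ be the field of quotients of the symmetric algebra of $V$ over $\mathbb{F}_q$, and $R_V\subset K_V$ the $\mathbb{F}_q$-subalgebra generated by the elements $\frac1v$ for all $v\in V\setminus\{0\}$. $R_n$ is the factor ring of $R_{V_n}\otimes_{\mathbb{F}_q}F$ by the ideal generated by the elements $\frac{1}{av}\otimes a-\sum_{v'\in V_\nu}\frac{1}{v-v'}\otimes1$ for all $a=\alpha t^\nu$ with $\alpha\in\mathbb{F}_q^\times$, $0\le\nu\le n$, and all $v\in V_n\setminus V_\nu$. $[f]$ denotes the image of $f$ in $R_n$. Let $b_1,\dots,b_r$ be the standard basis and $X_{k,n}\in V_n$ the class of $t^{-n}b_k$. Let $V'_{k,n}\subset V_n$ be the $\mathbb{F}_q$-subspace which is the direct sum of $V_{n-1}$ and the $\mathbb{F}_q$-span of $X_{1,n},\dots,X_{k-1,n}$. Define, in $R_n$, $$\Delta_k=\Bigl\{\bigl[\tfrac{1}{X_{k,n}+w}\otimes1\bigr]\Bigm|w\in V'_{k,n}\setminus\{0\}\Bigr\}\cup\{1\},\qquad E_k=\Bigl\{\bigl[\tfrac{1}{X_{k,n}+w}\otimes1\bigr]\Bigm|w\in V'_{k,n}\Bigr\},\qquad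 f_k=\sum_{w\in V'_{k,n}}\bigl[\tfrac{1}{X_{k,n}+w}\otimes1\bigr].$$ For subsets of $R_n$, $\Delta_1\cdots\Delta_r=\{e_1\cdots e_r\mid e_k\in\Delta_k\}$, similarly $E_1\cdots E_r$; for $I\subset\{1,\dots,r\}$, $E_I=\prod_{k\in I}E_k$ (the set of products, with $E_\emptyset=\{1\}$), and $F[f_k|_{k\in I}]$ is the $F$-subalgebra generated by the $f_k$ with $k\in I$. $U<\mathrm{GL}_r(\mathbb{F}_q[t]/(t^n))$ is the subgroup of matrices congruent modulo $(t)$ to an upper triangular matrix with all diagonal entries $1$. $\mathrm{GL}_r(\mathbb{F}_q[t]/(t^n))$ acts on $V_n$ (viewed as a space of column vectors) by left multiplication and hence on $R_n$ by $F$-algebra automorphisms $[\frac1v\otimes1]\mapsto[\frac1{gv}\otimes1]$; $R_n^U$ is the ring of $U$-invariants. *)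

(* Defs.v *)
From HB Require Import structures.
From mathcomp Require Import all_boot all_order all_algebra.
From mathcomp Require Import generic_quotient ring_quotient boolp.
From mathcomp Require Import ring finmap mpoly.

Set Implicit Arguments.
Unset Strict Implicit.
Unset Printing Implicit Defensive.

Import GRing.Theory.
Local Open Scope ring_scope.
Local Open Scope quotient_scope.

Local Notation "x %:F" := (tofrac x) : ring_scope.

(** [A] is viewed as a [k]-algebra through [i]. *)
Definition gen_subalg (k A : pzRingType) (i : k -> A) (S : A -> Prop) (x : A) :
    Prop :=
  forall P : A -> Prop,
    (forall c, P (i c)) -> (forall s, S s -> P s) ->
    (forall y z, P y -> P z -> P (y - z)) ->
    (forall y z, P y -> P z -> P (y * z)) -> P x.

Definition gen_ideal (A : pzRingType) (S : A -> Prop) (x : A) : Prop :=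
  forall J : A -> Prop,
    J 0 -> (forall s, S s -> J s) ->
    (forall y z, J y -> J z -> J (y + z)) ->
    (forall a y, J y -> J (a * y)) -> J x.

(** Tensor product of commutative algebras [f : R -> A] and [g : R -> B]:
    finite formal sums of pairs [(a, b)] modulo the least congruence making
    [(a, b)] additive in each variable and [R]-balanced. *)
Section Tensor.
Variables (R A B : comNzRingType).
Variables (f : {rmorphism R -> A}) (g : {rmorphism R -> B}).

Inductive tens_eq : seq (A * B) -> seq (A * B) -> Prop :=
| te_refl s : tens_eq s s
| te_sym s t : tens_eq s t -> tens_eq t s
| te_trans s t u : tens_eq s t -> tens_eq t u -> tens_eq s u
| te_cat s s' t t' : tens_eq s s' -> tens_eq t t' -> tens_eq (s ++ t) (s' ++ t')
| te_comm s t : tens_eq (s ++ t) (t ++ s)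
| te_zero b : tens_eq [:: (0, b)] [::]
| te_addl a a' b : tens_eq [:: (a + a', b)] [:: (a, b); (a', b)]
| te_addr a b b' : tens_eq [:: (a, b + b')] [:: (a, b); (a, b')]
| te_bal c a b : tens_eq [:: (f c * a, b)] [:: (a, g c * b)].

Definition tens_rel : rel (seq (A * B)) := fun s t => `[< tens_eq s t >].

Fact tens_rel_equiv : equiv_class_of tens_rel.
Proof.
split=> [s|s t|t s u]; first by apply/asboolP; exact: te_refl.
  by apply/asboolP/asboolP; exact: te_sym.
by move=> /asboolP h1 /asboolP h2; apply/asboolP; exact: te_trans h1 h2.
Qed.
Canonical tens_rel_equivRel := EquivRelPack tens_rel_equiv.
Canonical tens_rel_encModRel := defaultEncModRel tens_rel.

Definition tensor := {eq_quot tens_rel}.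
HB.instance Definition _ := EqQuotient.on tensor.
HB.instance Definition _ := Choice.on tensor.

Definition tclass (s : seq (A * B)) : tensor := \pi s.

Lemma tclassP s t : tens_eq s t <-> tclass s = tclass t.
Proof.
rewrite /tclass; split=> [h|/eqP]; first by apply/eqP; rewrite piE; apply/asboolP.
by rewrite piE => /asboolP.
Qed.

Lemma tclass_repr x : tclass (repr x) = x. Proof. exact: reprK. Qed.

Lemma tens_repr s : tens_eq (repr (tclass s)) s.
Proof. by apply/tclassP; rewrite tclass_repr. Qed.

Definition toppseq (s : seq (A * B)) := [seq (- p.1, p.2) | p <- s].
Definition tmulseq (s t : seq (A * B)) :=
  [seq (p.1 * p'.1, p.2 * p'.2) | p <- s, p' <- t].

Lemma te_oppr s : tens_eq (toppseq s ++ s) [::].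
Proof.
elim: s => [|[a b] s ih] /=; first exact: te_refl.
have h : tens_eq [:: (- a, b); (a, b)] [::].
  apply: te_trans (te_sym (te_addl _ _ _)) _; rewrite addNr; exact: te_zero.
apply: te_trans (te_cat (te_refl [:: (- a, b)]) (te_comm _ ((a, b) :: s))) _.
rewrite /= -[X in tens_eq X _]/([:: (- a, b); (a, b)] ++ (s ++ toppseq s)).
apply: (te_trans (te_cat h (te_comm _ _))); exact: ih.
Qed.

Lemma te_opp s t : tens_eq s t -> tens_eq (toppseq s) (toppseq t).
Proof.
rewrite /toppseq; elim=> {s t}.
- by move=> s; exact: te_refl.
- by move=> s t _; exact: te_sym.
- by move=> s t u _ h1 _ h2; exact: te_trans h1 h2.
- by move=> s s' t t' _ h1 _ h2; rewrite !map_cat; exact: te_cat.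
- by move=> s t; rewrite !map_cat; exact: te_comm.
- by move=> b /=; rewrite oppr0; exact: te_zero.
- by move=> a a' b /=; rewrite opprD; exact: te_addl.
- by move=> a b b' /=; exact: te_addr.
- by move=> c a b /=; rewrite -mulrN; exact: te_bal.
Qed.

Lemma te_mulC s t : tens_eq (tmulseq s t) (tmulseq t s).
Proof.
have te_perm (u v : seq (A * B)) : perm_eq u v -> tens_eq u v.
  elim: u v => [|x u ih] v.
    by rewrite perm_sym => /perm_nilP ->; exact: te_refl.
  move=> h; have xv : x \in v by rewrite -(perm_mem h) mem_head.
  case/splitPr: xv h => v1 v2 h.
  apply: (te_trans (t := x :: (v1 ++ v2))).
    apply: (te_cat (te_refl [:: x])); apply: ih.
    by move: h; rewrite perm_sym -cat1s perm_catCA /= perm_cons perm_sym.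
  rewrite -cat1s -[x :: v2]cat1s !catA.
  by apply: te_cat; [exact: te_comm | exact: te_refl].
apply: te_perm; elim: t => [|x t ih]; first by elim: s.
rewrite /tmulseq (perm_allpairs_consr _ s (fun=> x) (fun=> t)) /= perm_cat //.
rewrite (_ : [seq _ | p <- s] = [seq (x.1 * p.1, x.2 * p.2) | p <- s]) //.
by apply: eq_map => p; rewrite mulrC [_.2 * _]mulrC.
Qed.

Lemma tmulseq_catl s s' t : tmulseq (s ++ s') t = tmulseq s t ++ tmulseq s' t.
Proof. by rewrite /tmulseq allpairs_cat. Qed.

Lemma te_mid p s t : tens_eq (p :: (s ++ t)) (s ++ p :: t).
Proof.
rewrite -cat1s -[p :: t]cat1s !catA.
by apply: te_cat; [exact: te_comm | exact: te_refl].
Qed.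

Lemma te_mull s s' t : tens_eq s s' -> tens_eq (tmulseq s t) (tmulseq s' t).
Proof.
elim=> {s s'}.
- by move=> s; exact: te_refl.
- by move=> s u _; exact: te_sym.
- by move=> s u v _ h1 _ h2; exact: te_trans h1 h2.
- by move=> s s' u u' _ h1 _ h2; rewrite !tmulseq_catl; exact: te_cat.
- by move=> s u; rewrite !tmulseq_catl; exact: te_comm.
- move=> b; elim: t => [|[x y] t ih] /=; first exact: te_refl.
  by rewrite /tmulseq /= !cats0 mul0r in ih *; exact: (te_cat (te_zero _) ih).
- move=> a a' b; elim: t => [|[x y] t ih] /=; first exact: te_refl.
  rewrite /tmulseq /= !cats0 mulrDl in ih *.
  apply: te_trans (te_cat (te_addl _ _ _) ih) _.
  by rewrite /= -[(a * x, _) :: (a' * x, _) :: _]cat1s -[X in tens_eq _ X]cat1s;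
    apply: te_cat; [exact: te_refl | exact: te_mid].
- move=> a b b'; elim: t => [|[x y] t ih] /=; first exact: te_refl.
  rewrite /tmulseq /= !cats0 mulrDl in ih *.
  apply: te_trans (te_cat (te_addr _ _ _) ih) _.
  by rewrite /= -[(_, b * y) :: (_, b' * y) :: _]cat1s -[X in tens_eq _ X]cat1s;
    apply: te_cat; [exact: te_refl | exact: te_mid].
- move=> c a b; elim: t => [|[x y] t ih] /=; first exact: te_refl.
  rewrite /tmulseq /= !cats0 -!mulrA in ih *.
  exact: (te_cat (te_bal _ _ _) ih).
Qed.

Lemma te_mul s s' t t' : tens_eq s s' -> tens_eq t t' ->
  tens_eq (tmulseq s t) (tmulseq s' t').
Proof.
move=> h1 h2; apply: te_trans (te_mull t h1) _.
apply: te_trans (te_mulC _ _) _; apply: te_trans (te_mull _ h2) _.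
exact: te_mulC.
Qed.

Definition tadd (x y : tensor) := tclass (repr x ++ repr y).
Definition topp (x : tensor) := tclass (toppseq (repr x)).
Definition tmul (x y : tensor) := tclass (tmulseq (repr x) (repr y)).

Lemma taddE s t : tadd (tclass s) (tclass t) = tclass (s ++ t).
Proof. by apply/tclassP/te_cat; exact: tens_repr. Qed.
Lemma toppE s : topp (tclass s) = tclass (toppseq s).
Proof. by apply/tclassP/te_opp; exact: tens_repr. Qed.
Lemma tmulE s t : tmul (tclass s) (tclass t) = tclass (tmulseq s t).
Proof. by apply/tclassP/te_mul; exact: tens_repr. Qed.

Fact taddA : associative tadd.
Proof.
move=> x y z; rewrite -(tclass_repr x) -(tclass_repr y) -(tclass_repr z).
by rewrite !taddE catA.
Qed.
Fact taddC : commutative tadd.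
Proof. by move=> x y; apply/tclassP; exact: te_comm. Qed.
Fact tadd0 : left_id (tclass [::]) tadd.
Proof. by move=> x; rewrite -(tclass_repr x) taddE. Qed.
Fact taddN : left_inverse (tclass [::]) topp tadd.
Proof.
by move=> x; rewrite -(tclass_repr x) toppE taddE; apply/tclassP; exact: te_oppr.
Qed.
Fact tmulA : associative tmul.
Proof.
move=> x y z; rewrite -(tclass_repr x) -(tclass_repr y) -(tclass_repr z).
rewrite !tmulE; congr tclass; elim: (repr x) => // p s ih.
rewrite /tmulseq /= -!/(tmulseq _ _) tmulseq_catl -ih; congr cat.
elim: (repr y) => //= p' s' ih'; rewrite -cat1s tmulseq_catl map_cat ih'.
congr cat; rewrite /tmulseq /= cats0 -!map_comp; apply: eq_map => q /=.
by rewrite !mulrA.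
Qed.
Fact tmulC : commutative tmul.
Proof. by move=> x y; apply/tclassP; exact: te_mulC. Qed.
Fact tmul1 : left_id (tclass [:: (1, 1)]) tmul.
Proof.
move=> x; rewrite -(tclass_repr x) tmulE; congr tclass.
rewrite /tmulseq /= cats0 -[RHS]map_id; apply: eq_map => -[a b].
by rewrite /= !mul1r.
Qed.
Fact tmulDl : left_distributive tmul tadd.
Proof.
move=> x y z; rewrite -(tclass_repr x) -(tclass_repr y) -(tclass_repr z).
by rewrite !(taddE, tmulE) tmulseq_catl.
Qed.

HB.instance Definition _ := GRing.isZmodule.Build tensor taddA taddC tadd0 taddN.
HB.instance Definition _ :=
  GRing.Zmodule_isComPzRing.Build tensor tmulA tmulC tmul1 tmulDl.

Definition tpure (a : A) (b : B) : tensor := tclass [:: (a, b)].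

Lemma tclassE s : tclass s = \sum_(p <- s) tpure p.1 p.2.
Proof.
elim: s => [|[a b] s ih]; first by rewrite big_nil.
by rewrite big_cons /= -ih -[tpure a b + _]/(tadd _ _) taddE.
Qed.

Lemma tpureM a b a' b' : tpure a b * tpure a' b' = tpure (a * a') (b * b').
Proof. by rewrite -[LHS]/(tmul _ _) tmulE. Qed.
Lemma tpureDl a a' b : tpure (a + a') b = tpure a b + tpure a' b.
Proof. by rewrite -[RHS]/(tadd _ _) taddE; apply/tclassP; exact: te_addl. Qed.
Lemma tpureDr a b b' : tpure a (b + b') = tpure a b + tpure a b'.
Proof. by rewrite -[RHS]/(tadd _ _) taddE; apply/tclassP; exact: te_addr. Qed.
Lemma tpure_bal c a b : tpure (f c * a) b = tpure a (g c * b).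
Proof. by apply/tclassP; exact: te_bal. Qed.

Definition tinl a := tpure a 1.
Definition tinr b := tpure 1 b.

Fact tinl_zmod : zmod_morphism tinl.
Proof.
by move=> x y; apply/eqP; rewrite eq_sym subr_eq -[tinl _ + _]tpureDl subrK.
Qed.
Fact tinl_monoid : monoid_morphism tinl.
Proof. by split=> // x y; rewrite /tinl tpureM mulr1. Qed.
Fact tinr_zmod : zmod_morphism tinr.
Proof.
by move=> x y; apply/eqP; rewrite eq_sym subr_eq -[tinr _ + _]tpureDr subrK.
Qed.
Fact tinr_monoid : monoid_morphism tinr.
Proof. by split=> // x y; rewrite /tinr tpureM mulr1. Qed.

HB.instance Definition _ := GRing.isZmodMorphism.Build A tensor tinl tinl_zmod.
HB.instance Definition _ := GRing.isMonoidMorphism.Build A tensor tinl tinl_monoid.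
HB.instance Definition _ := GRing.isZmodMorphism.Build B tensor tinr tinr_zmod.
HB.instance Definition _ := GRing.isMonoidMorphism.Build B tensor tinr tinr_monoid.

Lemma tensor_ind (P : tensor -> Prop) : P 0 -> (forall x y, P x -> P y -> P (x + y)) ->
  (forall a b, P (tinl a * tinr b)) -> forall x, P x.
Proof.
move=> P0 PD Pp x; rewrite -(tclass_repr x) tclassE.
elim: (repr x) => [|[a b] s ih]; first by rewrite big_nil.
rewrite big_cons /=; apply: PD => //.
by have := Pp a b; rewrite /tinl /tinr tpureM mulr1 mul1r.
Qed.

End Tensor.

Section TensorLift.
Variables (R A B : comNzRingType).
Variables (f : {rmorphism R -> A}) (g : {rmorphism R -> B}).
Variables (C : comPzRingType) (h1 : {rmorphism A -> C}) (h2 : {rmorphism B -> C}).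

Definition tlift of (forall c, h1 (f c) = h2 (g c)) := fun x : tensor f g =>
  \sum_(p <- repr x) h1 p.1 * h2 p.2.

Hypothesis hfg : forall c, h1 (f c) = h2 (g c).

Lemma tlift_class s : tlift hfg (tclass f g s) = \sum_(p <- s) h1 p.1 * h2 p.2.
Proof.
rewrite /tlift; have := tens_repr f g s; move: (repr _) => t; elim=> {s t} //.
- by move=> s t u _ -> _ ->.
- by move=> s s' t t' _ h _ h'; rewrite !big_cat /= h h'.
- by move=> s t; rewrite !big_cat /= addrC.
- by move=> b; rewrite big_seq1 big_nil rmorph0 mul0r.
- by move=> a a' b; rewrite !big_cons !big_nil /= !addr0 rmorphD mulrDl.
- by move=> a b b'; rewrite !big_cons !big_nil /= !addr0 rmorphD mulrDr.
- by move=> c a b; rewrite !big_seq1 /= !rmorphM hfg mulrCA mulrA.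
Qed.

Fact tlift_zmod : zmod_morphism (tlift hfg).
Proof.
move=> x y; apply/eqP; rewrite eq_sym subr_eq; apply/eqP.
rewrite -[in LHS](subrK y x); move: (x - y) => {}x.
rewrite -(tclass_repr x) -(tclass_repr y) -[_ + _]/(tadd _ _) taddE.
by rewrite !tlift_class big_cat.
Qed.
Fact tlift_monoid : monoid_morphism (tlift hfg).
Proof.
split; first by rewrite tlift_class big_seq1 !rmorph1 mulr1.
move=> x y; rewrite -(tclass_repr x) -(tclass_repr y).
rewrite -[_ * _]/(tmul _ _) tmulE !tlift_class big_distrlr /=.
rewrite /tmulseq big_allpairs_dep; apply: eq_bigr => p _; apply: eq_bigr => q _ /=.
by rewrite !rmorphM mulrACA.
Qed.
HB.instance Definition _ :=
  GRing.isZmodMorphism.Build (tensor f g) C (tlift hfg) tlift_zmod.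
HB.instance Definition _ :=
  GRing.isMonoidMorphism.Build (tensor f g) C (tlift hfg) tlift_monoid.

Lemma tlift_inl a : tlift hfg (tinl f g a) = h1 a.
Proof. by rewrite tlift_class big_seq1 rmorph1 mulr1. Qed.
Lemma tlift_inr b : tlift hfg (tinr f g b) = h2 b.
Proof. by rewrite tlift_class big_seq1 rmorph1 mul1r. Qed.

End TensorLift.

(** The symmetric algebra of [V], realised as the polynomial ring on a basis
    of [V]; see [symV_lift] for its universal property. *)
Section SymAlg.
Variables (k : fieldType) (V : vectType k).

Definition symAlg := {mpoly k[\dim {:V}]}.
Definition symV (v : V) : symAlg :=
  \sum_(i < \dim {:V}) coord (vbasis {:V}) i v *: 'X_i.

Fact symV_linear : linear symV.
Proof.
move=> c u v; rewrite /symV scaler_sumr -big_split /=; apply: eq_bigr => i _.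
by rewrite linearP scalerDl scalerA.
Qed.
HB.instance Definition _ := GRing.isLinear.Build k V symAlg _ symV symV_linear.

Lemma symV_basis (i : 'I_(\dim {:V})) : symV (vbasis {:V})`_i = 'X_i.
Proof.
rewrite /symV (bigD1 i) //= big1 ?addr0 => [|j ji];
  rewrite coord_free ?(basis_free (vbasisP _)) //.
  by rewrite eqxx scale1r.
by rewrite eq_sym (negPf ji) scale0r.
Qed.

Lemma symV_neq0 v : v != 0 -> symV v != 0.
Proof.
apply: contra_neq => h.
rewrite (coord_vbasis (memvf v)) big1 // => i _.
have := congr1 (mcoeff U_(i)%MM) h; rewrite mcoeff0 /symV raddf_sum /= (bigD1 i) //= big1.
  by rewrite mcoeffZ mcoeffX eqxx mulr1 addr0 => ->; rewrite scale0r.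
by move=> j ji; rewrite mcoeffZ mcoeffXU (negPf ji) mulr0.
Qed.

Lemma symV_lift (C : comNzRingType) (iota : {rmorphism k -> C}) (h : V -> C) :
    {morph h : u v / u + v} -> (forall c v, h (c *: v) = iota c * h v) ->
  {m : {rmorphism symAlg -> C} |
    (forall c, m c%:MP = iota c) /\ (forall v, m (symV v) = h v)}.
Proof.
move=> hD hZ; exists (mmap iota (fun i => h (vbasis {:V})`_i)); split=> [c|v].
  by rewrite /= mmapC.
have h0 : h 0 = 0 by rewrite -(scale0r 0) hZ rmorph0 mul0r.
rewrite {2}(coord_vbasis (memvf v)) (big_morph h hD h0) raddf_sum /=.
by apply: eq_bigr => i _; rewrite mmapZ mmapX mmap1U hZ.
Qed.

Lemma symAlg_eq (C : comNzRingType) (m m' : {rmorphism symAlg -> C}) :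
    (forall c, m c%:MP = m' c%:MP) -> (forall v, m (symV v) = m' (symV v)) ->
  m =1 m'.
Proof.
move=> hc hv p; elim/mpolyind: p => [|c mon p _ _ ih]; first by rewrite !rmorph0.
rewrite -mul_mpolyC !rmorphD !rmorphM /= hc ih; congr (_ * _ + _).
rewrite mpolyXE_id !rmorph_prod; apply: eq_bigr => i _.
by rewrite !rmorphXn /= -symV_basis hv.
Qed.

Definition KV := {fraction symAlg}.
Definition KVconst : {rmorphism k -> KV} :=
  (@tofrac symAlg) \o (@mpolyC (\dim {:V}) k).
Definition KVinv (v : V) : KV := ((symV v)%:F)^-1.

Definition RV_pred : {pred KV} := fun x =>
  `[< gen_subalg KVconst (fun y => exists2 v, v != 0 & y = KVinv v) x >].

Fact RV_subring : subring_closed RV_pred.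
Proof.
split=> [|x y /asboolP hx /asboolP hy|x y /asboolP hx /asboolP hy];
  apply/asboolP => P Pc PS PB PM.
- by rewrite -(rmorph1 KVconst).
- exact: PB (hx P Pc PS PB PM) (hy P Pc PS PB PM).
- exact: PM (hx P Pc PS PB PM) (hy P Pc PS PB PM).
Qed.
HB.instance Definition _ := GRing.isSubringClosed.Build KV RV_pred RV_subring.

Record RV := MkRV { RVval :> KV; _ : RVval \in RV_pred }.
HB.instance Definition _ := [isSub for RVval].
HB.instance Definition _ := [Choice of RV by <:].
HB.instance Definition _ := [SubChoice_isSubComNzRing of RV by <:].

Fact RVval_zmod : zmod_morphism RVval. Proof. exact: (raddfB val). Qed.
Fact RVval_monoid : monoid_morphism RVval.
Proof. by split; [exact: (rmorph1 val) | exact: (rmorphM val)]. Qed.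
HB.instance Definition _ := GRing.isZmodMorphism.Build RV KV RVval RVval_zmod.
HB.instance Definition _ := GRing.isMonoidMorphism.Build RV KV RVval RVval_monoid.

Fact RVconst_subproof c : KVconst c \in RV_pred.
Proof. by apply/asboolP => P Pc _ _ _; exact: Pc. Qed.
Definition RVconst c : RV := MkRV (RVconst_subproof c).
Fact RVconst_zmod : zmod_morphism RVconst.
Proof. by move=> x y; apply: val_inj; exact: (rmorphB KVconst). Qed.
Fact RVconst_monoid : monoid_morphism RVconst.
Proof.
split=> [|x y]; apply: val_inj; first exact: (rmorph1 KVconst).
exact: (rmorphM KVconst).
Qed.
HB.instance Definition _ := GRing.isZmodMorphism.Build k RV RVconst RVconst_zmod.
HB.instance Definition _ :=
  GRing.isMonoidMorphism.Build k RV RVconst RVconst_monoid.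

(** [1/v] as an element of [R_V], with the junk value [0] at [v = 0]. *)
Fact RVinv_subproof v : KVinv v \in RV_pred.
Proof.
have [->|nz] := eqVneq v 0; first by rewrite /KVinv linear0 tofrac0 invr0 rpred0.
by apply/asboolP => P _ PS _ _; apply: PS; exists v.
Qed.
Definition RVinv v : RV := MkRV (RVinv_subproof v).

Lemma RV_ind (P : RV -> Prop) :
    (forall c, P (RVconst c)) -> (forall v, v != 0 -> P (RVinv v)) ->
    (forall x y, P x -> P y -> P (x - y)) ->
    (forall x y, P x -> P y -> P (x * y)) -> forall x, P x.
Proof.
move=> Pc Pv PB PM [x xR]; have /asboolP h := xR.
have [||||y e hy] := h (fun y => exists2 y' : RV, y = y' :> KV & P y').
- by move=> c; exists (RVconst c).
- by move=> s [v nz ->]; exists (RVinv v) => //; exact: Pv.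
- by move=> y z [y' -> hy] [z' -> hz]; exists (y' - z') => //; exact: PB.
- by move=> y z [y' -> hy] [z' -> hz]; exists (y' * z') => //; exact: PM.
by rewrite (_ : MkRV xR = y) //; exact: val_inj.
Qed.

Definition ratfun := {fraction {poly k}}.
Definition ratfun_const : {rmorphism k -> ratfun} :=
  (@tofrac {poly k}) \o (@polyC k).
Definition RVF := tensor RVconst ratfun_const.
HB.instance Definition _ := GRing.ComPzRing.on RVF.

(** Augmentation [R_V -> k], [1/v |-> 0]; it shows that [R_V (x) F] and its
    quotient [R_n] are nonzero rings. *)
Definition small (x : KV) := exists P Q : symAlg,
  [/\ Q != 0, x = P%:F / Q%:F & (msize P < msize Q)%N].

Let ltM (P Q S : symAlg) : S != 0 -> (msize P < msize Q)%N ->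
  (msize (P * S) < msize (Q * S))%N.
Proof.
move=> S0 PQ; have Q0 : Q != 0.
  by rewrite -(mmeasure_poly_eq0 mdeg) -lt0n (leq_ltn_trans _ PQ).
have [->|P0] := eqVneq P 0.
  by rewrite mul0r mmeasure0 lt0n (mmeasure_poly_eq0 mdeg) mulf_neq0.
rewrite !msizeM //; move: S0 P0 Q0; rewrite -!(mmeasure_poly_eq0 mdeg).
by case: (msize S) (msize P) (msize Q) PQ => // s [//|p] [//|q] /=;
  rewrite ltnS ltn_add2r.
Qed.

Lemma small0 : small 0.
Proof. by exists 0, 1; rewrite tofrac0 mul0r oner_neq0 mmeasure0 msize1. Qed.

Lemma smallB x y : small x -> small y -> small (x - y).
Proof.
move=> [P [Q [Q0 -> PQ]]] [P' [Q' [Q0' -> PQ']]].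
exists (P * Q' - P' * Q), (Q * Q'); split; first by rewrite mulf_neq0.
  by rewrite -mulNr addf_div ?tofrac_eq0 // tofracB !tofracM mulNr.
apply: leq_ltn_trans (mmeasureD_le _ _ _) _; rewrite mmeasureN gtn_max ltM //.
by rewrite [Q * _]mulrC ltM.
Qed.

Lemma smallM x y : small x -> small y -> small (x * y).
Proof.
move=> [P [Q [Q0 -> PQ]]] [P' [Q' [Q0' -> PQ']]].
exists (P * P'), (Q * Q'); split; first by rewrite mulf_neq0.
  by rewrite mulf_div !tofracM.
have [->|P0] := eqVneq P' 0.
  by rewrite mulr0 mmeasure0 lt0n (mmeasure_poly_eq0 mdeg) mulf_neq0.
by apply: ltn_trans (ltM P0 PQ) _; rewrite ![Q * _]mulrC ltM.
Qed.

Lemma smallZ c x : small x -> small (KVconst c * x).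
Proof.
move=> [P [Q [Q0 -> PQ]]]; exists (c *: P), Q; split=> //.
  by rewrite mulrA -mul_mpolyC tofracM.
exact: leq_ltn_trans (msizeZ_le _ _) PQ.
Qed.

Lemma small_const c : small (KVconst c) -> c = 0.
Proof.
move=> [P [Q [Q0 e PQ]]]; apply/eqP; apply: contraTT PQ => c0.
have : (c%:MP * Q)%:F = P%:F.
  by rewrite tofracM -[_%:F]/(KVconst c) e divfK ?tofrac_eq0.
move=> /eqP; rewrite tofrac_eq => /eqP <-.
by rewrite mul_mpolyC msizeZ // ltnn.
Qed.

Lemma small_inv v : v != 0 -> small (KVinv v).
Proof.
move=> v0; have s0 := symV_neq0 v0.
exists 1, (symV v); split => //; first by rewrite tofrac1 mul1r.
rewrite msize1 ltnNge; apply/negP => /msize1_polyC => e.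
case/eqP: s0; rewrite e; congr _%:MP.
rewrite /symV raddf_sum big1 //= => i _.
by rewrite mcoeffZ mcoeffX mnm1_eq0 mulr0.
Qed.

Fact RVaug_subproof (x : RV) : exists c, small (RVval x - KVconst c).
Proof.
elim/RV_ind: x => [c|v v0|x y [c hc] [d hd]|x y [c hc] [d hd]].
- by exists c; rewrite subrr; exact: small0.
- by exists 0; rewrite rmorph0 subr0; exact: small_inv.
- by exists (c - d); rewrite !rmorphB [- (KVconst _ - _)]opprD addrACA -opprD; exact: smallB.
- exists (c * d); rewrite !rmorphM.
  have -> : RVval x * RVval y - KVconst c * KVconst d =
      (RVval x - KVconst c) * (RVval y - KVconst d)
      - (KVconst (- c) * (RVval y - KVconst d)
         - KVconst d * (RVval x - KVconst c)).
    by rewrite rmorphN; ring.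
  by apply: smallB; [exact: smallM | apply: smallB; exact: smallZ].
Qed.
Definition RVaug (x : RV) : k := projT1 (cid (RVaug_subproof x)).

Lemma RVaugE (x : RV) c : small (RVval x - KVconst c) -> RVaug x = c.
Proof.
rewrite /RVaug; case: cid => d /= hd hc; apply/eqP; rewrite -subr_eq0; apply/eqP; apply: small_const.
have -> : KVconst (d - c) = (RVval x - KVconst c) - (RVval x - KVconst d).
  by rewrite rmorphB; ring.
exact: smallB.
Qed.
Lemma RVaugP x : small (RVval x - KVconst (RVaug x)).
Proof. by rewrite /RVaug; case: cid. Qed.

Fact RVaug_zmod : zmod_morphism RVaug.
Proof.
move=> x y; apply: RVaugE; rewrite !rmorphB [- (KVconst _ - _)]opprD addrACA -opprD.
by apply: smallB; exact: RVaugP.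
Qed.
Fact RVaug_monoid : monoid_morphism RVaug.
Proof.
split; first by apply: RVaugE; rewrite !rmorph1 subrr; exact: small0.
move=> x y; apply: RVaugE; rewrite !rmorphM.
have hx := RVaugP x; have hy := RVaugP y.
move: (RVaug x) (RVaug y) hx hy => c d hx hy.
have -> : RVval x * RVval y - KVconst c * KVconst d =
    (RVval x - KVconst c) * (RVval y - KVconst d)
    - (KVconst (- c) * (RVval y - KVconst d)
       - KVconst d * (RVval x - KVconst c)).
  by rewrite rmorphN; ring.
by apply: smallB; [exact: smallM | apply: smallB; exact: smallZ].
Qed.
HB.instance Definition _ := GRing.isZmodMorphism.Build RV k RVaug RVaug_zmod.
HB.instance Definition _ := GRing.isMonoidMorphism.Build RV k RVaug RVaug_monoid.

Lemma RVaug_const c : RVaug (RVconst c) = c.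
Proof. by apply: RVaugE; rewrite subrr; exact: small0. Qed.
Lemma RVaug_inv v : RVaug (RVinv v) = 0.
Proof.
apply: RVaugE; rewrite rmorph0 subr0.
have [->|] := eqVneq v 0; last exact: small_inv.
by rewrite /= /KVinv linear0 tofrac0 invr0; exact: small0.
Qed.

Fact RVFaug_compat c :
  (ratfun_const \o RVaug) (RVconst c) = idfun (ratfun_const c) :> ratfun.
Proof. by rewrite /= RVaug_const. Qed.
Definition RVFaug : {rmorphism RVF -> ratfun} := tlift RVFaug_compat.

Fact RVF_nonzero : (1 : RVF) != 0.
Proof.
by apply/eqP => /(congr1 RVFaug)/eqP; rewrite rmorph1 rmorph0 oner_eq0.
Qed.
HB.instance Definition _ := GRing.PzSemiRing_isNonZero.Build RVF RVF_nonzero.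
HB.instance Definition _ := GRing.ComNzRing.on RVF.

Definition RVl : {rmorphism RV -> RVF} := tinl RVconst ratfun_const.
Definition RVr : {rmorphism ratfun -> RVF} := tinr RVconst ratfun_const.

End SymAlg.

Section FracLift.
Variables (D : idomainType) (L : fieldType) (h : {rmorphism D -> L}).

Lemma frac_repr (x : {fraction D}) :
  exists p : D * D, p.2 != 0 /\ x = p.1%:F / p.2%:F.
Proof.
elim/quotW: x => y; exists (frac y); split; first exact: denom_ratioP.
have y2 := denom_ratioP y; apply: canRL (mulfK _) _; first by rewrite tofrac_eq0.
apply/eqP; rewrite piE /=.
by rewrite FracField.equivfE /FracField.mulf !numden_Ratio ?mulf_neq0 ?oner_neq0 //
  !mulr1 mulrC.
Qed.

Definition fraclift of injective h := fun x : {fraction D} =>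
  let p := projT1 (cid (frac_repr x)) in h p.1 / h p.2.

Hypothesis hI : injective h.

Lemma fracliftE a b : b != 0 -> fraclift hI (a%:F / b%:F) = h a / h b.
Proof.
move=> b0; rewrite /fraclift; case: cid => -[c d] /= [d0 /eqP e].
move: e; rewrite eqr_div ?tofrac_eq0 // -!tofracM tofrac_eq => /eqP e.
have hn z : z != 0 -> h z != 0 by move=> z0; rewrite -(rmorph0 h) (inj_eq hI).
by apply/eqP; rewrite eqr_div ?hn // -!rmorphM e mulrC [b * _]mulrC mulrC.
Qed.

Lemma fraclift_tofrac a : fraclift hI a%:F = h a.
Proof. by rewrite -[a%:F]divr1 -tofrac1 fracliftE ?oner_neq0 // rmorph1 divr1. Qed.

Fact fraclift_zmod : zmod_morphism (fraclift hI).
Proof.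
have hn z : z != 0 -> h z != 0 by move=> z0; rewrite -(rmorph0 h) (inj_eq hI).
move=> x y; have [[a b] /= [b0 ->]] := frac_repr x.
have [[c d] /= [d0 ->]] := frac_repr y.
rewrite -mulNr addf_div ?tofrac_eq0 //.
rewrite -tofracN -!tofracM -tofracD !fracliftE ?mulf_neq0 //.
by rewrite -[- (h c / _)]mulNr addf_div ?hn // rmorphD !rmorphM rmorphN.
Qed.
Fact fraclift_monoid : monoid_morphism (fraclift hI).
Proof.
split; first by rewrite -tofrac1 fraclift_tofrac rmorph1.
move=> x y; have [[a b] /= [b0 ->]] := frac_repr x.
have [[c d] /= [d0 ->]] := frac_repr y.
by rewrite mulf_div -!tofracM !fracliftE ?mulf_neq0 // mulf_div !rmorphM.
Qed.
HB.instance Definition _ :=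
  GRing.isZmodMorphism.Build {fraction D} L (fraclift hI) fraclift_zmod.
HB.instance Definition _ :=
  GRing.isMonoidMorphism.Build {fraction D} L (fraclift hI) fraclift_monoid.

End FracLift.

(** Functoriality of [R_V (x) F] under linear automorphisms of [V]. *)
Section Functor.
Variables (k : fieldType) (V : vectType k).
Variables (phi : {linear V -> V}) (phi_inj : injective phi).

Definition symmap : {rmorphism symAlg V -> symAlg V} :=
  projT1 (symV_lift (C := symAlg V) (iota := @mpolyC (\dim {:V}) k)
    (h := fun v => symV (phi v))
    (fun u v => etrans (congr1 (@symV k V) (linearD phi u v)) (linearD _ _ _))
    (fun c v => etrans (congr1 (@symV k V) (linearZZ phi c v))
      (etrans (linearZZ _ c _) (esym (mul_mpolyC c _))))).

Lemma symmapC c : symmap c%:MP = c%:MP.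
Proof. by rewrite /symmap; case: symV_lift => m [/= -> _]. Qed.
Lemma symmapV v : symmap (symV v) = symV (phi v).
Proof. by rewrite /symmap; case: symV_lift => m [/= _ ->]. Qed.

End Functor.

Section Functor2.
Variables (k : fieldType) (V : vectType k) (phi psi : {linear V -> V}).

Lemma symmapK : cancel phi psi -> cancel (symmap phi) (symmap psi).
Proof.
move=> pK; apply: (symAlg_eq (m := symmap psi \o symmap phi) (m' := idfun)).
  by move=> c; rewrite /= !symmapC.
by move=> v; rewrite /= !symmapV pK.
Qed.

Hypothesis pK : cancel phi psi.

Fact KVmap_inj : injective (@tofrac (symAlg V) \o symmap phi).
Proof.
by move=> p q /= /eqP; rewrite tofrac_eq => /eqP /(can_inj (symmapK pK)).
Qed.
Definition KVmap : {rmorphism KV V -> KV V} := fraclift KVmap_inj.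

Lemma KVmap_const c : KVmap (KVconst V c) = KVconst V c.
Proof. by rewrite /KVmap /= fraclift_tofrac /= symmapC. Qed.
Lemma KVmap_inv v : KVmap (KVinv v) = KVinv (phi v).
Proof. by rewrite /KVinv fmorphV /= fraclift_tofrac /= symmapV. Qed.

Fact RVmap_subproof (x : RV V) : KVmap (RVval x) \in @RV_pred k V.
Proof.
elim/RV_ind: x => [c|v v0|x y hx hy|x y hx hy].
- by rewrite KVmap_const; exact: RVconst_subproof.
- by rewrite KVmap_inv; exact: RVinv_subproof.
- by rewrite !rmorphB rpredB.
- by rewrite !rmorphM rpredM.
Qed.
Definition RVmap (x : RV V) : RV V := MkRV (RVmap_subproof x).

Fact RVmap_zmod : zmod_morphism RVmap.
Proof. by move=> x y; apply: val_inj; rewrite /= !rmorphB. Qed.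
Fact RVmap_monoid : monoid_morphism RVmap.
Proof. by split=> [|x y]; apply: val_inj; rewrite /= ?rmorph1 ?rmorphM. Qed.
HB.instance Definition _ := GRing.isZmodMorphism.Build (RV V) (RV V) RVmap RVmap_zmod.
HB.instance Definition _ :=
  GRing.isMonoidMorphism.Build (RV V) (RV V) RVmap RVmap_monoid.

Lemma RVmap_const c : RVmap (RVconst V c) = RVconst V c.
Proof. by apply: val_inj; exact: KVmap_const. Qed.
Lemma RVmap_inv v : RVmap (RVinv v) = RVinv (phi v).
Proof. by apply: val_inj; exact: KVmap_inv. Qed.

Fact RVFmap_compat c :
  (RVl V \o RVmap) (RVconst V c) = RVr V (ratfun_const k c).
Proof.
rewrite /= RVmap_const /tinl /tinr -[RVconst V c]mulr1 tpure_bal mulr1.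
by [].
Qed.
Definition RVFmap : {rmorphism RVF V -> RVF V} := tlift RVFmap_compat.

Lemma RVFmap_inv v : RVFmap (RVl V (RVinv v)) = RVl V (RVinv (phi v)).
Proof. by rewrite /RVFmap /= tlift_inl /= RVmap_inv. Qed.
Lemma RVFmap_scal c : RVFmap (RVr V c) = RVr V c.
Proof. by rewrite /RVFmap /= tlift_inr. Qed.

End Functor2.

Section Rn.
Variables (k : finFieldType) (n r : nat).

(** [V_n = (t^-n A / A)^r] for [n > 0]: multiplication by [t^n] identifies
    [t^-n A / A] with [A / t^n A] (see [torsion_modelP]), so that
    [t^-n a mod A] is represented by [a mod t^n]. *)
Definition Qn := {poly %/ ('X^n : {poly k})}.
Definition Vn := {ffun 'I_r -> Qn}.
HB.instance Definition _ := GRing.ComNzRing.on Qn.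
HB.instance Definition _ := Finite.on Vn.
HB.instance Definition _ := Vector.on Vn.

Lemma torsion_modelP (a b : {poly k}) : (0 < n)%N ->
  (exists c : {poly k}, a%:F / 'X^n%:F - b%:F / 'X^n%:F = c%:F) <->
  in_qpoly ('X^n : {poly k}) a = in_qpoly 'X^n b.
Proof.
move=> n0; have X0 : ('X^n : {poly k})%:F != 0.
  by rewrite tofrac_eq0 monic_neq0 ?monicXn.
have mkX : mk_monic ('X^n : {poly k}) = 'X^n by rewrite mk_monic_Xn prednK.
rewrite -mulrBl -tofracB; split=> [[c /(canRL (divfK X0))]|].
  rewrite -tofracM => /eqP; rewrite tofrac_eq => /eqP e.
  apply/eqP; rewrite -subr_eq0 -raddfB /= e; apply/eqP/val_inj => /=.
  by rewrite mkX Pdiv.RingMonic.rmodp_mull ?monicXn.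
move/eqP; rewrite -subr_eq0 -raddfB => /eqP/(congr1 val) /=; rewrite mkX => e.
exists (Pdiv.CommonRing.rdivp (a - b) 'X^n).
rewrite [in LHS](Pdiv.RingMonic.rdivp_eq (monicXn k n) (a - b)) e addr0.
by rewrite tofracM mulfK.
Qed.

Definition Ascale (a : {poly k}) (v : Vn) : Vn := [ffun i => in_qpoly 'X^n a * v i].

(** [V_nu], as the [t^nu]-torsion of [V_n], for [nu <= n]. *)
Definition Vsub (nu : nat) : {set Vn} := [set v | Ascale 'X^nu v == 0].

Definition relator (a : {poly k}) (nu : nat) (v : Vn) : RVF Vn :=
  tpure (@RVconst k Vn) (ratfun_const k) (RVinv (Ascale a v)) a%:F
  - \sum_(v' in Vsub nu) tpure (@RVconst k Vn) (ratfun_const k) (RVinv (v - v')) 1.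

Definition is_relator (x : RVF Vn) : Prop := exists alpha nu v,
  [/\ alpha != 0, (nu <= n)%N, v \notin Vsub nu
    & x = relator (alpha *: 'X^nu) nu v].

Definition Rn_ideal : {pred RVF Vn} := fun x => `[< gen_ideal is_relator x >].

Fact Rn_ideal_closed : idealr_closed Rn_ideal.
Proof.
split.
- by apply/asboolP => J J0 _ _ _; exact: J0.
- apply/negP => /asboolP /(_ (fun x => RVFaug Vn x = 0)); rewrite rmorph1.
  have aug (v : Vn) b : RVFaug Vn (tpure (@RVconst k Vn) (ratfun_const k) (RVinv v) b) = 0.
    rewrite -[RVinv v]mulr1 -[b]mul1r -tpureM rmorphM /= tlift_inl /= RVaug_inv.
    by rewrite rmorph0 mul0r.
  move=> h; have /eqP : (1 : ratfun k) = 0; last by rewrite oner_eq0.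
  apply: h => [|x [c [nu [v [_ _ _ ->]]]]|x y hx hy|a y hy].
  + by rewrite rmorph0.
  + by rewrite rmorphB aug rmorph_sum big1 ?subrr.
  + by rewrite rmorphD hx hy addr0.
  + by rewrite rmorphM hy mulr0.
- move=> a u v /asboolP hu /asboolP hv; apply/asboolP => J J0 JS JD JM.
  exact: JD (JM a u (hu J J0 JS JD JM)) (hv J J0 JS JD JM).
Qed.
HB.instance Definition _ := isIdealr.Build (RVF Vn) Rn_ideal Rn_ideal_closed.

Definition Rn := {ideal_quot Rn_ideal}.
HB.instance Definition _ := GRing.ComNzRing.on Rn.

Definition Rn_class : {rmorphism RVF Vn -> Rn} := \pi_Rn.
Definition Rn_scal : {rmorphism ratfun k -> Rn} := Rn_class \o RVr Vn.
(** [[1/v (x) 1]] for [v <> 0]. *)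
Definition recip (v : Vn) : Rn :=
  Rn_class (tpure (@RVconst k Vn) (ratfun_const k) (RVinv v) 1).

Lemma Rn_class0 x : Rn_class x = 0 <-> x \in Rn_ideal.
Proof.
rewrite -[x \in _]/(x \in Rn_ideal) -[x in x \in _]subr0 Quotient.idealrBE.
by rewrite -[0 in RHS]/(0 : Rn); split=> [h|/eqP h]; [apply/eqP|];
  move: h; rewrite -!/(Rn_class _) rmorph0.
Qed.

Definition GLmul (g : 'M[Qn]_r) (v : Vn) : Vn := [ffun i => \sum_j g i j * v j].

Fact GLmul_linear g : linear (GLmul g).
Proof.
move=> c u v; apply/ffunP => i; rewrite !ffunE scaler_sumr -big_split /=.
by apply: eq_bigr => j _; rewrite !ffunE mulrDr scalerAr.
Qed.
HB.instance Definition _ g :=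
  GRing.isLinear.Build k Vn Vn _ (GLmul g) (GLmul_linear g).

Lemma GLmulM g h v : GLmul g (GLmul h v) = GLmul (g *m h) v.
Proof.
apply/ffunP => i; rewrite !ffunE.
under eq_bigr do rewrite ffunE mulr_sumr.
rewrite exchange_big /=; apply: eq_bigr => j _; rewrite mxE mulr_suml.
by apply: eq_bigr => l _; rewrite mulrA.
Qed.
Lemma GLmul1 v : GLmul 1%:M v = v.
Proof.
apply/ffunP => i; rewrite ffunE (bigD1 i) //= mxE eqxx mul1r big1 ?addr0 // => j.
by move=> ji; rewrite mxE eq_sym (negPf ji) mul0r.
Qed.
Lemma GLmulK g : g \in unitmx -> cancel (GLmul g) (GLmul (invmx g)).
Proof. by move=> gU v; rewrite GLmulM mulVmx // GLmul1. Qed.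
Lemma GLmulVK g : g \in unitmx -> cancel (GLmul (invmx g)) (GLmul g).
Proof. by move=> gU v; rewrite GLmulM mulmxV // GLmul1. Qed.
Lemma GLmul_scale g a v : GLmul g (Ascale a v) = Ascale a (GLmul g v).
Proof.
apply/ffunP => i; rewrite !ffunE mulr_sumr; apply: eq_bigr => j _.
by rewrite ffunE mulrCA.
Qed.
Lemma GLmul_Vsub g nu v : g \in unitmx -> (GLmul g v \in Vsub nu) = (v \in Vsub nu).
Proof.
by move=> gU; rewrite !inE -GLmul_scale (raddf_eq0 _ (can_inj (GLmulK gU))).
Qed.

Section Action.
Variables (g : 'M[Qn]_r) (gU : g \in unitmx).

Let act0 := RVFmap (phi := GLmul g) (psi := GLmul (invmx g)) (GLmulK gU).

Lemma act0_pure v c : act0 (tpure (@RVconst k Vn) (ratfun_const k) (RVinv v) c) =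
  tpure (@RVconst k Vn) (ratfun_const k) (RVinv (GLmul g v)) c.
Proof.
rewrite -[RVinv v]mulr1 -[c]mul1r -tpureM rmorphM.
by rewrite [act0 _](RVFmap_inv (GLmulK gU)) [act0 _]RVFmap_scal tpureM mulr1 mul1r.
Qed.

Lemma act0_ideal x : x \in Rn_ideal -> act0 x \in Rn_ideal.
Proof.
move=> /asboolP /(_ (fun x => act0 x \in Rn_ideal)); apply.
- by rewrite rmorph0 rpred0.
- move=> _ [c [nu [v [c0 nun vV ->]]]]; apply/asboolP => J _ JS _ _; apply: JS.
  exists c, nu, (GLmul g v); rewrite GLmul_Vsub //; split=> //.
  rewrite /relator rmorphB act0_pure GLmul_scale rmorph_sum; congr (_ - _).
  rewrite [RHS](reindex_inj (can_inj (GLmulK gU))) /=.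
  by apply: eq_big => v'; rewrite ?GLmul_Vsub // => _; rewrite act0_pure linearB.
- by move=> y z hy hz; rewrite rmorphD rpredD.
- by move=> a y hy; rewrite rmorphM idealMr.
Qed.

(** The action of [g] on [R_n], characterised by [act_recip] and [act_scal]. *)
Definition act (x : Rn) : Rn := Rn_class (act0 (repr x)).

Lemma act_class y : act (Rn_class y) = Rn_class (act0 y).
Proof.
apply/eqP; rewrite -subr_eq0 -!rmorphB; apply/eqP/Rn_class0; apply: act0_ideal.
by apply/Rn_class0; rewrite rmorphB /= reprK subrr.
Qed.

Fact act_zmod : zmod_morphism act.
Proof.
move=> x y; rewrite -[x]reprK -[y]reprK -!/(Rn_class _) -rmorphB !act_class.
by rewrite !rmorphB.
Qed.
Fact act_monoid : monoid_morphism act.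
Proof.
split; first by rewrite -(rmorph1 Rn_class) act_class !rmorph1.
move=> x y; rewrite -[x]reprK -[y]reprK -!/(Rn_class _) -rmorphM !act_class.
by rewrite !rmorphM.
Qed.
HB.instance Definition _ := GRing.isZmodMorphism.Build Rn Rn act act_zmod.
HB.instance Definition _ := GRing.isMonoidMorphism.Build Rn Rn act act_monoid.

Lemma act_recip v : act (recip v) = recip (GLmul g v).
Proof. by rewrite act_class act0_pure. Qed.
Lemma act_scal c : act (Rn_scal c) = Rn_scal c.
Proof. by rewrite /Rn_scal /= act_class RVFmap_scal. Qed.

End Action.

(** Constant coefficients of entries are their residues modulo [(t)]. *)
Definition in_U (g : 'M[Qn]_r) : Prop := g \in unitmx /\
  forall i j : 'I_r, (j <= i)%N -> (g i j : {poly k})`_0 = (i == j)%:R.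

Definition U_invariant (x : Rn) : Prop :=
  forall (g : 'M[Qn]_r) (gU : g \in unitmx), in_U g -> act gU x = x.

(** Indices start at [0]: [i : 'I_r] stands for [k = i + 1]. The class of
    [t^-n b_k] is represented by [b_k]. *)
Definition Xn (i : 'I_r) : Vn := [ffun j => (j == i)%:R].

Definition Vprime (i : 'I_r) : {set Vn} :=
  [set v : Vn | [exists u in Vsub n.-1,
     v - u \in <<[seq Xn j | j : 'I_r <- enum 'I_r & (j < i)%N]>>%VS]].

Definition Delta (i : 'I_r) : {fset Rn} :=
  (1%R |` [fset recip (Xn i + w)%R | w in Vprime i & w != 0%R])%fset.
Definition Eset (i : 'I_r) : {fset Rn} :=
  [fset recip (Xn i + w)%R | w in Vprime i]%fset.
Definition fgen (i : 'I_r) : Rn := \sum_(w in Vprime i) recip (Xn i + w).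

Definition Falg (I : {set 'I_r}) : Rn -> Prop :=
  gen_subalg Rn_scal (fun x => exists2 i, i \in I & x = fgen i).

End Rn.

Definition alg_independent (K A : comNzRingType) (iota : {rmorphism K -> A})
    (m : nat) (x : 'I_m -> A) : Prop :=
  forall p : {mpoly K[m]}, mmap iota x p = 0 -> p = 0.

Definition is_free_basis (A : comNzRingType) (S : A -> Prop) (B : {fset A}) : Prop :=
  (forall x, exists2 c : A -> A, forall b, S (c b) & x = \sum_(b <- B) c b * b) /\
  (forall c : A -> A, (forall b, S (c b)) -> \sum_(b <- B) c b * b = 0 ->
     forall b, b \in B -> c b = 0).

(** The subgroups [W j l], [j : J], [l] in [D j], of [A] satisfy
    [A = (+)_j (+)_(l in D j) W j l] (internal direct sum). *)
Definition is_direct_sum (A : zmodType) (J : finType) (L : choiceType)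
    (D : J -> {fset L}) (W : J -> L -> A -> Prop) : Prop :=
  (forall x, exists2 y : J -> L -> A,
     forall j l, l \in D j -> W j l (y j l) &
     x = \sum_(j : J) \sum_(l <- D j) y j l) /\
  (forall y : J -> L -> A, (forall j l, l \in D j -> W j l (y j l)) ->
     \sum_(j : J) \sum_(l <- D j) y j l = 0 ->
     forall j l, l \in D j -> y j l = 0).

Section ProductSets.
Variables (A : comNzRingType) (m : nat).

Definition fsmul (S T : {fset A}) : {fset A} := [fset (x * y)%R | x in S, y in T]%fset.

Definition prodset (E : 'I_m -> {fset A}) (I : {set 'I_m}) : {fset A} :=
  \big[fsmul/[fset 1]%fset]_(i in I) E i.

Lemma mem_prodset E I x : x \in prodset E I <->
  exists2 e : 'I_m -> A, forall i, i \in I -> e i \in E i & x = \prod_(i in I) e i.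
Proof.
have gen (s : seq 'I_m) y : uniq s ->
    y \in \big[fsmul/[fset 1]%fset]_(i <- s | i \in I) E i <->
    exists2 e : 'I_m -> A, forall i, i \in s -> i \in I -> e i \in E i
      & y = \prod_(i <- s | i \in I) e i.
  elim: s y => [|j s ih] y /=.
    rewrite !big_nil inE => _; split=> [/eqP ->|[e _ ->]]; last by rewrite big_nil.
    by exists (fun=> 1) => //; rewrite big_nil.
  case/andP=> js us; rewrite !big_cons; case: ifPn => jI; last first.
    rewrite ih //; split=> -[e he ->]; exists e; rewrite ?big_cons ?(negPf jI) //.
      by move=> i; rewrite inE => /predU1P[->|]; [rewrite (negPf jI) | exact: he].
    by move=> i si; apply: he; rewrite inE si orbT.
  split=> [/imfset2P /= [u uE [v /ih [] // e he -> ->]]|[e he ->]].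
    exists (fun i => if i == j then u else e i) => [i|].
      rewrite inE; case: eqP => [-> //|_] /=; exact: he.
    rewrite big_cons jI eqxx; congr (_ * _); rewrite big_seq_cond [RHS]big_seq_cond.
    by apply: eq_bigr => i /andP[si _]; case: eqP si js => // -> ->.
  rewrite big_cons jI; apply/imfset2P; exists (e j) => /=; first by rewrite he ?mem_head.
  exists (\prod_(i <- s | i \in I) e i) => //; apply/ih => //.
  by exists e => // i si; apply: he; rewrite inE si orbT.
rewrite /prodset gen ?index_enum_uniq //; split=> -[e he ->]; exists e => // i.
  by apply: he; rewrite mem_index_enum.
by move=> _; exact: he.
Qed.

Definition prod_bijective (D : 'I_m -> {fset A}) : Prop :=
  let dom (e : {ffun 'I_m -> A}) := forall i, e i \in D i in
  let prod (e : {ffun 'I_m -> A}) := \prod_i e i in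
  [/\ forall e, dom e -> prod e \in prodset D setT,
      forall e e', dom e -> dom e' -> prod e = prod e' -> e = e'
    & forall x, x \in prodset D setT -> exists2 e, dom e & prod e = x].

End ProductSets.

(* Main.v *)
Require Import Defs.
From HB Require Import structures.
From mathcomp Require Import all_boot all_order all_algebra.
From mathcomp Require Import closed_field finfield.
From mathcomp Require Import generic_quotient ring_quotient boolp ring zify.
From mathcomp Require Import finmap mpoly.

(** Write [x_v] for [[1/v (x) 1]], and [e_w], [w] in [V'_1 x ... x V'_r], for
    the elements of [Delta_1 ... Delta_r] ([dprod w] below).

    Spanning.  For distinct [w, w'] in [V'_k], the product of [x_(X_k+w)] and
    [x_(X_k+w')] is [x_(w'-w) (x_(X_k+w) - x_(X_k+w'))].  If [w' - w] lies outside
    [V_(n-1)], then [x_(w'-w)] is a scalar times an element of some [E_j], [j < k];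
    otherwise the torsion relation makes it [1/t] times a combination over
    [F_q[1/t]] of elements of the [E_j].  Modulo [1/t] the products of the
    generators are therefore reduced by a triangular system, and Nakayama's lemma
    at the place [t = oo] shows that the [f^b e], with [e] in [E_I] and [b]
    supported in [I], span [R_n].

    Independence.  A Drinfeld module with generic [t]-torsion and a full level
    structure [lam : V_n -> K] gives a homomorphism [h : R_n -> K] sending [x_v] to
    [1 / lam v].  Since the [1 / lam (t^(n-1) X_k)] are algebraically independent,
    a dimension count shows that the [h f_k] are too.  The homomorphisms [h o g],
    [g] in [U], agree on [F[f_1, ..., f_r]], and they are as many as the [e_w]
    because [g] is determined by the [g X_k - X_k] in [V'_k].  By Dedekind's
    independence of characters the square matrix of the [(h o g)(e_w)] is
    invertible, which gives both the freeness and the ring of invariants. *)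

Set Implicit Arguments.
Unset Strict Implicit.
Unset Printing Implicit Defensive.

Import GRing.Theory.
Local Open Scope ring_scope.
Local Notation "x %:F" := (tofrac x) : ring_scope.

(** * Torsion vectors *)

Section TorsionVectors.
Variables (k : finFieldType) (n r : nat).
Hypothesis n_gt0 : (0 < n)%N.
Local Notation Q := (Qn k n).
Local Notation V := (Vn k n r).
Implicit Types (u v w : V) (i : 'I_r).

Lemma mk_monicXn : mk_monic ('X^n : {poly k}) = 'X^n.
Proof. by rewrite mk_monic_Xn prednK. Qed.

Lemma size_Qn (a : Q) : (size (a : {poly k}) <= n)%N.
Proof. by apply: leq_trans (size_npoly a) _; rewrite mk_monicXn size_polyXn. Qed.

Lemma coef_in_qpoly (p : {poly k}) j :
  (in_qpoly 'X^n p : {poly k})`_j = if (j < n)%N then p`_j else 0.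
Proof.
case: ifPn => jn; last by rewrite nth_default // (leq_trans (size_Qn _)) // leqNgt.
rewrite /= mk_monicXn.
rewrite [in RHS](Pdiv.RingMonic.rdivp_eq (monicXn k n) p) coefD coefMXn jn add0r.
by [].
Qed.

Lemma in_qpoly_val (a : Q) : in_qpoly 'X^n (a : {poly k}) = a.
Proof. by apply: val_inj; apply: in_qpoly_small; exact: size_mk_monic. Qed.

Lemma coef_Qn_mul (a b : Q) j : (j < n)%N ->
  ((a * b : Q) : {poly k})`_j = ((a : {poly k}) * (b : {poly k}))`_j.
Proof.
by move=> jn; rewrite -{1}(in_qpoly_val a) -{1}(in_qpoly_val b) -rmorphM coef_in_qpoly jn.
Qed.

(** Since a mod t^n stands for the class of t^-n a, this is the coefficient of t^(j-n) in coordinate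
    i. The coefficients at j = 0, called top coefficients below, describe v modulo V_(n-1). *)
Definition vcoef v i (j : nat) : k := (v i : {poly k})`_j.

Lemma vcoefP u v : (forall i j, (j < n)%N -> vcoef u i j = vcoef v i j) -> u = v.
Proof.
move=> h; apply/ffunP => i; apply: val_inj; apply/polyP => j.
have [jn|jn] := ltnP j n; first exact: h.
by rewrite !nth_default // (leq_trans (size_Qn _)).
Qed.

Lemma vcoef_big v i j : (n <= j)%N -> vcoef v i j = 0.
Proof. by move=> jn; rewrite /vcoef nth_default // (leq_trans (size_Qn _)). Qed.

Lemma vcoefD u v i j : vcoef (u + v) i j = vcoef u i j + vcoef v i j.
Proof. by rewrite /vcoef ffunE /= coefD. Qed.

Lemma vcoefZ c v i j : vcoef (c *: v) i j = c * vcoef v i j.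
Proof. by rewrite /vcoef ffunE /= coefZ. Qed.

Lemma vcoefN v i j : vcoef (- v) i j = - vcoef v i j.
Proof. by rewrite -scaleN1r vcoefZ mulN1r. Qed.

Lemma vcoef0 i j : vcoef 0 i j = 0.
Proof. by rewrite -[0](scale0r 0) vcoefZ mul0r. Qed.

Lemma vcoef_sum (I : Type) (s : seq I) (P : pred I) (f : I -> V) i j :
  vcoef (\sum_(l <- s | P l) f l) i j = \sum_(l <- s | P l) vcoef (f l) i j.
Proof.
apply: (big_morph (fun v => vcoef v i j)); last exact: vcoef0.
by move=> u v; exact: vcoefD.
Qed.

Lemma vcoef_Ascale nu v i j :
  vcoef (Ascale 'X^nu v) i j = if (nu <= j < n)%N then vcoef v i (j - nu) else 0.
Proof.
have [jn|jn] := ltnP j n; last by rewrite andbF vcoef_big.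
rewrite andbT /vcoef ffunE -{1}(in_qpoly_val (v i)) -rmorphM coef_in_qpoly jn.
by rewrite coefXnM ltnNge; case: (nu <= j)%N.
Qed.

Lemma vcoef_Xn i l j : vcoef (Xn k n i) l j = ((l == i) && (j == 0%N))%:R.
Proof.
rewrite /vcoef ffunE; case: (l == i); last by rewrite coef0.
rewrite -(rmorph1 (in_qpoly 'X^n : {rmorphism _ -> Q})) coef_in_qpoly coef1.
by case: j => [|j]; rewrite ?n_gt0 //; case: ifP.
Qed.

Definition vmk (E : 'I_r -> nat -> k) : V :=
  [ffun i => in_qpoly 'X^n (\poly_(j < n) E i j)].

Lemma vcoef_mk E i j : (j < n)%N -> vcoef (vmk E) i j = E i j.
Proof. by move=> jn; rewrite /vcoef ffunE coef_in_qpoly jn coef_poly jn. Qed.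

Lemma AscaleE a nu v : Ascale (a *: 'X^nu) v = a *: Ascale 'X^nu v.
Proof.
by apply/ffunP => i; rewrite !ffunE linearZ /= -scalerAl.
Qed.

Lemma Ascale_linear nu : linear (Ascale 'X^nu : V -> V).
Proof.
move=> c u v; apply: vcoefP => i j jn.
rewrite vcoefD vcoefZ !vcoef_Ascale; case: ifP; last by rewrite mulr0 addr0.
by rewrite vcoefD vcoefZ.
Qed.

Lemma AscaleD nu u v : Ascale 'X^nu (u + v) = Ascale 'X^nu u + Ascale 'X^nu v.
Proof. by have := Ascale_linear nu 1 u v; rewrite !scale1r. Qed.

Lemma Ascale_scale nu c v : Ascale 'X^nu (c *: v) = c *: Ascale 'X^nu v.
Proof.
by apply: vcoefP => i j jn; rewrite vcoefZ !vcoef_Ascale; case: ifP; rewrite ?vcoefZ ?mulr0.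
Qed.

Lemma AscaleB nu u v : Ascale 'X^nu (u - v) = Ascale 'X^nu u - Ascale 'X^nu v.
Proof. by rewrite -!scaleN1r AscaleD Ascale_scale. Qed.

Lemma AscaleA nu mu v : Ascale 'X^nu (Ascale 'X^mu v) = Ascale 'X^(nu + mu) v.
Proof.
by apply/ffunP => i; rewrite !ffunE mulrA -rmorphM -exprD.
Qed.

Lemma Ascale0 v : Ascale 'X^0 v = v.
Proof. by apply/ffunP => i; rewrite !ffunE expr0 rmorph1 mul1r. Qed.

Lemma mem_Vsub nu v :
  (v \in Vsub k n r nu) <-> (forall i j, (j + nu < n)%N -> vcoef v i j = 0).
Proof.
rewrite inE; split=> [/eqP h i j jn|h].
  have := congr1 (fun v => vcoef v i (j + nu)) h.
  by rewrite vcoef_Ascale vcoef0 leq_addl jn addnK.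
apply/eqP/vcoefP => i j jn; rewrite vcoef0 vcoef_Ascale; case: ifP => // /andP[h1 _].
by apply: h; rewrite subnK.
Qed.

Lemma Vsub0 v : (v \in Vsub k n r 0) = (v == 0).
Proof. by rewrite inE Ascale0. Qed.

Lemma zero_Vsub nu : 0 \in Vsub k n r nu.
Proof. by apply/mem_Vsub => i j _; rewrite vcoef0. Qed.

Lemma Vsub_n v : v \in Vsub k n r n.
Proof. by apply/mem_Vsub => i j; rewrite ltnNge leq_addl. Qed.

Lemma Vsub_top v : (v \in Vsub k n r n.-1) <-> (forall i, vcoef v i 0 = 0).
Proof.
rewrite mem_Vsub; split=> [h i|h i [|j] jn]; [|exact: h|by move: jn; lia].
by apply: h; rewrite add0n prednK.
Qed.

Lemma mem_Vprime i v :
  (v \in Vprime k n i) <-> (forall l : 'I_r, (i <= l)%N -> vcoef v l 0 = 0).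
Proof.
set s := [seq Xn k n j | j : 'I_r <- enum 'I_r & (j < i)%N].
rewrite inE; split=> [/'exists_andP[u [/Vsub_top uV hs]] l il|h].
  have e := coord_span (X := in_tuple s) hs.
  rewrite -(subrK u v) vcoefD uV addr0 e vcoef_sum big1 // => j _.
  rewrite vcoefZ.
  have : s`_j \in s by apply: mem_nth.
  case/mapP => a; rewrite mem_filter => /andP[ai _] ->.
  rewrite vcoef_Xn; case: eqP => [e2|]; last by rewrite mulr0.
  by move: il; rewrite e2 leqNgt ai.
(* The combination of the X_j, j < i, with the same top coefficients as v; the remainder v - w lies
   in V_(n-1). *)
pose w : V := \sum_(j < r | (j < i)%N) vcoef v j 0 *: Xn k n j.
apply/'exists_andP; exists (v - w); split.
  apply/Vsub_top => l; rewrite vcoefD vcoefN vcoef_sum.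
  case: (ltnP l i) => li; last first.
    rewrite h // big1 ?subrr // => j ji; rewrite vcoefZ vcoef_Xn.
    case: eqP => [e|]; last by rewrite mulr0.
    by move: ji; rewrite -e ltnNge li.
  rewrite (bigD1 l) //= big1 ?vcoefZ ?vcoef_Xn ?eqxx ?mulr1 ?addr0 ?subrr //.
  by move=> j /andP[_ /negPf jl]; rewrite vcoefZ vcoef_Xn eq_sym jl mulr0.
rewrite opprB addrC subrK; apply: memv_suml => j ji; apply: memvZ.
by apply: memv_span; apply: map_f; rewrite mem_filter ji mem_enum.
Qed.

Lemma Vprime0 i : 0 \in Vprime k n i.
Proof. by apply/mem_Vprime => l _; rewrite vcoef0. Qed.

Lemma VprimeB i u v :
  u \in Vprime k n i -> v \in Vprime k n i -> u - v \in Vprime k n i.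
Proof.
move=> /mem_Vprime hu /mem_Vprime hv; apply/mem_Vprime => l il.
by rewrite vcoefD vcoefN hu // hv // subrr.
Qed.

Lemma VprimeD i u v :
  u \in Vprime k n i -> v \in Vprime k n i -> u + v \in Vprime k n i.
Proof.
move=> /mem_Vprime hu /mem_Vprime hv; apply/mem_Vprime => l il.
by rewrite vcoefD hu // hv // addr0.
Qed.

Lemma VsubD nu u v : u \in Vsub k n r nu -> v \in Vsub k n r nu -> u + v \in Vsub k n r nu.
Proof. by rewrite !inE AscaleD => /eqP -> /eqP ->; rewrite addr0. Qed.

Lemma XnD_neq0 i w : w \in Vprime k n i -> Xn k n i + w != 0.
Proof.
move=> /mem_Vprime h; apply/eqP => /(congr1 (fun v => vcoef v i 0)).
by rewrite vcoefD vcoef_Xn !eqxx h // addr0 vcoef0; apply/eqP/oner_neq0.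
Qed.

(** Take for i the last coordinate with a nonzero top coefficient and for c that coefficient. Hence,
    outside V_(n-1), every reciprocal is a constant times an element of some E_i. *)
Lemma top_decomp u : u \notin Vsub k n r n.-1 ->
  exists i c w, [/\ c != 0, w \in Vprime k n i, vcoef u i 0 != 0 &
    u = c *: (Xn k n i + w)].
Proof.
move=> uV; have [i0 hi0] : exists i, vcoef u i 0 != 0.
  apply/existsP; apply: contraR uV; rewrite negb_exists => /forallP h.
  by apply/Vsub_top => i; apply/eqP; have := h i; rewrite negbK.
have [i ui imax] := @arg_maxnP _ i0 (fun i => vcoef u i 0 != 0) (fun i => i : nat) hi0.
exists i, (vcoef u i 0), ((vcoef u i 0)^-1 *: u - Xn k n i); split => //.
  apply/mem_Vprime => l il; rewrite vcoefD vcoefN vcoefZ vcoef_Xn eqxx andbT.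
  case: eqP => [->|/eqP li]; first by rewrite mulVf ?subrr.
  have [->|ul] := eqVneq (vcoef u l 0) 0; first by rewrite mulr0 subrr.
  have := imax _ ul; rewrite /= leqNgt => /negP[].
  by rewrite ltn_neqAle il andbT eq_sym; apply: contraNneq li => /val_inj ->.
by rewrite addrC subrK scalerA mulfV ?scale1r.
Qed.

Lemma Ascale_onto nu v : (nu <= n)%N -> v \in Vsub k n r (n - nu) ->
  exists u, v = Ascale 'X^nu u.
Proof.
move=> nun /mem_Vsub h.
exists (vmk (fun i j => vcoef v i (j + nu))); apply: vcoefP => i j jn.
rewrite vcoef_Ascale jn andbT; case: leqP => nj.
  by rewrite vcoef_mk ?subnK // (leq_ltn_trans (leq_subr _ _)).
by apply: h; move: nun jn nj; lia.
Qed.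

(** With m minimal such that v lies in V_m, v is divisible by t^(n-m), and minimality keeps the
    quotient u out of V_(n-1). *)
Lemma torsion_decomp v : v != 0 ->
  exists nu u, [/\ (nu < n)%N, u \notin Vsub k n r n.-1 & v = Ascale 'X^nu u].
Proof.
move=> v0; have ex : exists m, v \in Vsub k n r m by exists n; exact: Vsub_n.
case: (ex_minnP ex) => m vm mmin.
have m0 : (0 < m)%N by case: m vm {mmin} => //; rewrite Vsub0 (negPf v0).
have mn : (m <= n)%N by apply: mmin; exact: Vsub_n.
have [|u e] := @Ascale_onto (n - m) v (leq_subr _ _); first by rewrite subKn.
exists (n - m)%N, u; split=> //; first by lia.
apply/negP => uV; have : v \in Vsub k n r m.-1.
  by move: uV; rewrite e !inE AscaleA (_ : m.-1 + (n - m) = n.-1)%N //; lia.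
by move/mmin; lia.
Qed.

(** Coordinates l < i are arbitrary, q^n choices each; coordinates l >= i have constant coefficient
    0, q^(n-1) choices each. *)
Lemma card_Vprime i : #|Vprime k n i| = (#|k| ^ (r * (n - 1) + i))%N.
Proof.
pose F (l : 'I_r) : {set Q} := [set a : Q | (i <= l)%N ==> ((a : {poly k})`_0 == 0)].
have -> : #|Vprime k n i| = #|family (fun l => mem (F l))|.
  apply: eq_card => v; apply/idP/familyP => [/mem_Vprime h l|h].
    by rewrite inE; apply/implyP => il; apply/eqP; exact: h.
  by apply/mem_Vprime => l il; have := h l; rewrite inE il /= => /eqP.
have cQ : #|Q| = (#|k| ^ n)%N by rewrite card_monic_qpoly ?monicXn ?size_polyXn.
have c0 : #|[set a : Q | (a : {poly k})`_0 == 0]| = (#|k| ^ (n - 1))%N.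
  (* Translation by the constant c carries the fibre over 0 to the fibre over c, so all fibres of
     the constant coefficient have the same size. *)
  have fib (c : k) : #|[set a : Q | (a : {poly k})`_0 == c]|
                   = #|[set a : Q | (a : {poly k})`_0 == 0]|.
    have e0 : (in_qpoly 'X^n c%:P : {poly k})`_0 = c by rewrite coef_in_qpoly n_gt0 coefC.
    rewrite -[RHS](card_imset _ (addIr (in_qpoly 'X^n c%:P : Q))); apply: eq_card => a.
    rewrite inE; apply/idP/imsetP => [/eqP h|[b]].
      exists (a - in_qpoly 'X^n c%:P); last by rewrite subrK.
      by rewrite inE /= coefB e0 h subrr.
    by rewrite inE => /eqP hb ->; rewrite /= coefD e0 hb add0r eqxx.
  have : #|Q| = (#|k| * #|[set a : Q | ((a : {poly k})`_0 == 0)%R]|)%N.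
    rewrite -sum_nat_const -[LHS]sum1_card.
    rewrite (partition_big (fun a : Q => (a : {poly k})`_0) predT) //.
    apply: eq_big => // c _; rewrite -(fib c) -sum1_card; apply: eq_bigl => a.
    by rewrite !inE.
  rewrite cQ -{1}(subnK n_gt0) addn1 expnS => /eqP; rewrite eqn_pmul2l; first by move/eqP.
  by apply/card_gt0P; exists 0.
have cF l : #|F l| = (#|k| ^ ((n - 1) + (l < i)))%N.
  rewrite /F; case: ltnP => li.
    by rewrite addn1 subn1 prednK // -cQ; apply: eq_card => a; rewrite !inE.
  by rewrite addn0 -c0; apply: eq_card => a; rewrite !inE.
rewrite card_family foldrE big_map big_enum /= (eq_bigr _ (fun l _ => cF l)).
rewrite -expn_sum big_split /= sum_nat_const card_ord; congr (_ ^ (_ + _))%N.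
rewrite -[RHS](card_ord i) -sum1_card -big_mkcond /=.
rewrite (big_ord_widen_cond _ xpredT (fun=> 1%N) (ltnW (ltn_ord i))).
by apply: eq_bigr.
Qed.

End TorsionVectors.

(** * Homomorphisms from [R_n] to fields *)

Lemma invM_partial_fraction (F : fieldType) (x y : F) :
  x != 0 -> y != 0 -> x + y != 0 -> x^-1 * y^-1 = (x + y)^-1 * (x^-1 + y^-1).
Proof. by move=> x0 y0 xy0; field; rewrite x0 y0 xy0. Qed.

(** [R_V] lies in the localization of the symmetric algebra at the nonzero
    vectors, so an injective linear map from [V] to a field [K] induces a ring
    homomorphism even though [Sym V -> K] need not be injective. *)
Section ReciprocalLift.
Variables (k : fieldType) (V : vectType k) (K : fieldType).
Variables (iota : {rmorphism k -> K}) (lam : V -> K).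
Hypothesis lamD : {morph lam : u v / u + v}.
Hypothesis lamZ : forall c v, lam (c *: v) = iota c * lam v.
Hypothesis lam_inj : forall v, lam v = 0 -> v = 0.

Definition symlift : {rmorphism symAlg V -> K} := projT1 (symV_lift lamD lamZ).

Lemma symliftC c : symlift c%:MP = iota c.
Proof. by rewrite /symlift; case: symV_lift => m [/= -> _]. Qed.

Lemma symliftV v : symlift (symV v) = lam v.
Proof. by rewrite /symlift; case: symV_lift => m [/= _ ->]. Qed.

(** A relation, because only fractions admitting a denominator with nonzero image have a value;
    [evaluates_to_uniq] turns it into a partial function. *)
Definition evaluates_to (x : KV V) (y : K) := exists P Q : symAlg V,
  [/\ symlift Q != 0, x = P%:F / Q%:F & y = symlift P / symlift Q].

Lemma symlift_neq0 Q : symlift Q != 0 -> Q != 0.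
Proof. by apply: contra_neq => ->; rewrite rmorph0. Qed.

Lemma evaluates_to_uniq x y z : evaluates_to x y -> evaluates_to x z -> y = z.
Proof.
move=> [P [Q [Q0 -> ->]]] [P' [Q' [Q0' /eqP e ->]]].
move: e; rewrite eqr_div ?tofrac_eq0 ?symlift_neq0 // -!tofracM tofrac_eq => /eqP e.
by apply/eqP; rewrite eqr_div // -!rmorphM e.
Qed.

Lemma evaluates_toB x x' y y' : evaluates_to x y -> evaluates_to x' y' ->
  evaluates_to (x - x') (y - y').
Proof.
move=> [P [Q [Q0 -> ->]]] [P' [Q' [Q0' -> ->]]].
exists (P * Q' - P' * Q), (Q * Q'); split; first by rewrite rmorphM mulf_neq0.
  rewrite -mulNr addf_div ?tofrac_eq0 ?symlift_neq0 //.
  by rewrite tofracB !tofracM mulNr.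
by rewrite -mulNr addf_div // rmorphB !rmorphM mulNr.
Qed.

Lemma evaluates_toM x x' y y' : evaluates_to x y -> evaluates_to x' y' ->
  evaluates_to (x * x') (y * y').
Proof.
move=> [P [Q [Q0 -> ->]]] [P' [Q' [Q0' -> ->]]].
exists (P * P'), (Q * Q'); split; first by rewrite rmorphM mulf_neq0.
  by rewrite mulf_div !tofracM.
by rewrite mulf_div !rmorphM.
Qed.

Lemma evaluates_to_const c : evaluates_to (KVconst V c) (iota c).
Proof.
exists c%:MP, 1; rewrite rmorph1 oner_neq0; split => //.
  by rewrite tofrac1 divr1.
by rewrite symliftC divr1.
Qed.

Lemma evaluates_to_inv v : v != 0 -> evaluates_to (KVinv v) (lam v)^-1.
Proof.
move=> v0; exists 1, (symV v); rewrite symliftV !rmorph1 !div1r; split=> //.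
by apply: contra_neq v0; exact: lam_inj.
Qed.

Lemma RV_evaluates (x : RV V) : exists y, evaluates_to (RVval x) y.
Proof.
elim/RV_ind: x => [c|v v0|x y [c hc] [d hd]|x y [c hc] [d hd]].
- by exists (iota c); exact: evaluates_to_const.
- by exists (lam v)^-1; exact: evaluates_to_inv.
- by exists (c - d); rewrite rmorphB; exact: evaluates_toB.
- by exists (c * d); rewrite rmorphM; exact: evaluates_toM.
Qed.

Definition RVlift (x : RV V) : K := projT1 (cid (RV_evaluates x)).

Lemma RVliftE (x : RV V) y : evaluates_to (RVval x) y -> RVlift x = y.
Proof. by rewrite /RVlift; case: cid => z /= hz; exact: evaluates_to_uniq. Qed.

Lemma RVliftP x : evaluates_to (RVval x) (RVlift x).
Proof. by rewrite /RVlift; case: cid. Qed.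

Fact RVlift_zmod : zmod_morphism RVlift.
Proof. by move=> x y; apply: RVliftE; rewrite rmorphB; apply: evaluates_toB; exact: RVliftP. Qed.
Fact RVlift_monoid : monoid_morphism RVlift.
Proof.
split=> [|x y]; apply: RVliftE.
  by have := evaluates_to_const 1; rewrite !rmorph1.
by rewrite rmorphM; apply: evaluates_toM; exact: RVliftP.
Qed.
HB.instance Definition _ := GRing.isZmodMorphism.Build (RV V) K RVlift RVlift_zmod.
HB.instance Definition _ := GRing.isMonoidMorphism.Build (RV V) K RVlift RVlift_monoid.

Lemma RVlift_const c : RVlift (RVconst V c) = iota c.
Proof. by apply: RVliftE; exact: evaluates_to_const. Qed.

Lemma RVlift_inv v : RVlift (RVinv v) = (lam v)^-1.
Proof.
(* At v = 0 both sides are the default value 0 of the inverse. *)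
have [->|v0] := eqVneq v 0; last by apply: RVliftE; exact: evaluates_to_inv.
have -> : RVinv (0 : V) = 0 by apply: val_inj; rewrite /= /KVinv linear0 tofrac0 invr0.
have -> : lam 0 = 0 by rewrite -(scale0r 0) lamZ rmorph0 mul0r.
by rewrite rmorph0 invr0.
Qed.

End ReciprocalLift.

(** * Relations in R_n and its universal property for fields *)

Section RnRelations.
Variables (k : finFieldType) (n r : nat).
Hypothesis n_gt0 : (0 < n)%N.
Local Notation V := (Vn k n r).
Local Notation scal := (Rn_scal k n r).
Local Notation cst c := (scal (ratfun_const k c)).
Implicit Types (u v w : V).

Lemma recipE v : recip v = Rn_class k n r (RVl V (RVinv v)).
Proof. by []. Qed.

Lemma RVl_const c : RVl V (RVconst V c) = RVr V (ratfun_const k c).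
Proof. by rewrite /= /tinl /tinr -[RVconst V c]mulr1 tpure_bal mulr1. Qed.

(** The case c = 0 is included: both sides are then 0, by the conventions for the inverse of 0. *)
Lemma recipZ c v : recip (c *: v) = cst c^-1 * recip v.
Proof.
rewrite !recipE /Rn_scal /= -RVl_const -[Rn_class _ _ _ _ * _]rmorphM -[_ * _]rmorphM.
congr (Rn_class _ _ _ (RVl _ _)); apply: val_inj => /=.
rewrite /KVinv linearZ /= -mul_mpolyC tofracM invfM; congr (_ * _).
by rewrite -[X in _ = X]/(KVconst V c^-1) fmorphV.
Qed.

Lemma recipM v w : v != 0 -> w != 0 -> v + w != 0 ->
  recip v * recip w = recip (v + w) * (recip v + recip w).
Proof.
move=> v0 w0 vw0; rewrite !recipE -!rmorphD -!rmorphM.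
congr (Rn_class _ _ _ (RVl _ _)); apply: val_inj => /=; rewrite /KVinv.
have nz (x : V) : x != 0 -> (symV x)%:F != 0 by move=> x0; rewrite tofrac_eq0 symV_neq0.
have e : (symV (v + w))%:F = (symV v)%:F + (symV w)%:F by rewrite linearD tofracD.
rewrite e; apply: invM_partial_fraction; rewrite ?nz //.
by rewrite -e nz.
Qed.

Lemma recip_torsion nu v : (nu <= n)%N -> v \notin Vsub k n r nu ->
  scal ('X^nu)%:F * recip (Ascale 'X^nu v) = \sum_(v' in Vsub k n r nu) recip (v - v').
Proof.
move=> nun vV; have : relator ('X^nu : {poly k}) nu v \in @Rn_ideal k n r.
  apply/asboolP => J _ JS _ _; apply: JS; exists 1, nu, v.
  by rewrite scale1r oner_neq0.
move/Rn_class0; rewrite /relator rmorphB rmorph_sum => /eqP; rewrite subr_eq0 => /eqP <-.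
by rewrite mulrC /Rn_scal /= /recip -rmorphM tpureM mulr1 mul1r.
Qed.

Lemma Rn_ind (P : Rn k n r -> Prop) :
    (forall c, P (scal c)) -> (forall v, v != 0 -> P (recip v)) ->
    (forall x y, P x -> P y -> P (x - y)) ->
    (forall x y, P x -> P y -> P (x * y)) -> forall x, P x.
Proof.
move=> Pc Pv PB PM x.
have PD y z : P y -> P z -> P (y + z).
  move=> hy hz; rewrite -[z]opprK; apply: (PB) => //; rewrite -sub0r; apply: (PB) => //.
  by rewrite -(rmorph0 scal).
have -> : x = Rn_class k n r (repr x) by rewrite /= reprK.
elim/tensor_ind: (repr x) => [|y z hy hz|a b]; first by rewrite rmorph0 -(rmorph0 scal).
  by rewrite rmorphD; exact: PD.
rewrite rmorphM; apply: (PM); last exact: (Pc).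
elim/RV_ind: a => [c|v v0|y z hy hz|y z hy hz]; last by rewrite !rmorphM; exact: PM.
- by rewrite -[tinl _ _ _]/(RVl V _) RVl_const; exact: Pc.
- exact: Pv.
- by rewrite !rmorphB; exact: PB.
Qed.

Section Lift.
Variables (K : fieldType) (iF : {rmorphism ratfun k -> K}) (lam : V -> K).
Hypothesis lamD : {morph lam : u v / u + v}.
Hypothesis lamZ : forall c v, lam (c *: v) = iF (ratfun_const k c) * lam v.
Hypothesis lam_inj : forall v, lam v = 0 -> v = 0.
Hypothesis lam_torsion : forall nu v, (nu <= n)%N -> v \notin Vsub k n r nu ->
  iF ('X^nu)%:F / lam (Ascale 'X^nu v) = \sum_(v' in Vsub k n r nu) (lam (v - v'))^-1.

Fact Rn_lift_compat c :
  RVlift (iota := iF \o ratfun_const k) lamD lamZ lam_inj (RVconst V c) = iF (ratfun_const k c).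
Proof. by rewrite RVlift_const. Qed.

Let h0 : {rmorphism RVF V -> K} := tlift Rn_lift_compat.

Let h0_pure v b : h0 (tpure (@RVconst k V) (ratfun_const k) (RVinv v) b) = iF b / lam v.
Proof.
rewrite -[RVinv v]mulr1 -[b]mul1r -tpureM rmorphM /= tlift_inl tlift_inr /=.
by rewrite RVlift_inv mul1r mulrC.
Qed.

Let h0_ideal x : x \in @Rn_ideal k n r -> h0 x = 0.
Proof.
move=> /asboolP /(_ (fun x => h0 x = 0)); apply => [|_ [c [nu [v [c0 nun vV ->]]]]|y z|a y].
- exact: rmorph0.
(* The constant alpha cancels against the homogeneity of [lam], so the torsion hypothesis for a =
   t^nu suffices for all relators. *)
- rewrite /relator rmorphB rmorph_sum h0_pure AscaleE // lamZ -mul_polyC tofracM rmorphM.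
  rewrite -[c%:P%:F]/(ratfun_const k c) -mulf_div divff ?fmorph_eq0 // mul1r.
  rewrite lam_torsion //; apply/eqP; rewrite subr_eq0; apply/eqP/eq_bigr => v' _.
  by rewrite h0_pure rmorph1 mul1r.
- by rewrite rmorphD => -> ->; rewrite addr0.
- by rewrite rmorphM => ->; rewrite mulr0.
Qed.

Definition Rn_lift_fun (x : Rn k n r) : K := h0 (repr x).

Lemma Rn_lift_class y : Rn_lift_fun (Rn_class k n r y) = h0 y.
Proof.
apply/eqP; rewrite -subr_eq0 -rmorphB; apply/eqP/h0_ideal.
by apply/Rn_class0; rewrite rmorphB /= reprK subrr.
Qed.

Fact Rn_lift_zmod : zmod_morphism Rn_lift_fun.
Proof.
move=> x y; rewrite -[x]reprK -[y]reprK -!/(Rn_class _ _ _ _) -rmorphB !Rn_lift_class.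
by rewrite rmorphB.
Qed.
Fact Rn_lift_monoid : monoid_morphism Rn_lift_fun.
Proof.
split; first by rewrite -(rmorph1 (Rn_class k n r)) Rn_lift_class rmorph1.
move=> x y; rewrite -[x]reprK -[y]reprK -!/(Rn_class _ _ _ _) -rmorphM !Rn_lift_class.
by rewrite rmorphM.
Qed.
HB.instance Definition _ := GRing.isZmodMorphism.Build (Rn k n r) K Rn_lift_fun Rn_lift_zmod.
HB.instance Definition _ := GRing.isMonoidMorphism.Build (Rn k n r) K Rn_lift_fun Rn_lift_monoid.

(** By [lam_torsion] the map induced on the tensor product of R_V and F kills the relators. A level
    structure thus gives a K-valued point of R_n. *)
Lemma Rn_lift : {h : {rmorphism Rn k n r -> K} |
  (forall c, h (scal c) = iF c) /\ (forall v, h (recip v) = (lam v)^-1)}.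
Proof.
exists Rn_lift_fun; split=> [c|v] /=; first by rewrite Rn_lift_class /= tlift_inr.
by rewrite Rn_lift_class h0_pure rmorph1 mul1r.
Qed.

End Lift.
End RnRelations.

(** * Spanning *)

Section Nakayama.
Variable k : finFieldType.
Local Notation F := (ratfun k).
Local Notation t := ('X%:F : F).

(** The substitution of 1/t for the variable. Its image F_q[1/t] consists of functions regular at t
    = oo, and multiples of the variable go to functions vanishing there. *)
Definition sev : {rmorphism {poly k} -> F} :=
  horner_eval t^-1 \o map_poly (ratfun_const k).

Arguments sev : simpl never.

Lemma sevC c : sev c%:P = ratfun_const k c.
Proof. by rewrite /sev /= map_polyC /= /horner_eval hornerC. Qed.

Lemma sevX : sev 'X = t^-1.
Proof. by rewrite /sev /= map_polyX /horner_eval hornerX. Qed.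

(** Multiplying p(1/t) by t^N, with N the degree of p, gives the reversed polynomial, whose
    coefficient of t^N is the constant coefficient of p. *)
Lemma sev_neq0 (p : {poly k}) : p`_0 = 1 -> sev p != 0.
Proof.
move=> p0; have tn0 : t != 0 by rewrite tofrac_eq0 polyX_eq0.
pose N := (size p).-1; pose q := \sum_(i < size p) p`_i *: 'X^(N - i).
have : t ^+ N * sev p = q%:F.
  rewrite -[X in sev X](coefK p) poly_def rmorph_sum mulr_sumr /q rmorph_sum.
  apply: eq_bigr => i _; rewrite -!mul_polyC !rmorphM sevC !rmorphXn sevX mulrCA.
  congr (_ * _); rewrite exprVn -expfB_cond; first by rewrite ?tofracXn -?rmorphXn.
  by rewrite (negPf tn0) add0n /N -ltnS; have := ltn_ord i; lia.
move=> e; apply: contra_neq (oner_neq0 k) => p1; move: e; rewrite p1 mulr0.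
move=> /esym /eqP; rewrite tofrac_eq0 => /eqP q0.
have s0 : (0 < size p)%N.
  rewrite lt0n size_poly_eq0; apply: contraTneq isT => pp.
  by move: p0; rewrite pp coef0 => /esym/eqP; rewrite oner_eq0.
have := congr1 (fun q : {poly k} => q`_N) q0.
rewrite coef0 /q coef_sum (bigD1 (Ordinal s0)) //= subn0 coefZ coefXn eqxx mulr1 p0.
rewrite big1 ?addr0 // => i i0; rewrite coefZ coefXn; case: eqP; rewrite ?mulr0 // => e.
have iN : (i : nat) != 0%N by [].
clear i0; have := ltn_ord i; move: e iN s0; rewrite /N; clear.
by case: (size p) (nat_of_ord i); lia.
Qed.

(** Nakayama's lemma at the place [t = oo], with uniformizer [1/t]. *)
Lemma nakayama (A : comNzRingType) (scal : {rmorphism F -> A}) (J : finType)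
    (m : J -> A) (S : A -> Prop) :
    S 0 -> (forall u v, S u -> S v -> S (u + v)) -> (forall c u, S u -> S (scal c * u)) ->
    (forall j, exists C : J -> {poly k},
       S (m j - \sum_l scal (sev ('X * C l)) * m l)) ->
  forall j, S (m j).
Proof.
move=> S0 SD SZ /fin_all_exists [C hC] j.
pose N := #|J|; pose ev (a : 'I_N) : J := enum_val a.
pose er (l : J) : 'I_N := enum_rank l.
have erK l : ev (er l) = l by exact: enum_rankK.
have evK a : er (ev a) = a by exact: enum_valK.
(* At X = 0 the matrix B becomes the identity, so its determinant has constant coefficient 1 and
   stays nonzero under X := 1/t. The inverse of B(1/t) then expresses each [m j] through elements of
   S. *)
pose B : 'M[{poly k}]_N := \matrix_(a, b) ((a == b)%:R - 'X * C (ev a) (ev b)).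
have detB : (\det B)`_0 = 1.
  have -> : (\det B)`_0 = horner_eval 0 (\det B) by rewrite /horner_eval horner_coef0.
  rewrite -det_map_mx (_ : map_mx _ B = 1%:M) ?det1 //; apply/matrixP => a b.
  rewrite !mxE rmorphB rmorphM rmorph_nat /= /horner_eval hornerX mul0r subr0.
  by [].
pose D := map_mx sev B.
have DU : D \in unitmx by rewrite unitmxE det_map_mx unitfE sev_neq0.
have sD a : S (\sum_b scal (D a b) * m (ev b)).
  have := hC (ev a); congr S; rewrite (reindex_onto ev er) /=; last first.
    by move=> l _; rewrite erK.
  transitivity (\sum_b scal (sev (a == b)%:R) * m (ev b)
     - \sum_b scal (sev ('X * C (ev a) (ev b))) * m (ev b)).
    congr (_ - _); last first.
      by apply: eq_bigl => b; rewrite evK eqxx.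
    rewrite (bigD1 a) //= eqxx !rmorph1 mul1r big1 ?addr0 // => b ba.
    by rewrite eq_sym (negPf ba) !rmorph0 mul0r.
  rewrite -sumrB; apply: eq_bigr => b _; rewrite -mulrBl -!rmorphB; congr (scal _ * _).
  by rewrite !mxE.
have -> : m j = \sum_a scal (invmx D (er j) a) * \sum_b scal (D a b) * m (ev b).
  under eq_bigr do rewrite mulr_sumr.
  rewrite exchange_big /=.
  transitivity (\sum_b scal ((1%:M : 'M_N) (er j) b) * m (ev b)).
    rewrite (bigD1 (er j)) //= mxE eqxx rmorph1 mul1r erK big1 ?addr0 //.
    by move=> b bj; rewrite mxE eq_sym (negPf bj) rmorph0 mul0r.
  apply: eq_bigr => b _; rewrite -(mulVmx DU) mxE rmorph_sum mulr_suml.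
  by apply: eq_bigr => a _; rewrite rmorphM mulrA.
by apply: (big_ind S) => // a _; exact: SZ.
Qed.

End Nakayama.

(** * Reduction of products of reciprocals *)

Section Spanning.
Variables (k : finFieldType) (n r : nat).
Hypothesis n_gt0 : (0 < n)%N.
Local Notation V := (Vn k n r).
Local Notation F := (ratfun k).
Variables (A : comNzRingType) (scal : {rmorphism F -> A}) (x : V -> A).
Local Notation cst c := (scal (ratfun_const k c)).
Hypothesis xZ : forall c (v : V), x (c *: v) = cst c^-1 * x v.
Hypothesis xM : forall v w : V, v != 0 -> w != 0 -> v + w != 0 ->
  x v * x w = x (v + w) * (x v + x w).
Hypothesis x_torsion : forall nu v, (nu <= n)%N -> v \notin Vsub k n r nu ->
  scal ('X^nu)%:F * x (Ascale 'X^nu v) = \sum_(v' in Vsub k n r nu) x (v - v').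
Local Notation W := {ffun 'I_r -> V}.
Local Notation Xn i := (Xn k n i).
Local Notation V' i := (Vprime k n i).

Definition fsum (i : 'I_r) : A := \sum_(w in V' i) x (Xn i + w).
(** The index set of E_I; requiring the value 0 outside I gives each choice of factors a single
    index. *)
Definition esupp (I : {set 'I_r}) : {set W} :=
  [set o : W | [forall i, if i \in I then o i \in V' i else o i == 0]].
Definition eprod (I : {set 'I_r}) (o : W) : A := \prod_(i in I) x (Xn i + o i).
Definition fpow (b : 'X_{1..r}) : A := \prod_i fsum i ^+ b i.
Definition msupported (b : 'X_{1..r}) (I : {set 'I_r}) := forall i, i \notin I -> b i = 0%N.

(** The F-span of the f^b e with e in E_I, b supported in I and |b| <= d. The degree bound serves
    the counting argument for algebraic independence. *)
Inductive Span (d : nat) : A -> Prop :=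
| Span0 : Span d 0
| SpanD u v : Span d u -> Span d v -> Span d (u + v)
| Span_gen c b I o : msupported b I -> o \in esupp I -> (mdeg b <= d)%N ->
    Span d (scal c * (fpow b * eprod I o)).

Lemma SpanZ d c u : Span d u -> Span d (scal c * u).
Proof.
elim=> [|u1 u2 _ h1 _ h2|c' b I o hb ho hd]; first by rewrite mulr0; exact: Span0.
  by rewrite mulrDr; exact: SpanD.
by rewrite mulrA -rmorphM; exact: Span_gen.
Qed.

Lemma SpanN d u : Span d u -> Span d (- u).
Proof. by move/(SpanZ (-1)); rewrite rmorphN1 mulN1r. Qed.

Lemma Span_le d d' u : (d <= d')%N -> Span d u -> Span d' u.
Proof.
move=> dd; elim=> [|u1 u2 _ h1 _ h2|c b I o hb ho hd]; [exact: Span0|exact: SpanD|].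
by apply: Span_gen => //; exact: leq_trans dd.
Qed.

Lemma Span1 : Span 0 1.
Proof.
have -> : 1 = scal 1 * (fpow 0%MM * eprod set0 0).
  rewrite rmorph1 mul1r /eprod big_set0 mulr1 /fpow big1 // => i _.
  by rewrite mnm0E expr0.
apply: Span_gen; rewrite ?mdeg0 //; first by move=> i _; rewrite mnm0E.
by rewrite inE; apply/forallP => i; rewrite inE ffunE.
Qed.

Lemma esuppP I o i : o \in esupp I -> i \in I -> o i \in V' i.
Proof. by rewrite inE => /forallP /(_ i); case: ifP. Qed.

Lemma esupp_out I o i : o \in esupp I -> i \notin I -> o i = 0.
Proof. by rewrite inE => /forallP /(_ i); case: ifP => // _ /eqP. Qed.

Definition fupd (o : W) i w : W := [ffun j => if j == i then w else o j].

Lemma fupd_supp I o i w : o \in esupp I -> w \in V' i -> fupd o i w \in esupp (i |: I).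
Proof.
move=> oI wV; rewrite inE; apply/forallP => j; rewrite in_setU1 ffunE.
case: eqP => [->|_] //=; case: ifPn => jI; first exact: esuppP oI jI.
by rewrite (esupp_out oI jI).
Qed.

Lemma eprod_upd I o i w :
  eprod (i |: I) (fupd o i w) = x (Xn i + w) * \prod_(j in I | j != i) x (Xn j + o j).
Proof.
rewrite /eprod (bigD1 i) ?setU11 //= ffunE eqxx; congr (_ * _).
apply: eq_big => j; rewrite ?in_setU1; first by case: eqP; rewrite ?andbF.
by case: eqP => //= e; rewrite ?andbF // ffunE => _; case: eqP.
Qed.

Lemma x_top u : u \notin Vsub k n r n.-1 -> exists i a w,
  [/\ w \in V' i, vcoef u i 0 != 0 & x u = cst a * x (Xn i + w)].
Proof.
move=> /(top_decomp n_gt0) [i [c [w [c0 wV ui e]]]]; exists i, c^-1, w; split=> //.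
by rewrite e xZ.
Qed.

(** Write c = t^(nu+1) u with u outside V_(n-1). The torsion relation gives x_c as t^-(nu+1) times
    the sum of the x_(u-v'), v' in V_(nu+1), and each of these is a constant times an element of
    some E_i; so all coefficients are divisible by 1/t in F_q[1/t]. *)
Lemma x_low (c : V) (P : A -> Prop) : c != 0 -> c \in Vsub k n r n.-1 ->
    P 0 -> (forall u v, P u -> P v -> P (u + v)) ->
    (forall (C : {poly k}) i w, w \in V' i -> P (scal (sev k ('X * C)) * x (Xn i + w))) ->
  P (x c).
Proof.
move=> c0 cV P0 PD PG.
have [[|nu] [u [nun uV e]]] := torsion_decomp n_gt0 c0.
  by move: cV; rewrite e Ascale0 // (negPf uV).
have uV' : u \notin Vsub k n r nu.+1.
  apply: contra uV => /(mem_Vsub n_gt0) h; apply/(mem_Vsub n_gt0) => i j jn.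
  by apply: h; move: jn nun; clear; lia.
have X0 : ('X^(nu.+1) : {poly k})%:F != 0 by rewrite tofrac_eq0 monic_neq0 ?monicXn.
have -> : x c = scal ('X^(nu.+1))%:F^-1 * \sum_(v' in Vsub k n r nu.+1) x (u - v').
  by rewrite -x_torsion ?(ltnW nun) // mulrA -rmorphM mulVf // rmorph1 mul1r e.
rewrite mulr_sumr; apply: (big_ind P) => // v' v'V.
(* Because nu + 1 < n, the element v' lies in V_(n-1), while u does not. *)
have : u - v' \notin Vsub k n r n.-1.
  apply: contra uV => h; rewrite -(subrK v' u); apply: VsubD => //.
  apply/(mem_Vsub n_gt0) => i j jn; move/(mem_Vsub n_gt0): v'V; apply.
  by move: jn nun; clear; lia.
move=> /x_top [i [a [w [wV _ ->]]]]; rewrite mulrA -rmorphM.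
suff -> : ('X^(nu.+1))%:F^-1 * ratfun_const k a = sev k ('X * ('X^nu * a%:P)) by exact: PG.
by rewrite mulrA -exprS rmorphM sevC tofracXn -exprVn -sevX rmorphXn.
Qed.

Lemma x_span (c : V) (P : A -> Prop) : c != 0 ->
    P 0 -> (forall u v, P u -> P v -> P (u + v)) ->
    (forall a i w, w \in V' i -> P (scal a * x (Xn i + w))) ->
  P (x c).
Proof.
move=> c0 P0 PD PG; case: (boolP (c \in Vsub k n r n.-1)) => cV.
  by apply: x_low => // C i w wV; exact: PG.
by have [i [a [w [wV _ ->]]]] := x_top cV; exact: PG.
Qed.

Section Step.
Variables (d : nat) (b : 'X_{1..r}).
Hypothesis bd : (mdeg b <= d)%N.
Local Notation J := ('I_r * V * ({set 'I_r} * W))%type.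

Definition step_valid (j : J) :=
  [&& j.1.2 \in V' j.1.1, j.2.2 \in esupp j.2.1 & `[< msupported b j.2.1 >]].
(** The value 0 at invalid indices lets the family run over a whole finite type, as [nakayama]
    requires. *)
Definition step_gen (j : J) : A :=
  if step_valid j then x (Xn j.1.1 + j.1.2) * (fpow b * eprod j.2.1 j.2.2) else 0.

(** Membership in [Span d.+1] modulo 1/t, that is, up to an F_q[1/t]-combination of the [step_gen]
    divisible by 1/t: the form of the hypothesis of [nakayama]. *)
Let T u := exists C : J -> {poly k},
  Span d.+1 (u - \sum_l scal (sev k ('X * C l)) * step_gen l).

Let T_Span u : Span d.+1 u -> T u.
Proof.
move=> h; exists (fun=> 0); rewrite big1 ?subr0 // => l _.
by rewrite mulr0 !rmorph0 mul0r.
Qed.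

Let TD u v : T u -> T v -> T (u + v).
Proof.
move=> [C hC] [D hD]; exists (fun l => C l + D l).
have -> : u + v - \sum_l scal (sev k ('X * (C l + D l))) * step_gen l =
   (u - \sum_l scal (sev k ('X * C l)) * step_gen l)
   + (v - \sum_l scal (sev k ('X * D l)) * step_gen l).
  rewrite addrACA -opprD -big_split /=; congr (_ - _); apply: eq_bigr => l _.
  by rewrite mulrDr !rmorphD mulrDl.
exact: SpanD.
Qed.

Let TZ c u : T u -> T (cst c * u).
Proof.
move=> [C hC]; exists (fun l => c%:P * C l).
have -> : cst c * u - \sum_l scal (sev k ('X * (c%:P * C l))) * step_gen l =
   cst c * (u - \sum_l scal (sev k ('X * C l)) * step_gen l).
  rewrite mulrBr mulr_sumr; congr (_ - _); apply: eq_bigr => l _.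
  by rewrite mulrCA rmorphM sevC rmorphM mulrA.
exact: SpanZ.
Qed.

Let TN u : T u -> T (- u).
Proof. by move/(TZ (-1)); rewrite !rmorphN1 mulN1r. Qed.

Let T_gen C l : T (scal (sev k ('X * C)) * step_gen l).
Proof.
exists (fun l' => if l' == l then C else 0).
rewrite (bigD1 l) //= eqxx big1 ?addr0 ?subrr; first exact: Span0.
by move=> j /negPf ->; rewrite mulr0 !rmorph0 mul0r.
Qed.

(** Induction on i. If i is not in I, the product belongs to E_J with J the union of I and {i}. If i
    is in I and w differs from o_i, partial fractions replace the new factor by x_c with c = o_i -
    w, which is either divisible by 1/t or a constant times an element of E_j with j < i. If w =
    o_i, the factor is f_i minus the other elements of E_i. *)
Lemma step_triangular i w I o : w \in V' i -> msupported b I -> o \in esupp I ->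
  T (x (Xn i + w) * (fpow b * eprod I o)).
Proof.
have [m] := ubnP (i : nat); elim: m i w I o => // m ih i w I o im wV bI oI.
case: (boolP (i \in I)) => iI; last first.
  apply: T_Span; rewrite mulrCA -[_ * _]mul1r -(rmorph1 scal).
  have -> : x (Xn i + w) * eprod I o = eprod (i |: I) (fupd o i w).
    rewrite eprod_upd; congr (_ * _); apply: eq_bigl => j.
    by case: eqP => [->|]; rewrite ?(negPf iI) ?andbT.
  apply: Span_gen; [|exact: fupd_supp|exact: leqW].
  by move=> j; rewrite in_setU1 negb_or => /andP[_]; exact: bI.
have iUI : i |: I = I by apply/setUidPr; rewrite sub1set.
have eu w' : eprod I (fupd o i w') =
    x (Xn i + w') * \prod_(j in I | j != i) x (Xn j + o j) by rewrite -{1}iUI eprod_upd.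
have uI w' : w' \in V' i -> fupd o i w' \in esupp I.
  by move=> hw; have := fupd_supp oI hw; rewrite iUI.
have uo : fupd o i (o i) = o by apply/ffunP => j; rewrite ffunE; case: eqP => // ->.
have oV := esuppP oI iI.
have neq w' : w' \in V' i -> w' != o i -> T (x (Xn i + w') * (fpow b * eprod I o)).
  move=> w'V wo; pose c := o i - w'.
  have c0 : c != 0 by rewrite subr_eq0 eq_sym.
  have cV : c \in V' i by exact: VprimeB.
  have -> : x (Xn i + w') * (fpow b * eprod I o) =
      x c * (fpow b * eprod I (fupd o i w')) - x c * (fpow b * eprod I o).
    have e1 : Xn i + w' + c = Xn i + o i by rewrite /c -addrA [w' + _]addrC subrK.
    have := xM (XnD_neq0 n_gt0 w'V) c0; rewrite e1 => /(_ (XnD_neq0 n_gt0 oV)) e2.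
    rewrite -{1 3}uo !eu.
    transitivity (x (Xn i + o i) * x (Xn i + w') *
      (fpow b * \prod_(j in I | j != i) x (Xn j + o j))); first by ring.
    have -> : x (Xn i + o i) * x (Xn i + w') = x (Xn i + w') * x c - x (Xn i + o i) * x c.
      by rewrite e2; ring.
    ring.
  have main o' : o' \in esupp I -> T (x c * (fpow b * eprod I o')).
    move=> o'I; case: (boolP (c \in Vsub k n r n.-1)) => cT.
      apply: (x_low (P := fun u => T (u * (fpow b * eprod I o')))) => //.
      - by rewrite mul0r; apply: T_Span; exact: Span0.
      - by move=> u v hu hv; rewrite mulrDl; exact: TD.
      - move=> C j v vV; have := T_gen C ((j, v), (I, o')).
        rewrite /step_gen /step_valid /= vV o'I /= (_ : `[< _ >]) ?mulrA //.
        exact/asboolP.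
    (* The top coefficients of c vanish from index i on, while the one at j does not; so j < i and
       the induction hypothesis applies. *)
    have [j [a [v [vV cj ->]]]] := x_top cT; rewrite -mulrA; apply: TZ; apply: ih => //.
    rewrite -ltnS (leq_trans _ im) // ltnS ltnNge; apply: contra cj => ij.
    by move/(mem_Vprime n_gt0): cV => ->.
  by apply: TD; [|apply: TN]; apply: main => //; exact: uI.
have [->|] := eqVneq w (o i); last exact: neq.
(* The sum over w' is covered by the case w' <> o_i; the factor f_i raises the exponent b by one at
   i, which is allowed since i is in I. *)
have -> : x (Xn i + o i) * (fpow b * eprod I o) = fsum i * (fpow b * eprod I o)
   - \sum_(w' in V' i | w' != o i) x (Xn i + w') * (fpow b * eprod I o).
  by rewrite /fsum (bigD1 (o i)) //= mulrDl mulr_suml addrK.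
apply: TD; last first.
  apply: TN; apply: (big_ind T) => [||w' /andP[]]; [|exact: TD|exact: neq].
  by apply: T_Span; exact: Span0.
apply: T_Span; rewrite mulrA -[_ * _]mul1r -(rmorph1 scal).
have -> : fsum i * fpow b = fpow (b + U_(i)).
  rewrite /fpow (bigD1 i) //= [RHS](bigD1 i) //= mulrA -exprS mnmDE mnm1E eqxx addn1.
  congr (_ * _); apply: eq_bigr => j ji.
  by rewrite mnmDE mnm1E eq_sym (negPf ji) addn0.
apply: Span_gen => //; last by rewrite mdegD mdeg1 addn1.
move=> j jI; rewrite mnmDE mnm1E bI //; case: eqP => // e; by rewrite -e iI in jI.
Qed.

Lemma x_mul_gen i w I o : w \in V' i -> msupported b I -> o \in esupp I ->
  Span d.+1 (x (Xn i + w) * (fpow b * eprod I o)).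
Proof.
move=> wV bI oI.
have h : forall j, Span d.+1 (step_gen j).
  apply: (@nakayama k A scal); [exact: Span0|exact: SpanD|exact: SpanZ|].
  move=> [[j v] [I' o']]; rewrite {1}/step_gen; case: ifPn => /=.
    by case/and3P=> /= vV o'I /asboolP bI'; exact: step_triangular.
  by move=> _; apply: T_Span; exact: Span0.
have := h ((i, w), (I, o)); rewrite /step_gen /step_valid /= wV oI /= (_ : `[< _ >]) //.
exact/asboolP.
Qed.

End Step.

Lemma x_mul_Span d (c : V) u : Span d u -> Span d.+1 (x c * u).
Proof.
have [->|c0] := eqVneq c 0.
  (* Homogeneity at the scalar 0 gives x_0 = 0. *)
  have -> : x 0 = 0 by rewrite -(scale0r 0) xZ invr0 !rmorph0 mul0r.
  by rewrite mul0r => _; exact: Span0.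
move=> hu; apply: (x_span (P := fun v => Span d.+1 (v * u))) => //.
- by rewrite mul0r; exact: Span0.
- by move=> v1 v2 h1 h2; rewrite mulrDl; exact: SpanD.
move=> a i w wV; rewrite -mulrA; apply: SpanZ.
elim: hu => [|u1 u2 _ h1 _ h2|a' b I o hb ho hd].
- by rewrite mulr0; exact: Span0.
- by rewrite mulrDr; exact: SpanD.
- by rewrite mulrCA; apply: SpanZ; exact: x_mul_gen.
Qed.

(** Each multiplication by a reciprocal raises the degree bound by at most one. The resulting bound,
    with no loss in the degree, is what the counting argument uses. *)
Lemma Span_mprod (c : 'I_r -> V) (m : 'X_{1..r}) :
  Span (mdeg m) (\prod_i x (c i) ^+ m i).
Proof.
rewrite mdegE; elim: (index_enum _) => [|i s ih]; first by rewrite !big_nil; exact: Span1.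
rewrite !big_cons; elim: (m i) => [|e ihe]; first by rewrite expr0 mul1r.
by rewrite exprS -mulrA addSn; exact: x_mul_Span.
Qed.

Lemma Span_all :
    (forall P : A -> Prop, (forall c, P (scal c)) -> (forall v, v != 0 -> P (x v)) ->
      (forall u v, P u -> P v -> P (u - v)) -> (forall u v, P u -> P v -> P (u * v)) ->
      forall u, P u) ->
  forall u, exists d, Span d u.
Proof.
move=> gen u.
(* Stability of the spans under multiplication by u, unlike membership of u alone, passes to
   products. *)
suff h : forall d v, Span d v -> exists d', Span d' (u * v).
  by have := h _ _ Span1; rewrite mulr1.
move: u; apply: gen => [c|v v0|u v hu hv|u v hu hv] d y hy.
- by exists d; exact: SpanZ.
- by exists d.+1; exact: x_mul_Span.
- have [d1 h1] := hu _ _ hy; have [d2 h2] := hv _ _ hy.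
  exists (maxn d1 d2); rewrite mulrBl; apply: SpanD.
    by apply: Span_le h1; rewrite leq_maxl.
  by apply: SpanN; apply: Span_le h2; rewrite leq_maxr.
- by have [d2 h2] := hv _ _ hy; have [d1 h1] := hu _ _ h2; exists d1; rewrite -mulrA.
Qed.

End Spanning.

(** * Generic level structures *)

Lemma horner_prod_XsubC (K : idomainType) (I : Type) (s : seq I) (F : I -> K) x :
  (\prod_(i <- s) ('X - (F i)%:P)).[x] = \prod_(i <- s) (x - F i).
Proof. by rewrite horner_prod; apply: eq_bigr => i _; rewrite hornerXsubC. Qed.

Lemma log_deriv_prod_XsubC (K : fieldType) (I : eqType) (s : seq I) (F : I -> K) x :
    (forall i, i \in s -> x != F i) ->
  (\prod_(i <- s) ('X - (F i)%:P))^`().[x] =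
    (\prod_(i <- s) (x - F i)) * \sum_(i <- s) (x - F i)^-1.
Proof.
elim: s => [|i s ih] h; first by rewrite !big_nil mul1r derivC horner0.
rewrite !big_cons derivM derivXsubC mul1r hornerD hornerM hornerXsubC horner_prod_XsubC.
rewrite ih => [|j js]; last by rewrite h // inE js orbT.
rewrite mulrDr [_ * _ * _^-1]mulrAC mulfV ?subr_eq0 ?h ?mem_head // mul1r.
by rewrite mulrA.
Qed.

(** The [k]-subspace polynomial [prod_(w in W) (X - w)] of a finite subspace
    [W] of [K] is additive: [P(X + y) - P(X) - P(y)] has degree less than [#|W|]
    and vanishes on [W]. *)
Section SubspacePolynomial.
Variables (k : finFieldType) (r : nat) (K : fieldType) (iota : {rmorphism k -> K}).
Variable Y : 'I_r -> K.
Hypothesis Y_free : forall a : 'I_r -> k, \sum_i iota (a i) * Y i = 0 -> forall i, a i = 0.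
Local Notation W := {ffun 'I_r -> k}.

Definition lincomb (a : W) : K := \sum_i iota (a i) * Y i.

Lemma lincombD a b : lincomb (a + b) = lincomb a + lincomb b.
Proof.
by rewrite -big_split; apply: eq_bigr => i _; rewrite ffunE rmorphD mulrDl.
Qed.

Lemma lincombZ c (a : W) : lincomb [ffun i => c * a i] = iota c * lincomb a.
Proof.
by rewrite mulr_sumr; apply: eq_bigr => i _; rewrite ffunE rmorphM mulrA.
Qed.

Lemma lincomb_eq0 a : lincomb a = 0 -> a = 0.
Proof. by move/Y_free => h; apply/ffunP => i; rewrite h ffunE. Qed.

Lemma lincombB a b : lincomb (a - b) = lincomb a - lincomb b.
Proof.
by rewrite -sumrB; apply: eq_bigr => i _; rewrite !ffunE rmorphB mulrBl.
Qed.

Lemma lincomb_inj : injective lincomb.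
Proof.
move=> a b e; apply/eqP; rewrite -subr_eq0; apply/eqP/lincomb_eq0.
by rewrite lincombB e subrr.
Qed.

Lemma lincomb0 : lincomb 0 = 0.
Proof. by rewrite -(subrr 0) lincombB subrr. Qed.

Lemma lincomb_delta i : lincomb [ffun j => (j == i)%:R] = Y i.
Proof.
rewrite /lincomb (bigD1 i) //= ffunE eqxx rmorph1 mul1r big1 ?addr0 // => j /negPf ji.
by rewrite ffunE ji rmorph0 mul0r.
Qed.

Definition subpoly : {poly K} := \prod_(a : W) ('X - (lincomb a)%:P).

Lemma subpolyE x : subpoly.[x] = \prod_(a : W) (x - lincomb a).
Proof. exact: horner_prod_XsubC. Qed.

Lemma size_subpoly : size subpoly = (#|W|).+1.
Proof. by rewrite size_prod_XsubC -sum1_size sum1_card. Qed.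

Lemma subpoly_monic : subpoly \is monic.
Proof. exact: monic_prod_XsubC. Qed.

Lemma subpoly_lincombD x a : subpoly.[x + lincomb a] = subpoly.[x].
Proof.
rewrite !subpolyE (reindex_inj (addIr a)) /=; apply: eq_bigr => b _.
by rewrite lincombD [lincomb b + _]addrC opprD addrA addrK.
Qed.

Lemma subpoly0 : subpoly.[0] = 0.
Proof. by rewrite subpolyE (bigD1 (0 : W)) //= lincomb0 subrr mul0r. Qed.

Lemma subpoly_lincomb a : subpoly.[lincomb a] = 0.
Proof. by rewrite -[lincomb a]add0r subpoly_lincombD subpoly0. Qed.

Lemma subpoly_shift y : subpoly \Po ('X + y%:P) = subpoly + (subpoly.[y])%:P.
Proof.
pose T := \prod_(a : W) ('X - (lincomb a - y)%:P).
have -> : subpoly \Po ('X + y%:P) = T.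
  rewrite /subpoly rmorph_prod; apply: eq_bigr => a _ /=.
  by rewrite comp_polyB comp_polyX comp_polyC polyCB opprB addrA.
apply/eqP; rewrite -subr_eq0; apply/eqP.
have TE z : T.[z] = subpoly.[z + y].
  rewrite horner_prod_XsubC subpolyE; apply: eq_bigr => a _.
  by rewrite opprB addrA.
apply: (@roots_geq_poly_eq0 _ _ [seq lincomb a | a <- enum {: W}]).
- apply/allP => z /mapP[a _ ->]; rewrite /root !hornerE TE subpoly_lincomb add0r.
  by rewrite [_ + y]addrC subpoly_lincombD subrr.
- by rewrite map_inj_uniq ?enum_uniq //; exact: lincomb_inj.
rewrite size_map -cardE; apply/leq_sizeP => j.
have sT : size T = (#|W|).+1 by rewrite size_prod_XsubC -sum1_size sum1_card.
have cardW : (0 < #|W|)%N by apply/card_gt0P; exists 0.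
rewrite opprD addrA leq_eqVlt => /predU1P[<-|jW].
  rewrite !coefB coefC gtn_eqF // subr0.
  have : lead_coef T - lead_coef subpoly = 0.
    by rewrite (monicP subpoly_monic) (monicP (monic_prod_XsubC _ _ _)) subrr.
  by rewrite /lead_coef sT size_subpoly.
rewrite !coefB coefC gtn_eqF ?(leq_trans _ jW) // !nth_default ?sT ?size_subpoly //.
by rewrite !subr0.
Qed.

Lemma subpolyD x y : subpoly.[x + y] = subpoly.[x] + subpoly.[y].
Proof.
by have := congr1 (fun p => p.[x]) (subpoly_shift y); rewrite horner_comp !hornerE.
Qed.

(** Scaling by a nonzero c permutes the roots and produces the factor c^(q^r), which equals c for c
    in F_q. *)
Lemma subpolyZ c x : subpoly.[iota c * x] = iota c * subpoly.[x].
Proof.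
have [->|c0] := eqVneq c 0; first by rewrite rmorph0 !mul0r subpoly0.
have inj : injective (fun a : W => [ffun i => c * a i] : W).
  move=> a b /ffunP e; apply/ffunP => i; have := e i; rewrite !ffunE.
  exact: mulfI.
rewrite !subpolyE (reindex_inj inj) /=.
under eq_bigr do rewrite lincombZ -mulrBr.
rewrite big_split /= prodr_const card_ffun card_ord; congr (_ * _).
rewrite -rmorphXn; congr (iota _); elim: (r) => [|m ih] /=; first by rewrite expr1.
by rewrite expnS exprM expf_card.
Qed.

(** Differentiating P(X + y) = P(X) + P(y) at X = 0 shows that an additive polynomial has constant
    derivative. *)
Lemma deriv_subpoly x : subpoly^`().[x] = subpoly^`().[0].
Proof.
have := congr1 (fun p => p^`().[0]) (subpoly_shift x).
rewrite deriv_comp !derivD derivX !derivC !addr0 mulr1 horner_comp.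
by rewrite !hornerE.
Qed.

Lemma deriv_subpoly0_neq0 : subpoly^`().[0] != 0.
Proof.
rewrite /subpoly (bigD1 (0 : W)) //= lincomb0 subr0 derivM derivX mul1r hornerD hornerM.
rewrite hornerX mul0r addr0 horner_prod; apply/prodf_neq0 => a a0.
rewrite hornerXsubC sub0r oppr_eq0; apply: contra_neq a0; exact: lincomb_eq0.
Qed.

(** The left side is the logarithmic derivative P'/P at x, and P' is constant. This is the source of
    the torsion relations. *)
Lemma sum_subpoly x : subpoly.[x] != 0 ->
  \sum_(a : W) (x - lincomb a)^-1 = subpoly^`().[0] / subpoly.[x].
Proof.
move=> x0; have xa a : a \in index_enum {: W} -> x != lincomb a.
  by move=> _; apply: contra_neq x0 => ->; exact: subpoly_lincomb.
rewrite -(deriv_subpoly x) /subpoly log_deriv_prod_XsubC // -subpolyE mulrAC mulfV //.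
by rewrite mul1r.
Qed.

End SubspacePolynomial.

(** Over an algebraically closed field, [phi_t(z) = t z prod_(a <> 0) (1 - z / y_a)],
    where [y_a] runs through the span of [Y], is [k]-linear and surjective;
    iterated preimages of the [Y i] yield a level structure of the Drinfeld
    module with [t |-> phi_t]. *)
Section LevelStructure.
Variables (k : finFieldType) (n r : nat).
Hypothesis n_gt0 : (0 < n)%N.
Local Notation V := (Vn k n r).
Variables (K : closedFieldType) (iF : {rmorphism ratfun k -> K}).
Local Notation iota := (iF \o ratfun_const k).
Local Notation tau := (iF 'X%:F).
Variable Y : 'I_r -> K.
Hypothesis Y_free : forall a : 'I_r -> k, \sum_i iota (a i) * Y i = 0 -> forall i, a i = 0.
Local Notation W := {ffun 'I_r -> k}.
Local Notation P := (subpoly iota Y).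
Local Notation lin := (lincomb iota Y).

Definition phit (z : K) : K := tau / P^`().[0] * P.[z].

Lemma tau_neq0 : tau != 0.
Proof. by rewrite fmorph_eq0 tofrac_eq0 polyX_eq0. Qed.

Lemma phit_scale_neq0 : tau / P^`().[0] != 0.
Proof. by rewrite mulf_neq0 ?invr_eq0 ?tau_neq0 ?deriv_subpoly0_neq0. Qed.

Lemma phitD x y : phit (x + y) = phit x + phit y.
Proof. by rewrite /phit subpolyD // mulrDr. Qed.

Lemma phitZ c x : phit (iota c * x) = iota c * phit x.
Proof. by rewrite /phit subpolyZ // mulrCA. Qed.

Lemma phit0 : phit 0 = 0.
Proof. by rewrite /phit subpoly0 mulr0. Qed.

Lemma phit_sum (I : Type) (s : seq I) (Q : pred I) (f : I -> K) :
  phit (\sum_(i <- s | Q i) f i) = \sum_(i <- s | Q i) phit (f i).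
Proof. exact: (big_morph phit phitD phit0). Qed.

Lemma phit_onto y : exists z, phit z = y.
Proof.
pose p := (tau / P^`().[0]) *: P - y%:P.
have sp : (1 < size ((tau / P^`().[0]) *: P))%N.
  by rewrite size_scale ?phit_scale_neq0 // size_subpoly ltnS; apply/card_gt0P; exists 0.
have sy : (size (- y%:P) < size ((tau / P^`().[0]) *: P))%N.
  by rewrite size_polyN (leq_ltn_trans (size_polyC_leq1 _)).
have /closed_rootP [z] : size p != 1%N by rewrite /p size_polyDl // gtn_eqF.
rewrite /root /p !hornerE subr_eq0 => /eqP e; exists z.
by rewrite /phit e.
Qed.

Definition phit_section : {g : K -> K | cancel g phit}.
Proof. by have [g hg] := choice phit_onto; exists g. Qed.

Definition tower (i : 'I_r) (m : nat) : K := iter m (sval phit_section) (Y i).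

Lemma phit_tower0 i : phit (tower i 0) = 0.
Proof.
by rewrite /phit /tower /= -(lincomb_delta iota Y i) subpoly_lincomb mulr0.
Qed.

Lemma phit_towerS i m : phit (tower i m.+1) = tower i m.
Proof. by rewrite /tower /=; case: phit_section => g /=. Qed.

(** X_i goes to the (n-1)-fold chosen preimage of Y_i under [phit] and t^j X_i to the (n-1-j)-fold
    one; in particular t^(n-1) X_i goes to Y_i. *)
Definition level (v : V) : K :=
  \sum_i \sum_(j < n) iota (vcoef v i j) * tower i (n.-1 - j).

Lemma levelD u v : level (u + v) = level u + level v.
Proof.
rewrite -big_split; apply: eq_bigr => i _; rewrite -big_split; apply: eq_bigr => j _.
by rewrite vcoefD // rmorphD mulrDl.
Qed.

Lemma levelZ c v : level (c *: v) = iota c * level v.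
Proof.
rewrite mulr_sumr; apply: eq_bigr => i _; rewrite mulr_sumr; apply: eq_bigr => j _.
by rewrite vcoefZ // rmorphM mulrA.
Qed.

Lemma levelB u v : level (u - v) = level u - level v.
Proof. by rewrite levelD -scaleN1r levelZ rmorphN1 mulN1r. Qed.

Lemma level_t v : level (Ascale 'X^1 v) = phit (level v).
Proof.
rewrite phit_sum; apply: eq_bigr => i _; rewrite phit_sum.
have h (j : nat) : (j < n)%N -> vcoef (Ascale 'X^1 v) i j = if (0 < j)%N then vcoef v i j.-1 else 0.
  by move=> jn; rewrite vcoef_Ascale // jn andbT subn1.
under eq_bigr => j _ do rewrite h //.
under [RHS]eq_bigr => j _ do rewrite phitZ.
move: {h} n_gt0 (vcoef v i); case: (n) => // m _ g.
(* Multiplication by t shifts the coefficients and drops the last one; correspondingly [phit] kills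
   Y_i, the bottom of the tower. *)
rewrite big_ord_recl big_ord_recr /= !rmorph0 mul0r add0r subnn phit_tower0 mulr0 addr0.
apply: eq_bigr => j _; rewrite -(subnSK (ltn_ord j)) phit_towerS.
by rewrite /bump /= add1n.
Qed.

Lemma level_tn v : level (Ascale 'X^(n.-1) v) = lin [ffun i => vcoef v i 0].
Proof.
apply: eq_bigr => l _; rewrite ffunE; under eq_bigr => a _ do rewrite vcoef_Ascale //.
have nn : (n.-1 < n)%N by rewrite prednK.
rewrite (bigD1 (Ordinal nn)) //= leqnn nn subnn /= big1 ?addr0 // => a an.
case: ifP; last by rewrite !rmorph0 mul0r.
move=> /andP[h _]; case/eqP: an; apply: val_inj => /=.
by have := ltn_ord a; move: h n_gt0; lia.
Qed.

(** A nonzero v is t^nu u with u outside V_(n-1). If [level v] vanished, so would the level of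
    t^(n-1) u, a nontrivial F_q-combination of the Y_i. *)
Lemma level_eq0 v : level v = 0 -> v = 0.
Proof.
move=> e; apply/eqP; apply: contra_eqT e => v0.
have [nu [u [nun uV e]]] := torsion_decomp n_gt0 v0.
apply: contraNneq uV => l0.
have h m : level (Ascale 'X^m v) = 0.
  elim: m => [|m ih]; first by rewrite Ascale0.
  by rewrite -[m.+1]add1n -AscaleA // level_t ih phit0.
have := h (n.-1 - nu)%N; rewrite e AscaleA // subnK; last by rewrite -ltnS prednK.
rewrite level_tn // => /lincomb_eq0 /ffunP hu; apply/Vsub_top => // i.
by have := hu Y_free i; rewrite !ffunE.
Qed.

(** The level map identifies V_1 = t^(n-1) V_n with the span of the Y_i, stated as a change of
    variables in sums. *)
Lemma level_Vsub1 (g : K -> K) :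
  \sum_(v in Vsub k n r 1) g (level v) = \sum_(a : W) g (lin a).
Proof.
pose h (a : W) : V := vmk n (fun i j => if j == n.-1 then a i else 0).
pose h' (v : V) : W := [ffun i => vcoef v i n.-1].
have nn : (n.-1 < n)%N by rewrite prednK.
have hV a : h a \in Vsub k n r 1.
  apply/mem_Vsub => // i j jn; rewrite vcoef_mk //; last by lia.
  by case: eqP => // e; move: jn; rewrite e; lia.
have hK a : h' (h a) = a by apply/ffunP => i; rewrite ffunE vcoef_mk // eqxx.
rewrite (reindex_onto h h') /=; last first.
  move=> v /(mem_Vsub n_gt0) vV; apply: vcoefP => // i j jn; rewrite vcoef_mk // ffunE.
  by case: eqP => [->//|jn']; rewrite vV //; lia.
apply: eq_big => [a|a _]; first by rewrite hV hK eqxx.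
have -> : h a = Ascale 'X^(n.-1) (vmk n (fun i j => if j == 0%N then a i else 0)).
  apply: vcoefP => // i j jn; rewrite vcoef_Ascale // jn andbT [LHS]vcoef_mk //.
  case: leqP => jn'; last by rewrite (ltn_eqF jn').
  have -> : j = n.-1 by lia.
  by rewrite eqxx subnn vcoef_mk.
rewrite level_tn; congr (g (lin _)); apply/ffunP => i.
by rewrite ffunE vcoef_mk.
Qed.

Lemma level_torsion1 v : v \notin Vsub k n r 1 ->
  \sum_(v' in Vsub k n r 1) (level (v - v'))^-1 = tau / level (Ascale 'X^1 v).
Proof.
move=> vV; under eq_bigr => v' _ do rewrite levelB.
rewrite (level_Vsub1 (fun z => (level v - z)^-1)).
have Pv : P.[level v] != 0.
  have : phit (level v) != 0.
    by rewrite -level_t; apply: contraNneq vV => /level_eq0 /eqP e; rewrite inE.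
  by apply: contra_neq; rewrite /phit => ->; rewrite mulr0.
rewrite sum_subpoly // level_t /phit invfM invf_div mulrA.
by rewrite [tau * _]mulrC divfK ?tau_neq0.
Qed.

(** Induction on nu: multiplication by t maps V_(nu+1) onto V_nu with cosets of V_1 as fibres, and
    each fibre is summed by [level_torsion1]. *)
Lemma level_torsion nu v : (nu <= n)%N -> v \notin Vsub k n r nu ->
  iF ('X^nu)%:F / level (Ascale 'X^nu v) = \sum_(v' in Vsub k n r nu) (level (v - v'))^-1.
Proof.
elim: nu v => [|nu ih] v nun vV.
  rewrite (eq_bigl (pred1 0)) => [|u]; last by rewrite Vsub0.
  by rewrite big_pred1_eq subr0 Ascale0 tofrac1 rmorph1 div1r.
have tS u : (u \in Vsub k n r nu.+1) = (Ascale 'X^1 u \in Vsub k n r nu).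
  by rewrite !inE AscaleA // addn1.
rewrite (partition_big (Ascale 'X^1) (mem (Vsub k n r nu))) /=; last by move=> u; rewrite tS.
transitivity (\sum_(u in Vsub k n r nu) tau / level (Ascale 'X^1 v - u)); last first.
  apply: eq_bigr => u uV.
  have [|u' e] := @Ascale_onto _ _ _ n_gt0 1 u n_gt0.
    apply/mem_Vsub => // i j jn; move/(mem_Vsub n_gt0): uV; apply.
    by move: jn nun; clear; lia.
  rewrite (reindex_inj (addrI u')) /=.
  rewrite (eq_bigl (mem (Vsub k n r 1))) /=; last first.
    move=> w; rewrite tS AscaleD // -e; rewrite [RHS]inE; apply/andP/eqP => [[_ /eqP h]|->].
      by apply: (addrI u); rewrite h addr0.
    by rewrite addr0 uV eqxx.
  under eq_bigr => w _ do rewrite opprD addrA.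
  have vu : v - u' \notin Vsub k n r 1.
    rewrite inE AscaleB // -e subr_eq0; apply: contraNneq vV => h.
    by rewrite tS h.
  by rewrite (level_torsion1 vu) AscaleB // -e.
rewrite -mulr_sumr -ih //; last by rewrite -tS.
  by rewrite AscaleA // addn1 exprS tofracM rmorphM mulrA.
exact: ltnW.
Qed.

End LevelStructure.

(** * Countability of the rational function field in r variables over F *)

Section FractionField.
Variables (k : finFieldType) (r : nat).
Local Notation F := (ratfun k).

Definition fracpair (D : idomainType) (x : {fraction D}) : D * D :=
  projT1 (cid (frac_repr x)).

Lemma fracpairK (D : idomainType) : cancel (@fracpair D) (fun p => p.1%:F / p.2%:F).
Proof. by move=> x; rewrite /fracpair; case: cid => p /= [_ ->]. Qed.

Definition mpoly_terms (R : nzRingType) (p : {mpoly R[r]}) : seq ('X_{1..r} * R) :=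
  [seq (m, p@_m) | m <- msupp p].

Definition genfield := {fraction {mpoly F[r]}}.
HB.instance Definition _ := GRing.Field.on genfield.

(** Chosen numerators and denominators, at both levels of fractions, encode an element by countable
    data; the construction of an algebraic closure takes a countable field. *)
Definition gen_code (x : genfield) :=
  let code p := [seq (c.1, fracpair c.2) | c <- mpoly_terms p] in
  (code (fracpair x).1, code (fracpair x).2).

Definition gen_decode (p : seq ('X_{1..r} * ({poly k} * {poly k})) *
    seq ('X_{1..r} * ({poly k} * {poly k}))) : genfield :=
  let decode s : {mpoly F[r]} := \sum_(c <- s) (c.2.1%:F / c.2.2%:F) *: 'X_[c.1] in
  (decode p.1)%:F / (decode p.2)%:F.

Lemma gen_codeK : cancel gen_code gen_decode.
Proof.
move=> x; have h (p : {mpoly F[r]}) :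
    \sum_(c <- [seq (c.1, fracpair c.2) | c <- mpoly_terms p])
      (c.2.1%:F / c.2.2%:F : F) *: 'X_[c.1] = p.
  rewrite /mpoly_terms 2!big_map [RHS]mpolyE; apply: eq_bigr => m _ /=.
  by rewrite (fracpairK p@_m).
by rewrite /gen_decode /= !h (fracpairK x).
Qed.
HB.instance Definition _ := Countable.copy genfield (can_type gen_codeK).
HB.instance Definition _ := GRing.Field.on genfield.
End FractionField.

(** K is an algebraic closure of F(y_1, ..., y_r) and the t-torsion is spanned by the Y_i = 1/y_i,
    so that the reciprocals of the levels of the t^(n-1) X_i are independent variables. *)
Theorem generic_level_structure (k : finFieldType) (n r : nat) (n_gt0 : (0 < n)%N) :
  exists (K : fieldType) (j : {rmorphism {mpoly (ratfun k)[r]} -> K}) (lam : Vn k n r -> K),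
  injective j /\
  [/\ {morph lam : u v / u + v},
      forall c v, lam (c *: v) = j (ratfun_const k c)%:MP * lam v,
      forall v, lam v = 0 -> v = 0,
      forall nu v, (nu <= n)%N -> v \notin Vsub k n r nu ->
        j (('X^nu)%:F)%:MP / lam (Ascale 'X^nu v)
        = \sum_(v' in Vsub k n r nu) (lam (v - v'))^-1
    & forall i, (lam (Ascale 'X^(n.-1) (Xn k n i)))^-1 = j 'X_i].
Proof.
have [K [e _]] := countable_algebraic_closure (genfield k r).
have [j j_inj] : exists j : {rmorphism {mpoly (ratfun k)[r]} -> K}, injective j.
  by exists (e \o @tofrac _) => p q /fmorph_inj /eqP; rewrite tofrac_eq => /eqP.
pose iF : {rmorphism ratfun k -> K} := j \o @mpolyC r _.
pose Y (i : 'I_r) : K := (j 'X_i)^-1.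
have Y_free (a : 'I_r -> k) : \sum_i (iF \o ratfun_const k) (a i) * Y i = 0 ->
    forall i, a i = 0.
  move=> h i.
  (* The exponent of the product of all y_l' with l' <> l. Multiplying a relation among the 1/y_l by
     the product of all variables gives a relation among these distinct monomials. *)
  pose M l : 'X_{1..r} := [multinom ((l' != l) : nat) | l' < r].
  have ME l l' : M l l' = (l' != l) :> nat by rewrite mnmE.
  have X0 l : j 'X_l != 0.
    rewrite -(rmorph0 j) (inj_eq j_inj); apply/eqP => /(congr1 (mcoeff U_(l))) /eqP.
    by rewrite mcoeffX eqxx mcoeff0 oner_eq0.
  have YM l : Y l * j (\prod_l' 'X_l') = j 'X_[M l].
    rewrite (bigD1 l) //= rmorphM mulrA mulVf // mul1r.
    rewrite [X in _ = j X]mpolyXE_id [X in _ = j X](bigD1 l) //=.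
    rewrite ME eqxx expr0 mul1r; congr (j _); apply: eq_bigr => l' ll.
    by rewrite ME ll expr1.
  have : \sum_l (ratfun_const k (a l)) *: 'X_[M l] = 0 :> {mpoly (ratfun k)[r]}.
    apply: j_inj; rewrite rmorph0 -(mul0r (j (\prod_l 'X_l))) -[0 in RHS]h mulr_suml rmorph_sum.
    by apply: eq_bigr => l _; rewrite -mulrA YM -mul_mpolyC rmorphM.
  move/(congr1 (mcoeff (M i))); rewrite mcoeff0 raddf_sum /= (bigD1 i) //= big1.
    rewrite mcoeffZ mcoeffX eqxx mulr1 addr0 => /eqP.
    by rewrite tofrac_eq0 polyC_eq0 => /eqP.
  move=> l li; rewrite mcoeffZ mcoeffX; case: eqP => [/mnmP /(_ i)|]; last by rewrite mulr0.
  by rewrite !ME eqxx eq_sym li.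
exists K, j, (level (n := n) Y_free); split=> //; split.
- by move=> u v; exact: levelD.
- by move=> c v; exact: levelZ.
- by move=> v; exact: level_eq0.
- by move=> nu v nun vV; exact: (level_torsion n_gt0 Y_free nun vV).
move=> i; rewrite level_tn //.
have -> : [ffun l => vcoef (Xn k n i) l 0] = [ffun l => (l == i)%:R] :> {ffun 'I_r -> k}.
  by apply/ffunP => l; rewrite !ffunE vcoef_Xn // andbT.
by rewrite lincomb_delta /Y invrK.
Qed.

(** * Algebraic independence *)

(** A transcendence-degree argument by counting: if [p(f) = 0] with leading
    monomial [c], the [f^b] with [|b| <= r m] are spanned by those with [c] not
    dividing [b], of which there are [O(m^(r-1))], too few to contain [(m+1)^r]
    independent elements. *)
Section Counting.
Variables (F K : fieldType) (iF : {rmorphism F -> K}) (r : nat) (f : 'I_r -> K).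
Local Notation ev := (mmap iF f).

(** Well-founded induction on the monomial order: p(f) = 0 rewrites a monomial divisible by the
    leading one as a combination of smaller monomials. The order refines the degree, so the degree
    does not grow. *)
Lemma reduce_monomial (p : {mpoly F[r]}) (m : 'X_{1..r}) : ev p = 0 -> p != 0 ->
  exists q, ev q = ev 'X_[m] /\
    forall m', m' \in msupp q -> (mdeg m' <= mdeg m)%N /\ ~~ (mlead p <= m')%MM.
Proof.
move=> ep p0; elim/(@ltmwf r): m => m ih; set c := mlead p.
case: (boolP (c <= m)%MM) => cm; last first.
  by exists 'X_[m]; split=> // m'; rewrite msuppX inE => /eqP ->.
pose R u := exists q, ev q = u /\
    forall m', m' \in msupp q -> (mdeg m' <= mdeg m)%N /\ ~~ (c <= m')%MM.
have RD u v : R u -> R v -> R (u + v).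
  move=> [q [<- hq]] [q' [<- hq']]; exists (q + q'); rewrite rmorphD; split=> // m'.
  by move=> /msuppD_le; rewrite mem_cat => /orP[]; [exact: hq|exact: hq'].
have RZ a u : R u -> R (iF a * u).
  move=> [q [<- hq]]; exists (a *: q); rewrite mmapZ; split=> // m' /msuppZ_le.
  exact: hq.
have R0 : R 0 by exists 0; rewrite rmorph0; split=> // m'; rewrite msupp0.
have lc0 : p@_c != 0 by rewrite mleadc_eq0.
have mE : ev 'X_[m] = \sum_(m1 <- msupp p | m1 != c)
     iF (- (p@_c)^-1 * p@_m1) * ev 'X_[m1 + (m - c)].
  have : ev p * ev 'X_[m - c] = 0 by rewrite ep mul0r.
  rewrite {1}[p]mpolyE rmorph_sum mulr_suml.
  have ms := mlead_supp p0.
  rewrite (bigD1_seq c) //= mmapZ -mulrA -rmorphM -mpolyXD addmC submK // => /eqP.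
  rewrite addr_eq0 => /eqP e.
  apply: (mulfI (x := iF p@_c)); first by rewrite fmorph_eq0.
  rewrite e mulr_sumr -sumrN; apply: eq_bigr => m1 _.
  rewrite [RHS]mulrA -[X in _ = X * _]rmorphM mulrA mulrN mulfV // mulN1r rmorphN.
  by rewrite mulNr mmapZ mpolyXD rmorphM mulrA.
rewrite mE big_seq_cond; apply: (big_ind R) => // m1 /andP[m1p m1c]; apply: RZ.
have lt : ((m1 + (m - c))%MM < m)%O.
  rewrite -{2}(submK cm) [X in (_ < X)%O]addmC ltmc_add2l.
  by rewrite Order.POrderTheory.lt_neqAle m1c msupp_le_mlead.
have [q [e hq]] := ih _ lt; exists q; split=> // m' /hq [h1 h2]; split=> //.
exact: leq_trans h1 (lemc_mdeg (Order.POrderTheory.ltW lt)).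
Qed.

Lemma dependent_family (I J : finType) (S : {set J}) (y : I -> K) (z : J -> K) :
    (forall i, exists c : J -> F, y i = \sum_(j in S) iF (c j) * z j) ->
    (#|S| < #|I|)%N ->
  exists a : I -> F, (exists i, a i != 0) /\ \sum_i iF (a i) * y i = 0.
Proof.
move=> /fin_all_exists [c hc] SI.
pose M : 'M[F]_(#|I|, #|S|) := \matrix_(i, j) c (enum_val i) (enum_val j).
have : kermx M != 0.
  rewrite kermx_eq0 /row_free neq_ltn; apply/orP; left.
  exact: leq_ltn_trans (rank_leq_col _) SI.
case/matrix0Pn => i0 [i1 ker_neq0].
exists (fun i => kermx M i0 (enum_rank i)); split.
  by exists (enum_val i1); rewrite enum_valK.
under eq_bigr => i _ do rewrite hc mulr_sumr.
rewrite exchange_big /= big1 // => j jS.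
under eq_bigr => i _ do rewrite mulrA -rmorphM.
rewrite -mulr_suml -rmorph_sum.
have := congr1 (fun N : 'M_(_, _) => N i0 (enum_rank_in jS j)) (mulmx_ker M).
rewrite !mxE => hM; rewrite (_ : \sum_i _ = 0) ?rmorph0 ?mul0r // -[RHS]hM.
rewrite (reindex (@enum_val I I)) /=; last exact: onW_bij (enum_val_bij I).
by apply: eq_bigr => a _; rewrite enum_valK; congr (_ * _); rewrite mxE enum_rankK_in.
Qed.

(** The set is the union over i of the slabs a_i < c_i, which have at most c_i (D+1)^(r-1) points
    each. *)
Lemma card_below (D : nat) (c : 'X_{1..r}) :
  (#|[set a : {ffun 'I_r -> 'I_D.+1} | [exists i, a i < c i]]| <= mdeg c * D.+1 ^ r.-1)%N.
Proof.
set B := [set a : _ | _].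
have sub : B \subset \bigcup_i [set a : {ffun 'I_r -> 'I_D.+1} | (a i < c i)%N].
  by apply/subsetP => a; rewrite inE => /existsP[i hi]; apply/bigcupP; exists i; rewrite ?inE.
apply: leq_trans (subset_leq_card sub) _; rewrite mdegE big_distrl /=.
apply: (big_ind2 (fun (A : {set _}) m => #|A| <= m)%N) => [|A m A' m' hA hA'|i _].
- by rewrite cards0.
- by rewrite (leq_trans (leq_card_setU _ _)) // leq_add.
pose G (l : 'I_r) : {pred 'I_D.+1} := [pred x : 'I_D.+1 | (l == i) ==> (x < c i)%N].
have -> : #|[set a : {ffun 'I_r -> 'I_D.+1} | (a i < c i)%N]| = #|family G|.
  apply: eq_card => a; rewrite inE; apply/idP/familyP => [h l|/(_ i)]; last by rewrite inE eqxx.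
  by rewrite inE; apply/implyP => /eqP ->.
rewrite card_family foldrE big_map big_enum /= (bigD1 i) //=; apply: leq_mul.
  rewrite -[leqRHS]card_ord.
  have [cD|cD] := leqP (c i) D.+1; last first.
    by rewrite (leq_trans (max_card _)) // !card_ord ltnW.
  have winj : injective (widen_ord cD) by move=> x y /(congr1 val) /= /val_inj.
  rewrite -(card_imset _ winj).
  apply: subset_leq_card; apply/subsetP => x; rewrite !inE eqxx /= => xc.
  by apply/imsetP; exists (Ordinal xc) => //; apply: val_inj.
rewrite (eq_bigr (fun=> D.+1)) => [|l /negPf li].
  by rewrite prod_nat_const cardC1 card_ord.
by rewrite -[RHS]card_ord; apply: eq_card => x; rewrite !inE li.
Qed.

Lemma alg_independent_by_counting (y : {rmorphism {mpoly F[r]} -> K})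
    (J : finType) (e : J -> K) : injective y ->
    (forall m, exists P : J -> {mpoly F[r]}, (forall j, msize (P j) <= (mdeg m).+1)%N /\
       y 'X_[m] = \sum_j ev (P j) * e j) ->
    (forall c, y c%:MP = iF c) ->
  forall p, ev p = 0 -> p = 0.
Proof.
move=> y_inj span yC p ep; apply/eqP; apply: contraT => p0; exfalso.
set c := mlead p.
(* For r > 0, D + 1 <= r (M + 1) bounds the number |J| |c| (D+1)^(r-1) of available generators by M
   (M+1)^(r-1), which is less than the (M+1)^r monomials of [YBox]. The degree of these monomials is
   at most D = r M. *)
pose M := (#|J| * mdeg c * r ^ r.-1)%N; pose D := (r * M)%N.
pose Box := {ffun 'I_r -> 'I_D.+1}; pose YBox := {ffun 'I_r -> 'I_M.+1}.
pose mon N (a : {ffun 'I_r -> 'I_N}) : 'X_{1..r} := [multinom (a i : nat) | i < r].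
pose S : {set Box * J} := [set s : Box * J | [exists i, ((s.1 : Box) i < c i)%N]].
have [||a [[i0 a0] h]] := @dependent_family YBox (Box * J)%type S
    (fun a => y 'X_[mon _ a]) (fun s => ev 'X_[mon _ s.1] * e s.2).
- move=> a; have [P [Psize ->]] := span (mon _ a).
  have aD : (mdeg (mon _ a) <= D)%N.
    rewrite mdegE (leq_trans (leq_sum (E2 := fun=> M) _ _)) //.
      by move=> i _; rewrite mnmE -ltnS.
    by rewrite sum_nat_const card_ord.
  (* The relation p(f) = 0 removes from P_j all monomials divisible by c, and keeps the degree at
     most D. *)
  have red j : exists q : {mpoly F[r]}, ev q = ev (P j) /\
      forall m, m \in msupp q -> (mdeg m <= D)%N /\ ~~ (c <= m)%MM.
    rewrite [X in ev X]mpolyE big_seq; apply: (big_ind (fun u => exists q, ev q = ev u /\ _)).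
    + by exists 0; split=> // m; rewrite msupp0.
    + move=> u v [q [eq hq]] [q' [eq' hq']].
      exists (q + q'); split; first by rewrite rmorphD /= eq eq' -rmorphD.
      move=> m /msuppD_le; rewrite mem_cat => /orP[]; [exact: hq|exact: hq'].
    move=> m mP; have [q [eq hq]] := reduce_monomial m ep p0.
    exists ((P j)@_m *: q); rewrite !mmapZ eq; split=> // m' /msuppZ_le /hq [h1 h2].
    split=> //; apply: leq_trans h1 _; rewrite -ltnS.
    by apply: leq_trans (msize_mdeg_lt mP) _; apply: leq_trans (Psize j) _.
  have [q hq] := choice red.
  exists (fun s => (q s.2)@_(mon _ s.1)).
  transitivity (\sum_j \sum_(b : Box | [exists i, (b i < c i)%N])
      iF (q j)@_(mon _ b) * (ev 'X_[mon _ b] * e j)); last first.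
    rewrite exchange_big pair_big_dep /=; apply: eq_big => // -[b j] /=.
    by rewrite inE andbT.
  apply: eq_bigr => j _; have [<- supp] := hq j.
  rewrite {1}[q j]mpolyE rmorph_sum mulr_suml.
  pose back (m : 'X_{1..r}) : Box := [ffun i => inord (m i)].
  have monK m : m \in msupp (q j) -> mon _ (back m) = m.
    move=> /supp [mD _]; apply/mnmP => i; rewrite mnmE ffunE inordK // ltnS.
    by apply: leq_trans mD; rewrite mdegE (bigD1 i) //= leq_addr.
  have backK b : back (mon _ b) = b.
    by apply/ffunP => i; rewrite ffunE mnmE inord_val.
  transitivity (\sum_(b <- map back (msupp (q j)))
      iF (q j)@_(mon _ b) * (ev 'X_[mon _ b] * e j)).
    rewrite [RHS]big_map [LHS]big_seq [RHS]big_seq; apply: eq_bigr => m mq.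
    by rewrite /= mmapZ monK // mulrA.
  have ub : uniq (map back (msupp (q j))).
    rewrite map_inj_in_uniq ?msupp_uniq // => m m' hm hm' eb.
    by rewrite -(monK m) // -(monK m') // eb.
  rewrite big_uniq //= [RHS]big_mkcond [LHS]big_mkcond /=; apply: eq_bigr => b _.
  case: ifP => [/mapP[m mq ->]|bq].
    suff -> : [exists i, (back m i < c i)%N] by [].
    have [_] := supp m mq; apply: contraR; rewrite negb_exists => /forallP h1.
    by apply/mnm_lepP => i; rewrite -(monK m mq) mnmE leqNgt h1.
  case: ifP => // _; rewrite memN_msupp_eq0 ?rmorph0 ?mul0r //.
  by apply: contraFN bq => h1; rewrite -(backK b) map_f.
- have -> : S = setX [set b : Box | [exists i, (b i < c i)%N]] setT.
    by apply/setP => -[b j]; rewrite !inE andbT.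
  rewrite cardsX cardsT card_ffun !card_ord.
  apply: leq_ltn_trans (leq_mul (card_below D c) (leqnn _)) _.
  rewrite mulnAC [(mdeg c * _)%N]mulnC.
  case: (posnP r) => [r0|r0].
    have mc0 : mdeg c = 0%N.
      rewrite mdegE big1 // => i _; exfalso.
      by have := ltn_ord i; rewrite [X in (_ < X)%N]r0.
    by rewrite mc0 muln0 mul0n expn_gt0.
  have D1 : (D.+1 <= r * M.+1)%N by rewrite /D mulnS; move: r0; lia.
  apply: (@leq_ltn_trans (#|J| * mdeg c * (r * M.+1) ^ r.-1)%N).
    rewrite leq_mul2l; apply/orP; right; case: (r.-1) => // e'.
    by rewrite leq_exp2r.
  rewrite expnMn mulnA -/M -[in X in (_ < X)%N](prednK r0) expnS ltn_pmul2r //.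
  by rewrite expn_gt0.
(* Too many vectors in too small a span give a linear relation among distinct monomials in the y_i,
   against the injectivity of [y]. *)
have a_eq0 : \sum_(b : YBox) a b *: 'X_[mon _ b] = 0 :> {mpoly F[r]}.
  apply: y_inj; rewrite rmorph0 -[RHS]h rmorph_sum; apply: eq_bigr => b _.
  by rewrite -mul_mpolyC rmorphM yC.
have mon_inj : injective (@mon M.+1).
  by move=> b b' /mnmP eb; apply/ffunP => i; apply: val_inj; have := eb i; rewrite !mnmE.
case/eqP: a0; have := congr1 (mcoeff (mon _ i0)) a_eq0.
rewrite mcoeff0 raddf_sum /= (bigD1 i0) //= mcoeffZ mcoeffX eqxx mulr1.
rewrite big1 ?addr0 // => b bi; rewrite mcoeffZ mcoeffX (inj_eq mon_inj) (negPf bi).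
by rewrite mulr0.
Qed.

End Counting.

(** * Linear independence *)

Section Coordinates.
Variables (k : finFieldType) (n r : nat).
Hypothesis n_gt0 : (0 < n)%N.
Local Notation V := (Vn k n r).
Local Notation F := (ratfun k).
Variables (A : comNzRingType) (scal : {rmorphism F -> A}) (x : V -> A).
Local Notation W := {ffun 'I_r -> V}.
Local Notation Xn i := (Xn k n i).
Local Notation V' i := (Vprime k n i).
Local Notation f := (fsum x).
Local Notation ev := (mmap scal f).
Local Notation esupp := (@esupp k n r).
Local Notation WS := (esupp setT).

Definition psupported (I : {set 'I_r}) (p : {mpoly F[r]}) :=
  forall m, m \in msupp p -> msupported m I.

Lemma psupportedD I p q : psupported I p -> psupported I q -> psupported I (p + q).
Proof.
by move=> hp hq m /msuppD_le; rewrite mem_cat => /orP[]; [exact: hp|exact: hq].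
Qed.

Lemma psupportedN I p : psupported I p -> psupported I (- p).
Proof. by move=> hp m; rewrite (perm_mem (msuppN p)); exact: hp. Qed.

Lemma psupportedM I p q : psupported I p -> psupported I q -> psupported I (p * q).
Proof.
move=> hp hq m /msuppM_le /allpairsP[[m1 m2] /= [h1 h2 ->]] i iI.
by rewrite mnmDE (hp _ h1) ?(hq _ h2).
Qed.

Lemma psupportedC I c : psupported I c%:MP.
Proof.
by move=> m; rewrite msuppC; case: ifP => //; rewrite inE => _ /eqP -> i _; rewrite mnm0E.
Qed.

Lemma psupported0 I : psupported I 0.
Proof. by move=> m; rewrite msupp0. Qed.

Lemma psupportedX I m : msupported m I -> psupported I 'X_[m].
Proof. by move=> h m'; rewrite msuppX inE => /eqP ->. Qed.

Lemma esuppT o : (o \in WS) = [forall i, o i \in V' i].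
Proof. by rewrite inE; apply: eq_forallb => i; rewrite inE. Qed.

Lemma esupp_subT I o : o \in esupp I -> o \in WS.
Proof.
move=> oI; rewrite esuppT; apply/forallP => i.
case: (boolP (i \in I)) => iI; first exact: esuppP oI iI.
by rewrite (esupp_out oI iI); exact: Vprime0.
Qed.

Lemma ev_fpow b : ev 'X_[b] = fpow x b.
Proof. by rewrite mmapX. Qed.

Lemma Span_coords d u : Span scal x d u -> exists P : {set 'I_r} -> W -> {mpoly F[r]},
  (forall I o, (msize (P I o) <= d.+1)%N /\ psupported I (P I o)) /\
  u = \sum_I \sum_(o in esupp I) ev (P I o) * eprod x I o.
Proof.
elim=> [|u1 u2 _ [P1 [h1 ->]] _ [P2 [h2 ->]]|c b I o hb ho hd].
- exists (fun _ _ => 0); split=> [I o|]; first by rewrite mmeasure0; split=> //; exact: psupported0.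
  by rewrite big1 // => I _; rewrite big1 // => o _; rewrite rmorph0 mul0r.
- exists (fun I o => P1 I o + P2 I o); split=> [I o|].
    have [s1 p1] := h1 I o; have [s2 p2] := h2 I o; split; last exact: psupportedD.
    by rewrite (leq_trans (mmeasureD_le _ _ _)) // geq_max s1.
  rewrite -big_split /=; apply: eq_bigr => I _; rewrite -big_split /=.
  by apply: eq_bigr => o _; rewrite rmorphD mulrDl.
exists (fun I' o' => if (I' == I) && (o' == o) then c *: 'X_[b] else 0); split=> [I' o'|].
  case: ifP => [/andP[/eqP -> _]|_]; last by rewrite mmeasure0; split=> //; exact: psupported0.
  split; first by rewrite (leq_trans (msizeZ_le _ _)) // msizeX ltnS.
  by rewrite -mul_mpolyC; apply: psupportedM; [exact: psupportedC|exact: psupportedX].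
rewrite (bigD1 I) //= [X in _ + X]big1 ?addr0; last first.
  by move=> I' /negPf II; rewrite big1 // => o' _; rewrite II /= rmorph0 mul0r.
rewrite (bigD1 o) //= !eqxx /= mmapZ ev_fpow -mulrA big1 ?addr0 //.
by move=> o' /andP[_ /negPf oo]; rewrite oo rmorph0 mul0r.
Qed.

(** Delta_i is indexed by V'_i like E_i: the index 0, which gives 1/X_i in E_i, gives 1 here. *)
Definition dfactor (i : 'I_r) (w : V) : A := if w == 0 then 1 else x (Xn i + w).
Definition dprod (o : W) : A := \prod_i dfactor i (o i).

(** Coordinates of [E_I] in terms of [Delta_1 ... Delta_r]: each factor
    [1/X_i] is replaced by [f_i - sum_(w <> 0) 1/(X_i + w)]. *)
Definition ecoord1 (I : {set 'I_r}) (o : W) (i : 'I_r) (w : V) : {mpoly F[r]} :=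
  if (i \in I) && (o i == 0) then (if w == 0 then 'X_i else - 1)
  else (w == o i)%:R.
Definition ecoord I o (q : W) : {mpoly F[r]} := \prod_i ecoord1 I o i (q i).

Lemma eprod_coord I o : o \in esupp I ->
  eprod x I o = \sum_(q in WS) ev (ecoord I o q) * dprod q.
Proof.
move=> oI.
transitivity (\prod_i \sum_(w in V' i) ev (ecoord1 I o i w) * dfactor i w).
  rewrite /eprod big_mkcond; apply: eq_bigr => i _; rewrite /ecoord1.
  case: ifPn => iI /=; last first.
    rewrite (esupp_out oI iI) (bigD1 0) ?Vprime0 //= eqxx rmorph1 mul1r /dfactor eqxx.
    by rewrite big1 ?addr0 // => w /andP[_ /negPf ->]; rewrite rmorph0 mul0r.
  have oV := esuppP oI iI; case: eqP => [->|/eqP oi0].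
    rewrite (bigD1 0) ?Vprime0 //= eqxx /dfactor eqxx mulr1 addr0.
    have -> : ev 'X_i = f i.
      rewrite mmapX /mmap1 (bigD1 i) //= mnm1E eqxx expr1 big1 ?mulr1 // => j ji.
      by rewrite mnm1E eq_sym (negPf ji) expr0.
    rewrite /fsum (bigD1 0) ?Vprime0 //= addr0 -addrA -[LHS]addr0; congr (_ + _).
    rewrite -big_split big1 //= => w /andP[_ /negPf ->].
    by rewrite rmorphN1 mulN1r subrr.
  rewrite (bigD1 (o i)) //= eqxx rmorph1 mul1r /dfactor (negPf oi0).
  by rewrite big1 ?addr0 // => w /andP[_ /negPf ->]; rewrite rmorph0 mul0r.
rewrite bigA_distr_big_dep; apply: eq_big => [q|q _].
  by rewrite esuppT; apply/familyP/forallP.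
by rewrite big_split /= -rmorph_prod.
Qed.

Lemma dspan u d : Span scal x d u ->
  exists c : W -> {mpoly F[r]}, u = \sum_(q in WS) ev (c q) * dprod q.
Proof.
move=> /Span_coords [P [_ ->]].
exists (fun q => \sum_I \sum_(o in esupp I) P I o * ecoord I o q).
transitivity (\sum_I \sum_(o in esupp I) \sum_(q in WS) ev (P I o * ecoord I o q) * dprod q).
  apply: eq_bigr => I _; apply: eq_bigr => o oI; rewrite eprod_coord // mulr_sumr.
  by apply: eq_bigr => q _; rewrite rmorphM mulrA.
under eq_bigr do rewrite exchange_big /=.
rewrite exchange_big /=; apply: eq_bigr => q _; rewrite rmorph_sum mulr_suml.
by apply: eq_bigr => I _; rewrite rmorph_sum mulr_suml.
Qed.

Definition zeros (o : W) : {set 'I_r} := [set i | o i == 0].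
Definition zmon (I : {set 'I_r}) (o : W) : 'X_{1..r} :=
  [multinom ((i \in I) && (o i == 0)%R : nat) | i < r].

Lemma ecoord_diag I o : ecoord I o o = 'X_[zmon I o].
Proof.
rewrite mpolyXE_id; apply: eq_bigr => i _; rewrite /ecoord1 mnmE.
case: (boolP (i \in I)) => /= _; last by rewrite eqxx expr0.
by case: (o i == 0); rewrite ?expr1 // eqxx expr0.
Qed.

(** Expanding a factor 1/X_i can only turn a zero entry of o into a nonzero one. The coordinates are
    thus triangular for the number of zero entries. *)
Lemma ecoord_neq0 I o q : ecoord I o q != 0 -> q != o -> (#|zeros q| < #|zeros o|)%N.
Proof.
move=> h qo; have hi i : ecoord1 I o i (q i) != 0.
  by apply: contraNneq h => e; rewrite /ecoord (bigD1 i) //= e mul0r.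
have oq i : o i != 0 -> q i = o i.
  move=> oi; have := hi i; rewrite /ecoord1 (negPf oi) andbF.
  by case: (q i =P o i) => // _; rewrite eqxx.
apply: proper_card; rewrite properE; apply/andP; split.
  apply/subsetP => i; rewrite !inE => /eqP qi; apply/negPn/negP => oi.
  by have := oi; rewrite -(oq i oi) qi eqxx.
apply: contra qo => /subsetP sub; apply/eqP/ffunP => i.
have [oi|/oq //] := eqVneq (o i) 0.
by have := sub i; rewrite !inE oi eqxx => /(_ isT) /eqP.
Qed.

Hypothesis d_indep : forall c : W -> {mpoly F[r]},
  \sum_(q in WS) ev (c q) * dprod q = 0 -> forall q, q \in WS -> c q = 0.

(** Descending induction on the number of zero entries of o. In the coordinate o only the diagonal
    terms of the various J remain, and the supports of their monomials tell the sets J apart. *)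
Lemma e_indep (P : {set 'I_r} -> W -> {mpoly F[r]}) :
    (forall I o, o \in esupp I -> psupported I (P I o)) ->
    \sum_I \sum_(o in esupp I) ev (P I o) * eprod x I o = 0 ->
  forall I o, o \in esupp I -> P I o = 0.
Proof.
move=> Psupp P0.
have coords q : q \in WS -> \sum_I \sum_(o in esupp I) P I o * ecoord I o q = 0.
  move: q; apply: (d_indep (c := fun q => \sum_I \sum_(o in esupp I) P I o * ecoord I o q)).
  rewrite -[RHS]P0.
  transitivity (\sum_I \sum_(o in esupp I) \sum_(q in WS) ev (P I o * ecoord I o q) * dprod q).
    symmetry; under eq_bigr do rewrite exchange_big /=.
    rewrite exchange_big /=; apply: eq_bigr => q' _; rewrite rmorph_sum mulr_suml.
    by apply: eq_bigr => I _; rewrite rmorph_sum mulr_suml.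
  apply: eq_bigr => I _; apply: eq_bigr => o oI; rewrite eprod_coord // mulr_sumr.
  by apply: eq_bigr => q' _; rewrite rmorphM mulrA.
move=> I o; have [N] := ubnP (r - #|zeros o|)%N; elim: N I o => // N ih I o oN oI.
have big_zeros I' o' : o' \in esupp I' -> (#|zeros o| < #|zeros o'|)%N -> P I' o' = 0.
  move=> oI' lt; apply: ih => //.
  have : (#|zeros o'| <= r)%N by rewrite -[leqRHS]card_ord max_card.
  by move: oN lt; clear; lia.
(* A family o' other than o reaches the coordinate o only if it has more zero entries, and then its
   coefficient vanishes by induction. *)
have e : \sum_(J : {set 'I_r} | o \in esupp J) P J o * 'X_[zmon J o] = 0.
  rewrite -[RHS](coords o (esupp_subT oI)) big_mkcond; apply: eq_bigr => J _.
  case: ifP => oJ.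
    rewrite (bigD1 o) //= ecoord_diag big1 ?addr0 // => o' /andP[o'J o'o].
    have [->|nz] := eqVneq (ecoord J o' o) 0; first by rewrite mulr0.
    by rewrite (big_zeros J) ?mul0r //; apply: ecoord_neq0 nz _; rewrite eq_sym.
  rewrite big1 // => o' o'J.
  have [->|nz] := eqVneq (ecoord J o' o) 0; first by rewrite mulr0.
  rewrite (big_zeros J) ?mul0r //; apply: ecoord_neq0 nz _.
  by apply: contraFneq oJ => ->.
apply/mpolyP => m; rewrite mcoeff0; apply/eqP; apply: contraT => mP.
have mI : msupported m I by apply: (Psupp I o oI); rewrite mcoeff_msupp.
have := congr1 (mcoeff (zmon I o + m)) e; rewrite mcoeff0 raddf_sum /= (bigD1 I) //=.
rewrite mcoeffMX big1 ?addr0; first by move/eqP; rewrite (negPf mP).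
(* Where o_i = 0, the variable i occurs in a monomial of P_J f^(zmon J o) exactly when i is in J;
   where o_i is nonzero, i is in J anyway. The monomial therefore determines J. *)
move=> J /andP[oJ JI]; apply/eqP; apply: contraNT JI; rewrite -mcoeff_msupp.
move=> /msuppM_le /allpairsP[[m1 m2] /= [h1]]; rewrite msuppX inE => /eqP -> /mnmP e2.
have mJ := Psupp J o oJ m1 h1.
apply/eqP/setP => i; have := e2 i; rewrite !mnmDE !mnmE.
have [oi|oi] := eqVneq (o i) 0; rewrite ?andbT ?andbF; last first.
  have out L : o \in esupp L -> i \in L.
    by move=> oL; apply: contraNT oi => /(esupp_out oL) /eqP.
  by rewrite !out.
case: (boolP (i \in J)) => iJ; case: (boolP (i \in I)) => iI //=.
  by rewrite mI // addn1.
by rewrite (mJ i iJ).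
Qed.

Lemma sum_delta (S : {set W}) (g : W -> A) o o' : o \in S -> o' \in S -> g o = g o' ->
  \sum_(q in S) ev ((q == o)%:R - (q == o')%:R) * g q = 0.
Proof.
move=> oS o'S e; have H o1 : o1 \in S -> \sum_(q in S) (q == o1)%:R * g q = g o1.
  move=> o1S; rewrite (bigD1 o1) //= eqxx mul1r big1 ?addr0 // => q /andP[_ /negPf ->].
  by rewrite mul0r.
have evn (b : bool) : ev b%:R = b%:R by exact: rmorph_nat.
under eq_bigr => q _ do rewrite rmorphB /= !evn mulrBl.
by rewrite sumrB !H // e subrr.
Qed.

Lemma delta_neq0 (o o' : W) : o != o' -> (o == o)%:R - (o == o')%:R != 0 :> {mpoly F[r]}.
Proof. by move=> /negPf ->; rewrite eqxx subr0 oner_neq0. Qed.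

(** Two equal products with distinct indices would give a relation with coefficients 1 and -1. *)
Lemma eprod_inj I : {in esupp I &, injective (eprod x I)}.
Proof.
move=> o o' oI o'I e; apply/eqP; apply: contraT => oo; exfalso.
pose P (J : {set 'I_r}) (q : W) : {mpoly F[r]} :=
  if J == I then (q == o)%:R - (q == o')%:R else 0.
have Ps J q : q \in esupp J -> psupported J (P J q).
  move=> _; rewrite /P; case: ifP => _; last exact: psupported0.
  by apply: psupportedD; [|apply: psupportedN]; case: (_ == _);
    rewrite -?mpolyC1 -?mpolyC0; exact: psupportedC.
have P0 : \sum_J \sum_(q in esupp J) ev (P J q) * eprod x J q = 0.
  rewrite (bigD1 I) //= [X in _ + X]big1 ?addr0; last first.
    by move=> J /negPf JI; rewrite big1 // => q _; rewrite /P JI rmorph0 mul0r.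
  by rewrite /P eqxx sum_delta.
have := e_indep Ps P0 oI; rewrite /P eqxx; apply/eqP; exact: delta_neq0.
Qed.

Lemma dprod_inj : {in WS &, injective dprod}.
Proof.
move=> o o' oI o'I e; apply/eqP; apply: contraT => oo; exfalso.
have := d_indep (sum_delta oI o'I e) oI; apply/eqP; exact: delta_neq0.
Qed.

End Coordinates.

(** Induction on the length of the relation: subtracting chi_j(u) times the relation at v from the
    relation at u v kills the j-th term and, for u with chi_i(u) <> chi_j(u), keeps the i-th. A
    relation with a single term fails at 1. *)
Lemma dedekind_independence (A : pzSemiRingType) (K : fieldType) (I : finType)
    (chi : I -> {rmorphism A -> K}) :
    (forall i j, i != j -> exists u, chi i u != chi j u) ->
  forall a : I -> K, (forall u, \sum_i a i * chi i u = 0) -> forall i, a i = 0.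
Proof.
move=> dist a; have [N] := ubnP #|[set i | a i != 0]|.
elim: N a => // N ih a aN rel i; apply/eqP; apply: contraT => ai.
have only j : j != i -> a j = 0.
  move=> ji; apply/eqP; apply: contraT => aj; exfalso.
  have [u hu] := dist _ _ ji.
  pose b l := a l * (chi l u - chi j u).
  have relb v : \sum_l b l * chi l v = 0.
    transitivity (\sum_l a l * chi l (u * v) - chi j u * \sum_l a l * chi l v).
      rewrite mulr_sumr -sumrB; apply: eq_bigr => l _; rewrite rmorphM /b; ring.
    by rewrite !rel mulr0 subr0.
  have bN : (#|[set l | b l != 0%R]| < N)%N.
    rewrite -ltnS; apply: leq_trans aN; rewrite ltnS; apply: proper_card; apply/properP; split.
      by apply/subsetP => l; rewrite !inE /b; apply: contraNneq => ->; rewrite mul0r.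
    by exists j; rewrite !inE ?aj // /b subrr mulr0 eqxx.
  have := ih b bN relb i; apply/eqP; rewrite /b mulf_neq0 // subr_eq0 eq_sym.
  exact: hu.
have := rel 1; rewrite (bigD1 i) //= rmorph1 mulr1 big1 ?addr0.
  by move=> a0; rewrite a0 eqxx in ai.
by move=> j /only ->; rewrite mul0r.
Qed.

Section FsetImages.
Variables (T : finType) (A : choiceType) (S : {set T}) (phi : T -> A) (B : {fset A}).
Hypothesis phi_inj : {in S &, injective phi}.
Hypothesis BE : forall y, y \in B <-> exists2 o, o \in S & y = phi o.

Lemma fset_image_perm : perm_eq (enum_fset B) [seq phi o | o <- enum S].
Proof.
apply: uniq_perm; first exact: fset_uniq.
  rewrite map_inj_in_uniq ?enum_uniq // => o o'; rewrite !mem_enum; exact: phi_inj.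
move=> y; apply/idP/mapP => [/BE [o oS ->]|[o]]; first by exists o; rewrite ?mem_enum.
by rewrite mem_enum => oS ->; apply/BE; exists o.
Qed.

Lemma big_fset_image (R : nmodType) (G : A -> R) :
  \sum_(y <- B) G y = \sum_(o in S) G (phi o).
Proof. by rewrite (perm_big _ fset_image_perm) big_map big_enum. Qed.

Lemma card_fset_image : #|` B| = #|S|.
Proof. by rewrite /= (perm_size fset_image_perm) size_map -cardE. Qed.

End FsetImages.

(** * The action of U on torsion vectors *)

Section Unipotent.
Variables (k : finFieldType) (n r : nat).
Hypothesis n_gt0 : (0 < n)%N.
Local Notation V := (Vn k n r).
Local Notation Xn i := (Xn k n i).
Local Notation V' i := (Vprime k n i).

Lemma vcoef0_GLmul (g : 'M[Qn k n]_r) (v : V) i :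
  vcoef (GLmul g v) i 0 = \sum_j (g i j : {poly k})`_0 * vcoef v j 0.
Proof.
rewrite /vcoef ffunE; elim/big_rec2: _ => [|j y1 y2 _ <-]; first by rewrite coef0.
by rewrite coefD coef_Qn_mul // coef0M.
Qed.

Variable g : 'M[Qn k n]_r.
Hypothesis gU : forall i j : 'I_r, (j <= i)%N -> (g i j : {poly k})`_0 = (i == j)%:R.

Lemma unipotent_top (v : V) (i : 'I_r) : (forall j : 'I_r, (i < j)%N -> vcoef v j 0 = 0) ->
  vcoef (GLmul g v) i 0 = vcoef v i 0.
Proof.
move=> h; rewrite vcoef0_GLmul (bigD1 i) //= gU // eqxx mul1r big1 ?addr0 // => j ji.
have [lt|gt|e] := ltngtP i j; first by rewrite h ?mulr0.
  by rewrite gU ?(ltnW gt) // eq_sym (negPf ji) mul0r.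
by move: ji; rewrite (val_inj e) eqxx.
Qed.

(** The last nonzero top coefficient of a vector is preserved, so g u stays outside V_(n-1) when u
    does; by [torsion_decomp] g is injective on V_n, hence bijective by finiteness. *)
Lemma unipotent_unit : g \in unitmx.
Proof.
have inj0 (v : V) : GLmul g v = 0 -> v = 0.
  move=> gv; apply/eqP; apply: contraT => v0; exfalso.
  have [nu [u [nun uV e]]] := torsion_decomp n_gt0 v0.
  have : GLmul g u \in Vsub k n r n.-1.
    rewrite inE -GLmul_scale (_ : n.-1 = n.-1 - nu + nu)%N; last first.
      by rewrite subnK // -ltnS prednK.
    rewrite -AscaleA // GLmul_scale -e gv.
    by have := @zero_Vsub k n r n_gt0 (n.-1 - nu); rewrite inE.
  have [i [c [w [c0 /(mem_Vprime n_gt0) wV ui ue]]]] := top_decomp n_gt0 uV.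
  move/(Vsub_top n_gt0) => /(_ i); rewrite unipotent_top; first by apply/eqP.
  move=> j ij; rewrite ue vcoefZ // vcoefD // vcoef_Xn // wV ?(ltnW ij) // addr0.
  by rewrite -val_eqE /= gtn_eqF // mulr0.
have inj : injective (GLmul g : V -> V).
  by move=> u v e; apply/eqP; rewrite -subr_eq0; apply/eqP/inj0; rewrite linearB /= e subrr.
(* The columns of the right inverse are the preimages of the X_j. *)
pose C : 'M[Qn k n]_r := \matrix_(i, j) (invF inj (Xn j)) i.
suff : g *m C = 1%:M by case/mulmx1_unit.
apply/matrixP => i j; rewrite !mxE.
transitivity (GLmul g (invF inj (Xn j)) i).
  by rewrite ffunE; apply: eq_bigr => l _; rewrite mxE.
by rewrite f_invF ffunE.
Qed.

Lemma unipotent_Vprime i w : w \in V' i -> GLmul g w \in V' i.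
Proof.
move=> /(mem_Vprime n_gt0) h; apply/(mem_Vprime n_gt0) => l il.
by rewrite unipotent_top ?h // => j lj; rewrite h // (leq_trans il) // ltnW.
Qed.

Lemma unipotent_Xn i : GLmul g (Xn i) - Xn i \in V' i.
Proof.
apply/(mem_Vprime n_gt0) => l il; rewrite vcoefD // vcoefN // unipotent_top ?subrr // => j lj.
by rewrite vcoef_Xn // -val_eqE /= gtn_eqF // (leq_ltn_trans il).
Qed.

(** The map g permutes the coset X_i + V'_i, so it only permutes the terms of f_i. *)
Lemma unipotent_fsum (A : comNzRingType) (x : V -> A) i :
  \sum_(w in V' i) x (GLmul g (Xn i + w)) = fsum x i.
Proof.
pose h w := GLmul g (Xn i) - Xn i + GLmul g w.
have h_inj : injective h.
  by move=> u v /addrI /(can_inj (GLmulK unipotent_unit)).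
have hV : h @: V' i = V' i.
  apply/eqP; rewrite eqEcard card_imset // leqnn andbT; apply/subsetP => _ /imsetP[w wV ->].
  by apply: VprimeD => //; [exact: unipotent_Xn|exact: unipotent_Vprime].
rewrite /fsum -[in RHS]hV big_imset /=; last by move=> u v _ _; exact: h_inj.
by apply: eq_bigr => w _; rewrite linearD /= /h addrA [Xn i + _]addrC subrK.
Qed.

End Unipotent.

(** [mmap] pinned to the [comNzRingType] structure of its codomain: with the
    instances inferred at [Rn], unification is very slow. *)
Definition peval (F A : comNzRingType) (r : nat) (scal : {rmorphism F -> A})
  (f : 'I_r -> A) (p : {mpoly F[r]}) : A := mmap scal f p.

(** * Subalgebras generated by some of the f_k *)

Section GeneratedSubalgebra.
Variables (k : finFieldType) (r : nat) (A : comNzRingType).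
Variables (scal : {rmorphism ratfun k -> A}) (f : 'I_r -> A).
Local Notation ev := (mmap scal f).

Lemma ev_X i : ev 'X_i = f i.
Proof.
rewrite mmapX /mmap1 (bigD1 i) //= mnm1E eqxx expr1 big1 ?mulr1 // => j ji.
by rewrite mnm1E eq_sym (negPf ji) expr0.
Qed.

Lemma gen_subalgP (I : {set 'I_r}) (c : A) :
  gen_subalg scal (fun y => exists2 i, i \in I & y = f i) c <->
  exists2 p : {mpoly (ratfun k)[r]}, psupported I p & c = ev p.
Proof.
split=> [h|[p hp ->] P Pc Ps PB PM].
  apply: (h (fun c => exists2 p, psupported I p & c = ev p))
    => [a|_ [i iI ->]|y z [p hp ->] [q hq ->]|y z [p hp ->] [q hq ->]].
  - by exists a%:MP; [exact: psupportedC|rewrite mmapC].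
  - exists 'X_i; last by rewrite ev_X.
    apply: psupportedX => j jI; rewrite mnm1E; case: eqP => // e.
    by rewrite -e iI in jI.
  - exists (p - q); last by rewrite rmorphB.
    by apply: psupportedD => //; exact: psupportedN.
  - by exists (p * q); [exact: psupportedM|rewrite rmorphM].
have P0 : P 0 by rewrite -(rmorph0 scal).
have PD y z : P y -> P z -> P (y + z).
  move=> hy hz; rewrite -[z]opprK; apply: (PB) => //; rewrite -sub0r; exact: (PB).
rewrite [p]mpolyE rmorph_sum big_seq; apply: (big_ind P) => // m mp.
rewrite /= mmapZ; apply: (PM); first exact: (Pc).
have P1 : P 1 by rewrite -(rmorph1 scal).
rewrite mmapX /mmap1; apply: (big_ind P) => // i _.
case: (boolP (i \in I)) => iI; last by rewrite (hp m mp i iI) expr0.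
by elim: (m i) => [|e ih]; rewrite ?expr0 // exprS; apply: (PM) => //; apply: (Ps); exists i.
Qed.

Lemma rmorph_ev (B : comNzRingType) (h : {rmorphism A -> B}) p :
  h (ev p) = mmap (h \o scal) (h \o f) p.
Proof.
rewrite /mmap rmorph_sum; apply: eq_bigr => m _; rewrite rmorphM /mmap1 rmorph_prod.
by congr (_ * _); apply: eq_bigr => i _; rewrite rmorphXn.
Qed.

Lemma rmorph_ev_fixed (h : {rmorphism A -> A}) p :
  (forall c, h (scal c) = scal c) -> (forall i, h (f i) = f i) -> h (ev p) = ev p.
Proof.
move=> hc hf; rewrite rmorph_ev /mmap; apply: eq_bigr => m _; rewrite /= hc; congr (_ * _).
by apply: eq_bigr => i _; rewrite /= hf.
Qed.

End GeneratedSubalgebra.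

(** * Independence and invariants from separating characters *)

Section Separation.
Variables (k : finFieldType) (n r : nat).
Hypothesis n_gt0 : (0 < n)%N.
Local Notation V := (Vn k n r).
Local Notation F := (ratfun k).
Variables (A : comNzRingType) (scal : {rmorphism F -> A}) (x : V -> A).
Local Notation W := {ffun 'I_r -> V}.
Local Notation WS := (esupp k n [set: 'I_r]).
Local Notation ev := (mmap scal (fsum x)).
Local Notation dbase := (@dprod k n r A x).
Hypothesis spanning : forall u, exists d, Span scal x d u.
Variables (K : fieldType) (h : {rmorphism A -> K}) (chi : W -> {rmorphism A -> K}).
Hypothesis chi_ev : forall o p, o \in WS -> chi o (ev p) = h (ev p).
Hypothesis chi_dist : forall o o', o \in WS -> o' \in WS -> o != o' ->
  exists u, chi o u != chi o' u.
Hypothesis ev_inj : forall p, h (ev p) = 0 -> p = 0.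

(** The matrix [chi_o(dprod q)] is square, and its rows are independent by
    Dedekind's theorem since the [dprod q] span [A] over the ring of [ev p],
    on which all [chi_o] agree. *)
Lemma chi_matrix_regular (c : W -> K) :
    (forall o, o \in WS -> \sum_(q in WS) c q * chi o (dbase q) = 0) ->
  forall q, q \in WS -> c q = 0.
Proof.
move=> hc; pose N : 'M[K]_#|WS| := \matrix_(a, b) chi (enum_val a) (dbase (enum_val b)).
have Nfree : row_free N.
  rewrite -kermx_eq0; apply/eqP/row_matrixP => i0; rewrite row0; apply/rowP => j0.
  rewrite mxE [RHS]mxE; move: j0.
  apply: (dedekind_independence (chi := fun a : 'I_#|WS| => chi (enum_val a))) => [a b ab|u].
    apply: chi_dist; try exact: enum_valP.
    by apply: contra_neq ab => /enum_val_inj.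
  have [d /(dspan n_gt0) [p ->]] := spanning u.
  transitivity (\sum_(q in WS) h (ev (p q)) *
      \sum_(a < #|WS|) kermx N i0 a * chi (enum_val a) (dbase q)).
    under eq_bigr => a _ do rewrite rmorph_sum mulr_sumr.
    rewrite exchange_big /=; apply: eq_bigr => q _; rewrite mulr_sumr.
    by apply: eq_bigr => a _; rewrite rmorphM chi_ev ?enum_valP // mulrCA.
  rewrite big1 // => q qS; rewrite [X in _ * X](_ : _ = 0) ?mulr0 //.
  have := congr1 (fun M : 'M_(_, _) => M i0 (enum_rank_in qS q)) (mulmx_ker N).
  rewrite !mxE => hM; rewrite -[RHS]hM; apply: eq_bigr => a _; congr (_ * _).
  by rewrite mxE enum_rankK_in.
move=> q qS; pose cv : 'cV[K]_#|WS| := \col_b c (enum_val b).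
have : N *m cv = 0.
  apply/colP => a; rewrite !mxE -[RHS](hc (enum_val a)) ?enum_valP // [RHS]big_enum_val.
  by apply: eq_bigr => b _; rewrite !mxE mulrC.
have NU : N \in unitmx by rewrite -row_free_unit.
move/(congr1 (mulmx (invmx N))); rewrite mulKmx // mulmx0 => /colP /(_ (enum_rank_in qS q)).
by rewrite !mxE enum_rankK_in.
Qed.

(** Applying all chi_o to a relation gives a relation among the columns of the invertible matrix,
    with coefficients h(c_q(f)). *)
Lemma dprod_indep (c : W -> {mpoly F[r]}) :
  \sum_(q in WS) ev (c q) * dbase q = 0 -> forall q, q \in WS -> c q = 0.
Proof.
move=> c0 q qS; apply: ev_inj; move: q qS; apply: chi_matrix_regular => o oS.
have := congr1 (chi o) c0; rewrite rmorph0 rmorph_sum => e; rewrite -[RHS]e.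
by apply: eq_bigr => q _; rewrite rmorphM chi_ev.
Qed.

(** The index 0 gives the basis element 1. If all chi_o take the value h u at u, the coordinates of
    u and of the scalar h u agree under the matrix, so only the coordinate at 0 survives. *)
Lemma chi_invariant u : (forall o, o \in WS -> chi o u = h u) -> exists p, u = ev p.
Proof.
move=> hu; have [d /(dspan n_gt0) [c e]] := spanning u.
have zS : (0 : W) \in WS by rewrite esuppT; apply/forallP => i; rewrite ffunE Vprime0.
have d0 : dbase 0 = 1 by rewrite /dprod big1 // => i _; rewrite /dfactor ffunE eqxx.
have c0 q : q \in WS -> q != 0 -> c q = 0.
  move=> qS /negPf q0; apply: ev_inj.
  suff : forall q, q \in WS -> h (ev (c q)) - (if q == 0 then h u else 0) = 0.
    by move/(_ q qS); rewrite q0 subr0.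
  apply: chi_matrix_regular => o oS.
  under eq_bigr => q' _ do rewrite mulrBl.
  rewrite sumrB; apply/eqP; rewrite subr_eq0; apply/eqP.
  transitivity (chi o u).
    by rewrite [in RHS]e rmorph_sum; apply: eq_bigr => q' q'S; rewrite rmorphM chi_ev.
  rewrite (bigD1 (0 : W)) //= eqxx d0 rmorph1 mulr1 hu // big1 ?addr0 // => q' /andP[_ /negPf ->].
  by rewrite mul0r.
exists (c 0); rewrite e (bigD1 (0 : W)) //= d0 mulr1 big1 ?addr0 // => q /andP[qS q0].
by rewrite c0 // rmorph0 mul0r.
Qed.

End Separation.

(** * Product sets and decompositions *)

Section ProductBijections.
Variables (k : finFieldType) (n r : nat).
Hypothesis n_gt0 : (0 < n)%N.
Variables (A : comNzRingType) (D : 'I_r -> {fset A}) (d : 'I_r -> Vn k n r -> A).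
Local Notation W := {ffun 'I_r -> Vn k n r}.
Local Notation V' i := (Vprime k n i).
Local Notation esupp := (@esupp k n r).
Hypothesis DE : forall i y, y \in D i <-> exists2 w, w \in V' i & y = d i w.

Lemma mem_prodset_esupp I y :
  y \in prodset D I <-> exists2 o, o \in esupp I & y = \prod_(i in I) d i (o i).
Proof.
split=> [/mem_prodset [e he ->]|[o oI ->]]; last first.
  apply/mem_prodset; exists (fun i => d i (o i)) => // i iI.
  by apply/DE; exists (o i) => //; exact: esuppP oI iI.
have /fin_all_exists [w hw] i : exists w, i \in I -> w \in V' i /\ e i = d i w.
  case: (boolP (i \in I)) => [/he /DE [w wV ew]|_]; last by exists 0.
  by exists w.
exists [ffun i => if i \in I then w i else 0].
  rewrite inE; apply/forallP => i; rewrite ffunE; case: ifP => iI; rewrite iI //.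
  by case: (hw i iI).
by apply: eq_bigr => i iI; rewrite ffunE iI; case: (hw i iI).
Qed.

Hypothesis d_inj : {in esupp setT &, injective (fun o : W => \prod_i d i (o i))}.

Lemma esupp_setT (o : W) : (forall i, o i \in V' i) -> o \in esupp setT.
Proof. by move=> h; rewrite esuppT; apply/forallP. Qed.

Lemma mem_prodset_setT y :
  y \in prodset D setT <-> exists2 o, o \in esupp setT & y = \prod_i d i (o i).
Proof.
rewrite mem_prodset_esupp; split=> -[o oI ->]; exists o => //.
  by apply: eq_bigl => i; rewrite inE.
by apply: eq_bigl => i; rewrite inE.
Qed.

Lemma prod_bijective_of_inj : prod_bijective D.
Proof.
have lift (e : {ffun 'I_r -> A}) : (forall i, e i \in D i) ->
    exists2 o, o \in esupp setT & forall i, e i = d i (o i).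
  move=> he; have /fin_all_exists [w hw] i : exists w, w \in V' i /\ e i = d i w.
    by have /DE [w] := he i; exists w.
  exists [ffun i => w i]; last by move=> i; rewrite ffunE; case: (hw i).
  by apply: esupp_setT => i; rewrite ffunE; case: (hw i).
split=> [e he|e e' he he' E|y /mem_prodset_setT [o oS ->]].
- apply/mem_prodset; exists e; first by move=> i _; exact: he.
  by apply: eq_bigl => i; rewrite inE.
- have [o oS eo] := lift _ he; have [o' oS' eo'] := lift _ he'.
  suff oo : o = o' by apply/ffunP => i; rewrite eo eo' oo.
  apply: d_inj => //; have := E; rewrite (eq_bigr _ (fun i _ => eo i)).
  by rewrite [RHS](eq_bigr _ (fun i _ => eo' i)).
exists [ffun i => d i (o i)]; last by apply: eq_bigr => i _; rewrite ffunE.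
move=> i; rewrite ffunE; apply/DE; exists (o i) => //; exact: esuppP oS (in_setT i).
Qed.

Lemma card_of_inj i : #|` D i| = (#|k| ^ (r * (n - 1) + i))%N.
Proof.
rewrite -(@card_Vprime k n r n_gt0); apply: card_fset_image (DE i) => w w' wV w'V e.
(* Holding the other factors at index 0 deduces the injectivity of one factor from that of the whole
   product. *)
pose one (v : Vn k n r) : W := [ffun j => if j == i then v else 0].
have oneS v : v \in V' i -> one v \in esupp setT.
  move=> vV; apply: esupp_setT => j; rewrite ffunE; case: eqP => [->//|_].
  exact: Vprime0.
have oneE v : \prod_j d j (one v j) = d i v * \prod_(j | j != i) d j 0.
  rewrite (bigD1 i) //= ffunE eqxx; congr (_ * _); apply: eq_bigr => j /negPf ji.
  by rewrite ffunE ji.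
have /(d_inj (oneS _ wV) (oneS _ w'V)) /ffunP /(_ i) :
    \prod_j d j (one w j) = \prod_j d j (one w' j) by rewrite !oneE e.
by rewrite !ffunE eqxx.
Qed.

End ProductBijections.

Section Decompositions.
Variables (k : finFieldType) (n r : nat).
Hypothesis n_gt0 : (0 < n)%N.
Local Notation V := (Vn k n r).
Local Notation F := (ratfun k).
Variables (A : comNzRingType) (scal : {rmorphism F -> A}) (x : V -> A).
Local Notation W := {ffun 'I_r -> V}.
Local Notation WS := (esupp k n [set: 'I_r]).
Local Notation ev := (mmap scal (fsum x)).
Local Notation Xn i := (Xn k n i).
Local Notation V' i := (Vprime k n i).
Local Notation dbase := (@dprod k n r A x).
Local Notation dfactor := (@dfactor k n r A x).
Hypothesis spanning : forall u, exists d, Span scal x d u.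
Hypothesis d_indep : forall c : W -> {mpoly F[r]},
  \sum_(q in WS) ev (c q) * dbase q = 0 -> forall q, q \in WS -> c q = 0.
Variables (D E : 'I_r -> {fset A}).
Hypothesis DE : forall i y, y \in D i <-> exists2 w, w \in V' i & y = dfactor i w.
Hypothesis EE : forall i y, y \in E i <-> exists2 w, w \in V' i & y = x (Xn i + w).
Local Notation subalg I := (gen_subalg scal (fun y => exists2 i, i \in I & y = fsum x i)).

Lemma e_inj_setT : {in WS &, injective (fun o : W => \prod_i x (Xn i + o i))}.
Proof.
have e (o : W) : \prod_i x (Xn i + o i) = eprod x setT o.
  by rewrite /eprod; apply: eq_bigl => i; rewrite inE.
by move=> o o' oS o'S; rewrite !e; exact: (eprod_inj n_gt0 d_indep).
Qed.

Lemma free_basis : is_free_basis (subalg [set: 'I_r]) (prodset D setT).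
Proof.
have dinj := dprod_inj d_indep.
have DS := mem_prodset_setT DE.
have Tsupp (p : {mpoly F[r]}) : psupported setT p by move=> m _ i; rewrite inE.
split=> [u|c hc].
  have [d /(dspan n_gt0) [c ->]] := spanning u.
  (* Coefficients must be functions of the basis element rather than of its index; by injectivity
     the inner sum has one term for each basis element. *)
  exists (fun b => \sum_(q in WS | dbase q == b) ev (c q)).
    move=> b; apply/gen_subalgP; exists (\sum_(q in WS | dbase q == b) c q) => //.
    by rewrite rmorph_sum.
  rewrite (big_fset_image dinj DS); apply: eq_bigr => q qS.
  congr (_ * _); rewrite (big_pred1 q) // => q'; apply/andP/eqP => [[q'S /eqP]|->] //.
  exact: dinj.
rewrite (big_fset_image dinj DS) => c0.
have /fin_all_exists [p hp] q : exists p, c (dbase q) = ev p.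
  by have /gen_subalgP [p _ ->] := hc (dbase q); exists p.
have p0 : forall q, q \in WS -> p q = 0.
  by apply: d_indep; rewrite -[RHS]c0; apply: eq_bigr => q _; rewrite hp.
by move=> _ /DS [q qS ->]; rewrite -/(dprod x q) hp p0 // rmorph0.
Qed.

Lemma direct_sum : is_direct_sum (fun I : {set 'I_r} => prodset E I)
  (fun (I : {set 'I_r}) (e u : A) => exists2 c, subalg I c & u = c * e).
Proof.
have einj I := eprod_inj n_gt0 d_indep (I := I).
have ES := mem_prodset_esupp EE.
split=> [u|y hy].
  have [d /Span_coords [P [hP ->]]] := spanning u.
  exists (fun I e => (\sum_(o in esupp k n I | eprod x I o == e) ev (P I o)) * e).
    move=> I e _; exists (\sum_(o in esupp k n I | eprod x I o == e) ev (P I o)) => //.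
    apply/gen_subalgP; exists (\sum_(o in esupp k n I | eprod x I o == e) P I o).
      apply: (big_ind (psupported I)); [exact: psupported0|exact: psupportedD|].
      by move=> o _; case: (hP I o).
    by rewrite rmorph_sum.
  apply: eq_bigr => I _; rewrite (big_fset_image (einj I) (ES I)).
  apply: eq_bigr => o oI; congr (_ * _).
  rewrite (big_pred1 o) // => o'; apply/andP/eqP => [[o'I /eqP]|->] //.
  exact: einj.
move=> y0.
have ex (z : {set 'I_r} * W) : exists p : {mpoly F[r]}, z.2 \in esupp k n z.1 ->
    psupported z.1 p /\ y z.1 (eprod x z.1 z.2) = ev p * eprod x z.1 z.2.
  case: z => I o /=; case: (boolP (o \in esupp k n I)) => oI; last by exists 0.
  have /hy [_ /gen_subalgP [p ps ->] ->] : eprod x I o \in prodset E I.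
    by apply/ES; exists o.
  by exists p.
have [p hp] := fin_all_exists ex.
have p0 : forall I o, o \in esupp k n I -> p (I, o) = 0.
  apply: (e_indep n_gt0 d_indep (P := fun I o => p (I, o))) => [I o oI|].
    by case: (hp (I, o) oI).
  rewrite -[RHS]y0; apply: eq_bigr => I _; rewrite (big_fset_image (einj I) (ES I)).
  by apply: eq_bigr => o oI; case: (hp (I, o) oI) => _ ->.
move=> I e /ES [o oI ->]; case: (hp (I, o) oI) => _ /= ->.
by rewrite p0 // rmorph0 mul0r.
Qed.

End Decompositions.

(** * The structure of R_n *)

Section RnStructure.
Variables (k : finFieldType) (n r : nat).
Hypothesis n_gt0 : (0 < n)%N.
Local Notation V := (Vn k n r).
Local Notation F := (ratfun k).
Local Notation A := (Rn k n r).
Local Notation scal := (Rn_scal k n r).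
Local Notation x := (@recip k n r).
Local Notation W := {ffun 'I_r -> V}.
Local Notation WS := (esupp k n [set: 'I_r]).
Local Notation ev := (peval scal (fsum x)).
Local Notation Xn i := (Xn k n i).
Local Notation V' i := (Vprime k n i).

Lemma Rn_spanning (u : A) : exists d, Span scal x d u.
Proof.
apply: (Span_all n_gt0 (@recipZ k n r) (@recipM k n r) (@recip_torsion k n r)) => P.
exact: Rn_ind.
Qed.

(** For a generic level structure the images of the 1/(t^(n-1) X_i) are independent variables. By
    [Span_mprod] their monomials of degree d are combinations of the elements of the E_I with
    coefficients of degree at most d in the f_k, so the counting argument applies. *)
Lemma generic_point : exists (K : fieldType) (h : {rmorphism A -> K}),
  (forall u v, h (recip u) = h (recip v) -> u = v) /\ (forall p, h (ev p) = 0 -> p = 0).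
Proof.
have [K [j [lam [j_inj [lamD lamZ lam_inj lam_tors lamX]]]]] :=
  @generic_level_structure k n r n_gt0.
have [h [hc hx]] := @Rn_lift k n r K (j \o @mpolyC r F) lam lamD lamZ lam_inj lam_tors.
exists K, h; split=> [u v|p].
  rewrite !hx => /invr_inj e; apply/eqP; rewrite -subr_eq0; apply/eqP/lam_inj.
  by apply: (addIr (lam v)); rewrite -lamD subrK add0r.
(* Pairs that index no element of E_I get the value 0, so that the sum runs over a whole finite
   type. *)
pose e (z : {set 'I_r} * W) := h (if z.2 \in esupp k n z.1 then eprod x z.1 z.2 else 0).
rewrite /peval rmorph_ev; apply: (@alg_independent_by_counting F K (h \o scal) r (h \o fsum x) j
  ({set 'I_r} * W)%type e j_inj) => [m|c]; last by rewrite /= hc.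
have /Span_coords [P [hP eP]] := Span_mprod n_gt0 (@recipZ k n r) (@recipM k n r)
  (@recip_torsion k n r) (fun i => Ascale 'X^(n.-1) (Xn i)) m.
exists (fun z => P z.1 z.2); split=> [z|]; first by case: (hP z.1 z.2).
transitivity (h (\prod_i x (Ascale 'X^(n.-1) (Xn i)) ^+ m i)).
  rewrite mpolyXE_id !rmorph_prod; apply: eq_bigr => i _.
  by rewrite !rmorphXn hx lamX.
rewrite eP rmorph_sum.
transitivity (\sum_I \sum_o mmap (h \o scal) (h \o fsum x) (P I o) * e (I, o)); last first.
  by rewrite pair_bigA; apply: eq_bigr => -[].
apply: eq_bigr => I _; rewrite rmorph_sum [LHS]big_mkcond; apply: eq_bigr => o _.
by rewrite /e /=; case: ifP => _; rewrite ?rmorph0 ?mulr0 // rmorphM rmorph_ev.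
Qed.

Lemma act_fsum (g : 'M[Qn k n]_r) (gU : g \in unitmx) i : in_U g ->
  act gU (fsum x i) = fsum x i.
Proof.
move=> [_ gt]; rewrite -[RHS](unipotent_fsum n_gt0 gt) /fsum rmorph_sum.
by apply: eq_bigr => w _; rewrite /= act_recip.
Qed.

Lemma act_ev (g : 'M[Qn k n]_r) (gU : g \in unitmx) p : in_U g -> act gU (ev p) = ev p.
Proof.
move=> gI.
exact: (@rmorph_ev_fixed k r A scal (fsum x) (act gU) p (act_scal gU)
  (fun i => act_fsum gU i gI)).
Qed.

(** The matrix sending each X_i to X_i + o_i; for o_i in V'_i it lies in U, which yields as many
    characters as there are products in Delta_1 ... Delta_r. *)
Definition column_mx (o : W) : 'M[Qn k n]_r := \matrix_(l, i) (Xn i + o i) l.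

Lemma column_mx_Xn o i : GLmul (column_mx o) (Xn i) = Xn i + o i.
Proof.
have XnE (j l : 'I_r) : Xn j l = (l == j)%:R by rewrite ffunE.
apply/ffunP => l; rewrite ffunE (bigD1 i) //= mxE XnE eqxx mulr1 big1 ?addr0 //.
by move=> j /negPf ji; rewrite XnE ji mulr0.
Qed.

Lemma column_mx_U o : o \in WS -> in_U (column_mx o).
Proof.
rewrite esuppT => /forallP oV.
have h (i j : 'I_r) : (j <= i)%N -> (column_mx o i j : {poly k})`_0 = (i == j)%:R.
  move=> ji; rewrite mxE; have := vcoefD (Xn j) (o j) i 0; rewrite {1}/vcoef => ->.
  by rewrite vcoef_Xn // andbT; move/(mem_Vprime n_gt0): (oV j) => -> //; rewrite addr0.
by split; first exact: (unipotent_unit n_gt0 h).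
Qed.

Lemma unipotent_characters (K : fieldType) (h : {rmorphism A -> K}) :
  exists chi : W -> {rmorphism A -> K}, forall o (oU : column_mx o \in unitmx) u,
    chi o u = h (act oU u).
Proof.
have ex (o : W) : exists c : {rmorphism A -> K}, forall (oU : column_mx o \in unitmx) u,
    c u = h (act oU u).
  have [oU|oN] := pselect (column_mx o \in unitmx).
    exists (h \o act oU) => oU' u /=.
    by rewrite (bool_irrelevance oU oU').
  (* A default value: the matrix is invertible for every o in [WS]. *)
  by exists h => oU; case: (oN oU).
by have [chi hchi] := fin_all_exists ex; exists chi.
Qed.

Lemma Rn_main_facts :
  [/\ forall p, ev p = 0 -> p = 0,
      forall c : W -> {mpoly F[r]},
        \sum_(q in WS) ev (c q) * dprod x q = 0 -> forall q, q \in WS -> c q = 0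
    & forall u, U_invariant u -> exists p, u = ev p].
Proof.
have [K [h [h_inj ev_inj]]] := generic_point.
have [chi chiE] := unipotent_characters h.
have chi_ev o p : o \in WS -> chi o (ev p) = h (ev p).
  by move=> oS; have [oU oI] := column_mx_U oS; rewrite (chiE o oU) act_ev.
have chi_dist o o' : o \in WS -> o' \in WS -> o != o' -> exists u, chi o u != chi o' u.
  move=> oS oS' oo; have [oU _] := column_mx_U oS; have [oU' _] := column_mx_U oS'.
  have [i oi] : exists i, o i != o' i.
    apply/existsP; apply: contraR oo; rewrite negb_exists => /forallP e.
    by apply/eqP/ffunP => i; apply/eqP; have := e i; rewrite negbK.
  (* At 1/X_i the two characters are h(1/(X_i + o_i)) and h(1/(X_i + o'_i)), which differ because h
     separates reciprocals. *)
  exists (recip (Xn i)); rewrite (chiE o oU) (chiE o' oU') !act_recip !column_mx_Xn.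
  by apply: contra_neq oi => /h_inj /addrI.
split=> [p p0|c|u uU].
- by apply: ev_inj; rewrite p0 rmorph0.
- exact: (dprod_indep n_gt0 Rn_spanning chi_ev chi_dist ev_inj).
apply: (chi_invariant n_gt0 Rn_spanning chi_ev chi_dist ev_inj) => o oS.
by have [oU oI] := column_mx_U oS; rewrite (chiE o oU) uU.
Qed.

Lemma mem_Delta (i : 'I_r) (y : A) :
  y \in Delta k n i <-> exists2 w, w \in V' i & y = dfactor x i w.
Proof.
rewrite in_fset1U; split=> [/predU1P[->|/imfsetP[w /= /andP[wV w0] ->]]|[w wV ->]].
- by exists 0; rewrite ?Vprime0 // /dfactor eqxx.
- by exists w => //; rewrite /dfactor (negPf w0).
rewrite /dfactor; have [_|w0] := eqVneq w 0; first by rewrite eqxx.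
by apply/orP; right; apply/imfsetP; exists w => //; apply/andP; split.
Qed.

Lemma mem_Eset (i : 'I_r) (y : A) :
  y \in Eset k n i <-> exists2 w, w \in V' i & y = recip (Xn i + w).
Proof. by split=> [/imfsetP[w /= wV ->]|[w wV ->]]; [exists w|apply/imfsetP; exists w]. Qed.

End RnStructure.

Theorem theorem3p2p15 (k : finFieldType) (n r : nat) (hn : (0 < n)%N) (hr : (0 < r)%N) :
  [/\ (* (a) *) alg_independent (Rn_scal k n r) (@fgen k n r),
      (* (b) *) forall i : 'I_r,
        #|` Delta k n i| = (#|k| ^ (r * (n - 1) + i))%N /\
        #|` Eset k n i| = (#|k| ^ (r * (n - 1) + i))%N,
      (* (c) *) prod_bijective (@Delta k n r) /\ prod_bijective (@Eset k n r),
      (* (d) *) is_free_basis (@Falg k n r setT) (prodset (@Delta k n r) setT)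
    & (* (e) *) (forall x : Rn k n r, U_invariant x <-> Falg setT x) /\
      (* (f) *) is_direct_sum (fun I : {set 'I_r} => prodset (@Eset k n r) I)
        (fun (I : {set 'I_r}) (e x : Rn k n r) => exists2 c, Falg I c & x = c * e)].
Proof.
have [ev_inj d_indep invariants] := @Rn_main_facts k n r hn.
have d_inj := dprod_inj d_indep.
have e_inj := e_inj_setT hn d_indep.
have spanning := @Rn_spanning k n r hn.
split.
- exact: ev_inj.
- move=> i; split; first exact: (card_of_inj hn (@mem_Delta k n r hn) d_inj).
  exact: (card_of_inj hn (@mem_Eset k n r) e_inj).
- split; first exact: (prod_bijective_of_inj (@mem_Delta k n r hn) d_inj).
  exact: (prod_bijective_of_inj (@mem_Eset k n r) e_inj).
- exact: (free_basis hn spanning d_indep (@mem_Delta k n r hn)).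
split; last exact: (direct_sum hn spanning d_indep (@mem_Eset k n r)).
move=> u; split=> [/invariants [p ->]|/gen_subalgP [p _ ->] g gU gI].
  by apply/gen_subalgP; exists p => // m _ i; rewrite inE.
exact: (act_ev hn gU p gI).
Qed.
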